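(* There is an absolute constant $C>0$ such that the following holds. Let $n,d,q\ge1$ be integers, $\mathbf{x}_1,\dots,\mathbf{x}_n\in\mathbb{R}^d$, $\mathbf{y}\in\mathbb{R}^n$, $\lambda>0$, $\epsilon>0$ and $\delta\in(0,1)$. Let $\mathbf{K}\in\mathbb{R}^{n\times n}$ be the kernel matrix of the degree-$q$ homogeneous polynomial kernel $k(\mathbf{x},\mathbf{z})=(\mathbf{x}^T\mathbf{z})^q$, i.e. $\mathbf{K}_{ij}=k(\mathbf{x}_i,\mathbf{x}_j)$, and let $s_\lambda(\mathbf{K})=\mathrm{Tr}\left((\mathbf{K}+\lambda \mathbf{I}_n)^{-1}\mathbf{K}\right)$. Assume that $\|\mathbf{K}\|_2\ge\lambda$. Let $\varphi:\mathbb{R}^d\to\mathbb{R}^{s_1}$ be a random TensorSketch map of degree $q$, where $s_1$ is a power of $2$ with $$s_1\ge 32(2+3^q)\,s_\lambda(\mathbf{K})^2/\delta,$$ and let $\mathbf{S}_2\in\mathbb{R}^{s_2\times s_1}$ be a subsampled randomized Walsh-Hadamard transform (SRHT), independent of $\varphi$, with $$s_2\ge C\, s_\lambda(\mathbf{K})\log(2+s_\lambda(\mathbf{K}))/\delta^2.$$ Let $\mathbf{z}_i=\mathbf{S}_2\varphi(\mathbf{x}_i)\in\mathbb{R}^{s_2}$ for $i=1,\dots,n$, and let $\mathbf{Z}_2\in\mathbb{R}^{n\times s_2}$ have rows $\mathbf{z}_1^T,\dots,\mathbf{z}_n^T$. Let $\mathbf{c}$ be the exact solution of $(\mathbf{K}+\lambda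 \mathbf{I}_n)\mathbf{c}=\mathbf{y}$. Then, with probability at least $1-\delta$, after $$T=\left\lceil \frac{\sqrt3}{2}\ln(2/\epsilon)\right\rceil$$ iterations of the preconditioned conjugate gradient method (PCG) on the system $(\mathbf{K}+\lambda \mathbf{I}_n)\mathbf{c}=\mathbf{y}$, starting from the all-zeros vector and with $\mathbf{Z}_2\mathbf{Z}_2^T+\lambda \mathbf{I}_n$ as a preconditioner, one obtains a vector $\tilde{\mathbf{c}}$ such that $$\|\tilde{\mathbf{c}}-\mathbf{c}\|_{\mathbf{K}+\lambda \mathbf{I}_n}\le \epsilon\,\|\mathbf{c}\|_{\mathbf{K}+\lambda \mathbf{I}_n}.$$
   Context: For a symmetric positive definite matrix $\mathbf{A}$, $\|\mathbf{x}\|_{\mathbf{A}}=\sqrt{\mathbf{x}^T\mathbf{A}\mathbf{x}}$; $\|\cdot\|_2$ is the spectral norm. Write $[m]=\{1,\dots,m\}$. TensorSketch (with $s_1$ features). Let $h_1,\dots,h_q:[d]\to[s_1]$ be $3$-wise independent (uniform) random hash functions and $g_1,\dots,g_q:[d]\to\{+1,-1\}$ be $4$-wise independent (uniform) random sign functions, all $2q$ functions chosen independently of each other. Define $H:[d]^q\to[s_1]$ and $G:[d]^q\to\{+1,-1\}$ by $$H(i_1,\dots,i_q)\equiv h_1(i_1)+\cdots+h_q(i_q) \bmod s_1,\qquad G(i_1,\dots,i_q)=g_1(i_1)g_2(i_2)\cdots g_q(i_q),$$ where residues mod $s_1$ are identified with $[s_1]$. The TensorSketch matrix $\mathbf{S}_1\in\mathbb{R}^{s_1\times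 d^q}$ has columns indexed by $[d]^q$, and its column $(i_1,\dots,i_q)$ is $G(i_1,\dots,i_q)\,\mathbf{e}_{H(i_1,\dots,i_q)}$, with $\mathbf{e}_j$ the $j$-th standard basis vector of $\mathbb{R}^{s_1}$. Let $v_q:\mathbb{R}^d\to\mathbb{R}^{d^q}$ map $\mathbf{x}$ to the vector with entries $x_{i_1}\cdots x_{i_q}$ indexed by $(i_1,\dots,i_q)\in[d]^q$. The TensorSketch map is $\varphi(\mathbf{x})=\mathbf{S}_1v_q(\mathbf{x})$. SRHT. For $m$ a power of $2$, the Walsh-Hadamard matrix is defined recursively by $\mathbf{H}_2=\begin{pmatrix}1&1\\1&-1\end{pmatrix}$ and $\mathbf{H}_m=\begin{pmatrix}\mathbf{H}_{m/2}&\mathbf{H}_{m/2}\\ \mathbf{H}_{m/2}&-\mathbf{H}_{m/2}\end{pmatrix}$. An $s\times m$ SRHT is a random matrix $\frac{1}{\sqrt{s}}\mathbf{P}\mathbf{H}_m\mathbf{D}$, where $\mathbf{D}$ is a random $m\times m$ diagonal matrix whose diagonal entries are independent uniform random signs and $\mathbf{P}\in\mathbb{R}^{s\times m}$ is a random sampling matrix, independent of $\mathbf{D}$: its rows are (transposed) standard basis vectors of $\mathbb{R}^m$ drawn independently and uniformly at random. PCG is considered in exact arithmetic. For a positive definite system $\mathbf{A}\mathbf{c}=\mathbf{y}$ with positive definite preconditioner $\mathbf{M}$ and zero initial vector, the $t$-th PCG iterate is the minimizer of $\|\mathbf{x}-\mathbf{c}\|_{\mathbf{A}}$ over $\mathbf{x}$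 in the Krylov subspace $\mathrm{span}\{(\mathbf{M}^{-1}\mathbf{A})^j\mathbf{M}^{-1}\mathbf{y}: 0\le j<t\}$. (For $t\le 0$ the iterate is the zero initial vector.) *)

(* Defs.v *)
From HB Require Import structures.
From mathcomp Require Import all_boot all_order all_algebra.
From mathcomp Require Import all_classical all_reals all_analysis.

Set Implicit Arguments.
Unset Strict Implicit.
Unset Printing Implicit Defensive.

Import Order.TTheory GRing.Theory Num.Theory.
Local Open Scope classical_set_scope.
Local Open Scope ring_scope.

Section LinearAlgebra.
Context {R : realType}.

Definition l2norm n (x : 'cV[R]_n) : R := Num.sqrt ((x^T *m x) 0 0).

Definition spectral_norm m n (A : 'M[R]_(m, n)) : R :=
  sup [set l2norm (A *m x) | x in [set x : 'cV[R]_n | l2norm x <= 1]].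

Definition energy_norm n (A : 'M[R]_n) (x : 'cV[R]_n) : R :=
  Num.sqrt ((x^T *m A *m x) 0 0).

Definition poly_kernel d (q : nat) (x z : 'cV[R]_d) : R :=
  ((x^T *m z) 0 0) ^+ q.

Definition kernel_matrix n d (q : nat) (x : 'I_n -> 'cV[R]_d) : 'M[R]_n :=
  \matrix_(i, j) poly_kernel q (x i) (x j).

Definition statistical_dim n (lambda : R) (K : 'M[R]_n) : R :=
  \tr (invmx (K + lambda%:M) *m K).

Definition krylov n (A M : 'M[R]_n) (y : 'cV[R]_n) (t : int) :
    {vspace 'cV[R]_n} :=
  <<[seq (invmx M *m A) ^+ j *m (invmx M *m y)
       | j <- iota 0 (if t is Posz m then m else 0)]>>%VS.

(* In exact arithmetic, for A and M positive definite and a zero initial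
   vector; the minimizer then exists and is unique. *)
Definition pcg_iterate n (A M : 'M[R]_n) (y : 'cV[R]_n) (t : int)
    (x : 'cV[R]_n) : Prop :=
  let c := invmx A *m y in
  x \in krylov A M y t /\
  forall x', x' \in krylov A M y t ->
    energy_norm A (x - c) <= energy_norm A (x' - c).

Lemma addn_exp2 k : (2 ^ k + 2 ^ k = 2 ^ k.+1)%N.
Proof. by rewrite addnn -mul2n -expnS. Qed.

(* The 1 x 1 matrix (1) is taken as the base case, so that [hadamard 1] is
   the usual 2 x 2 matrix. *)
Fixpoint hadamard (k : nat) : 'M[R]_(2 ^ k) :=
  if k is k'.+1 then
    castmx (addn_exp2 k', addn_exp2 k')
      (block_mx (hadamard k') (hadamard k') (hadamard k') (- hadamard k'))
  else 1%:M.

End LinearAlgebra.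

(* Random elements with values in a type carrying the discrete sigma-algebra;
   all those used below take finitely many values. *)
Section Probability.
Context {R : realType} {disp : measure_display} {T : measurableType disp}.
Variable P : probability T R.

Definition random_element (U : Type) (X : T -> U) : Prop :=
  forall A : set U, measurable (X @^-1` A).

Definition indep_over (I : finType) (J : {set I}) (U : I -> Type)
    (X : forall i, T -> U i) : Prop :=
  forall A : forall i, set (U i),
    P [set w | forall i, i \in J -> A i (X i w)] =
    (\prod_(i in J) P (X i @^-1` A i))%E.

Definition mutual_indep (I : finType) (U : I -> Type)
    (X : forall i, T -> U i) : Prop :=
  forall J : {set I}, indep_over J X.

Definition kwise_indep (k : nat) (I : finType) (U : I -> Type)
    (X : forall i, T -> U i) : Prop :=
  forall J : {set I}, (#|J| <= k)%N -> indep_over J X.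

Definition indep2 (U V : Type) (X : T -> U) (Y : T -> V) : Prop :=
  forall (A : set U) (B : set V),
    P ((X @^-1` A) `&` (Y @^-1` B)) = (P (X @^-1` A) * P (Y @^-1` B))%E.

Definition uniform (B : finType) (X : T -> B) : Prop :=
  forall b : B, P (X @^-1` [set b]) = (#|B|%:R^-1)%:E.

Definition with_probability_ge (p : R) (E : set T) : Prop :=
  measurable E /\ (p%:E <= P E)%E.

End Probability.

(* A sign is encoded by a Boolean b, standing for (-1)^b. *)
Section TensorSketch.
Context {R : realType}.

Local Notation multi_index d q := {ffun 'I_q -> 'I_d}.

Definition tensor_power d (q : nat) (x : 'cV[R]_d) :
    'cV[R]_(#|multi_index d q|) :=
  \col_I \prod_(j < q) x ((enum_val I : multi_index d q) j) 0.

(* Residues mod s are identified with 'I_s; the (r, I) entry is G(I) when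
   r = H(I), and 0 otherwise. *)
Definition tensor_sketch_mx d q s (h : 'I_q -> {ffun 'I_d -> 'I_s})
    (g : 'I_q -> {ffun 'I_d -> bool}) : 'M[R]_(s, #|multi_index d q|) :=
  \matrix_(r, I)
    ((\prod_(j < q) (-1) ^+ g j ((enum_val I : multi_index d q) j)) *
     (val r == ((\sum_(j < q) h j ((enum_val I : multi_index d q) j)) %% s)%N)%:R).

Definition hash_sign_family (T : Type) d q s
    (h : 'I_q -> T -> {ffun 'I_d -> 'I_s})
    (g : 'I_q -> T -> {ffun 'I_d -> bool}) (i : 'I_q + 'I_q) :
    T -> {ffun 'I_d -> if i is inl _ then 'I_s else bool} :=
  match i with inl j => h j | inr j => g j end.

Definition is_tensor_sketch disp (T : measurableType disp)
    (P : probability T R) (d q s : nat) (phi : T -> 'cV[R]_d -> 'cV[R]_s) :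
    Prop :=
  exists (h : 'I_q -> T -> {ffun 'I_d -> 'I_s})
         (g : 'I_q -> T -> {ffun 'I_d -> bool}),
  [/\ (forall j, random_element (h j)) /\ (forall j, random_element (g j)),
      forall j, (forall i, uniform P (fun w => h j w i)) /\
                kwise_indep P 3 (fun i w => h j w i),
      forall j, (forall i, uniform P (fun w => g j w i)) /\
                kwise_indep P 4 (fun i w => g j w i),
      mutual_indep P (hash_sign_family h g) &
      forall w x, phi w x =
        tensor_sketch_mx (h ^~ w) (g ^~ w) *m tensor_power q x].

End TensorSketch.

Section SRHT.
Context {R : realType}.

Definition sign_mx m (b : {ffun 'I_m -> bool}) : 'M[R]_m :=
  diag_mx (\row_i (-1) ^+ b i).

Definition sampling_mx s m (p : {ffun 'I_s -> 'I_m}) : 'M[R]_(s, m) :=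
  \matrix_(i, j) (j == p i)%:R.

Definition is_srht disp (T : measurableType disp) (P : probability T R)
    (s k : nat) (S : T -> 'M[R]_(s, 2 ^ k)) : Prop :=
  exists (b : T -> {ffun 'I_(2 ^ k) -> bool})
         (p : T -> {ffun 'I_s -> 'I_(2 ^ k)}),
  [/\ random_element b /\ random_element p,
      (forall i, uniform P (fun w => b w i)) /\
        mutual_indep P (fun i w => b w i),
      (forall i, uniform P (fun w => p w i)) /\
        mutual_indep P (fun i w => p w i),
      indep2 P b p &
      forall w, S w = (Num.sqrt s%:R)^-1 *:
        (sampling_mx (p w) *m hadamard k *m sign_mx (b w))].

End SRHT.

(* Main.v *)
Require Import Defs.
From HB Require Import structures.
From mathcomp Require Import all_boot all_order all_algebra.
From mathcomp Require Import all_classical all_reals all_analysis.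
From mathcomp Require Import ring lra zify.

(**
The preconditioner is [M = Z2 Z2^T + lambda] for the system matrix
[A = K + lambda], where [K = V V^T] and the rows of [V] are the tensor powers of
the data. Choose [L] with [L A L^T = 1] ([cholesky]). Then [B = L V] satisfies
[B B^T <= 1], and the squared Frobenius norm of [B] is the statistical dimension
[sl] ([statistical_dimE]); the assumption [lambda <= ||K||] forces [sl >= 1/2]
([statistical_dim_ge_half]). If the two random stages change [B B^T] by at most
[1/4] each in operator norm, then [A / 2 <= M <= 3 A / 2], the condition number
is at most [3], and conjugate gradients converge at the Chebyshev rate.

TensorSketch. The error of a sketched inner product of [u] and [v] is a sum over
pairs of distinct multi-indices. In its second moment the signs keep only the
quadruples of multi-indices that pair up in every coordinate, a collision costs
[1 / s1], and induction on the degree bounds the rest by [3^q |u|^2 |v|^2]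
([paired_sum], [cross_moment]). Summing over the rows of [B] bounds the expected
squared Frobenius error and the variance of the trace by [3^q sl^2 / s1]
([sketch_failure]). So the sketched [B1] has [B1 B1^T <= 2] and squared
Frobenius norm at most [2 sl].

SRHT. The sample covariance of [s2] rows has to be compared with [B1 B1^T]
without any factor depending on the dimensions. Given the signs, the even trace
moments of the deviation are estimated by exchanging one draw with an
independent copy; a convexity inequality for traces [tr (H A^j H B^(N - j))]
gives a recursion with ratio about [r L / s2] for vectors of squared length at
most [L] ([trace_young], [sample_moment]). Rows longer than [L] are cut off.
Each row is a Rademacher sum whose moments are Gaussian-like
([sign_sum_moment]), so with [L] of order [sl + r] the energy cut off is
exponentially small in [r] ([srht_failure]). The base of these moments is a
trace, not the dimension, so taking [r] of order [ln (2 + sl) / delta] makes the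
failure probability a small multiple of [delta] ([srht_parameters]).

No spectral theorem is used: operator norms are read off traces of powers of
two by repeated Cauchy-Schwarz ([qform_le_trace_pow2]), and the Chebyshev bound
comes from the Pell identity [T^2 - (e^2 - 1) U^2 = 1] read in the inner product
of [A] ([cheb_energy_le]).

Probability. All random elements take finitely many values, so the expectations
above are finite sums. The failure of the second stage is bounded conditionally
on each value of the sketch ([indep2_conditional_le]); [5/8] of [delta] is spent
on the sketch and [3/8] on the transform.
*)

Set Implicit Arguments.
Unset Strict Implicit.
Unset Printing Implicit Defensive.

Import Order.TTheory GRing.Theory Num.Theory.
Local Open Scope classical_set_scope.
Local Open Scope ring_scope.

(** * The Hilbert-Schmidt inner product and quadratic forms *)

Section HilbertSchmidt.
Context {R : realFieldType}.

Definition hs m n (X Y : 'M[R]_(m, n)) : R := \tr (X^T *m Y).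

Lemma hsE m n (X Y : 'M[R]_(m, n)) : hs X Y = \sum_i \sum_j X i j * Y i j.
Proof.
rewrite /hs /mxtrace exchange_big /=; apply: eq_bigr => j _.
by rewrite mxE; apply: eq_bigr => i _; rewrite mxE.
Qed.

Lemma hsC m n (X Y : 'M[R]_(m, n)) : hs X Y = hs Y X.
Proof.
by rewrite !hsE; do 2 (apply: eq_bigr => ? _); rewrite mulrC.
Qed.

Lemma hsDl m n (X Y Z : 'M[R]_(m, n)) : hs (X + Y) Z = hs X Z + hs Y Z.
Proof. by rewrite /hs linearD mulmxDl mxtraceD. Qed.

Lemma hsDr m n (X Y Z : 'M[R]_(m, n)) : hs Z (X + Y) = hs Z X + hs Z Y.
Proof. by rewrite hsC hsDl !(hsC Z). Qed.

Lemma hsZl m n a (X Y : 'M[R]_(m, n)) : hs (a *: X) Y = a * hs X Y.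
Proof. by rewrite /hs linearZ -scalemxAl mxtraceZ. Qed.

Lemma hsZr m n a (X Y : 'M[R]_(m, n)) : hs X (a *: Y) = a * hs X Y.
Proof. by rewrite hsC hsZl hsC. Qed.

Lemma hsNl m n (X Y : 'M[R]_(m, n)) : hs (- X) Y = - hs X Y.
Proof. by rewrite -scaleN1r hsZl mulN1r. Qed.

Lemma hsNr m n (X Y : 'M[R]_(m, n)) : hs X (- Y) = - hs X Y.
Proof. by rewrite hsC hsNl hsC. Qed.

Lemma hs0l m n (X : 'M[R]_(m, n)) : hs 0 X = 0.
Proof. by rewrite -(scale0r X) hsZl mul0r. Qed.

Lemma hs_suml m n (I : finType) (X : I -> 'M[R]_(m, n)) Y :
  hs (\sum_i X i) Y = \sum_i hs (X i) Y.
Proof. by rewrite /hs linear_sum mulmx_suml raddf_sum. Qed.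

Lemma hs_ge0 m n (X : 'M[R]_(m, n)) : 0 <= hs X X.
Proof.
by rewrite hsE; apply: sumr_ge0 => i _; apply: sumr_ge0 => j _; rewrite -expr2 sqr_ge0.
Qed.

Lemma hs_eq0 m n (X : 'M[R]_(m, n)) : hs X X = 0 -> X = 0.
Proof.
move=> X0; apply/matrixP => i j; rewrite mxE.
have h a b : 0 <= X a b * X a b by rewrite -expr2 sqr_ge0.
move: X0; rewrite hsE => /eqP; rewrite psumr_eq0; last by move=> a _; exact: sumr_ge0.
move=> /allP/(_ i (mem_index_enum _))/=; rewrite psumr_eq0 //.
by move=> /allP/(_ j (mem_index_enum _))/=; rewrite mulf_eq0 orbb => /eqP.
Qed.

Lemma hs_gt0 m n (X : 'M[R]_(m, n)) : X != 0 -> 0 < hs X X.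
Proof.
by move=> X0; rewrite lt_neqAle hs_ge0 andbT eq_sym; apply: contra X0 => /eqP/hs_eq0 ->.
Qed.

Lemma hs_young m n (X Y : 'M[R]_(m, n)) : 2 * hs X Y <= hs X X + hs Y Y.
Proof.
have := hs_ge0 (X - Y); rewrite !(hsDl, hsDr, hsNl, hsNr) (hsC Y X); lra.
Qed.

Lemma hs_cauchy m n (X Y : 'M[R]_(m, n)) : hs X Y ^+ 2 <= hs X X * hs Y Y.
Proof.
have [->|Y0] := eqVneq Y 0; first by rewrite hsC !hs0l mulr0 expr0n.
have yy := hs_gt0 Y0.
have := hs_ge0 (hs Y Y *: X - hs X Y *: Y).
rewrite !(hsDl, hsDr, hsNl, hsNr, hsZl, hsZr) (hsC Y X) => h.
rewrite -subr_ge0 -(pmulr_lge0 _ yy); apply: le_trans h _; lra.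
Qed.

Lemma hs_mulmx m n p (X : 'M[R]_(m, n)) (Y : 'M[R]_(n, p)) (Z : 'M[R]_(m, p)) :
  hs (X *m Y) Z = hs Y (X^T *m Z).
Proof. by rewrite /hs trmx_mul mulmxA. Qed.

Lemma hs_trmx m n (X Y : 'M[R]_(m, n)) : hs X^T Y^T = hs X Y.
Proof. by rewrite /hs trmxK mxtrace_mulC -mxtrace_tr trmx_mul trmxK. Qed.

(** Every entry of the product is an inner product of a row and a column. *)
Lemma hs_mulmx_le m n p (X : 'M[R]_(m, n)) (Y : 'M[R]_(n, p)) :
  hs (X *m Y) (X *m Y) <= hs X X * hs Y Y.
Proof.
rewrite hsE -(hs_trmx Y) !hsE mulr_suml; apply: ler_sum => i _.
rewrite mulr_sumr; apply: ler_sum => j _.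
have := hs_cauchy (row i X) (col j Y)^T.
rewrite !hsE !big_ord1 => h; rewrite -expr2 mxE.
rewrite (eq_bigr (fun k => row i X 0 k * (col j Y)^T 0 k)); last by move=> k _; rewrite !mxE.
apply: le_trans h _; rewrite le_eqVlt; apply/orP; left; apply/eqP; congr (_ * _).
  by apply: eq_bigr => k _; rewrite !mxE.
by apply: eq_bigr => k _; rewrite !mxE.
Qed.

Definition qform n (A : 'M[R]_n) (x : 'cV[R]_n) : R := (x^T *m A *m x) 0 0.

Definition qform_le n (A B : 'M[R]_n) := forall x, qform A x <= qform B x.

Lemma qformE n (A : 'M[R]_n) x : qform A x = hs x (A *m x).
Proof. by rewrite /hs trace_mx11 mulmxA. Qed.

Lemma qformD n (A B : 'M[R]_n) x : qform (A + B) x = qform A x + qform B x.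
Proof. by rewrite !qformE mulmxDl hsDr. Qed.

Lemma qformZ n a (A : 'M[R]_n) x : qform (a *: A) x = a * qform A x.
Proof. by rewrite !qformE -scalemxAl hsZr. Qed.

Lemma qformN n (A : 'M[R]_n) x : qform (- A) x = - qform A x.
Proof. by rewrite -scaleN1r qformZ mulN1r. Qed.

Lemma qform_scalar n (a : R) (x : 'cV[R]_n) : qform a%:M x = a * hs x x.
Proof. by rewrite qformE mul_scalar_mx hsZr. Qed.

Lemma qform_sum n (I : finType) (A : I -> 'M[R]_n) x :
  qform (\sum_i A i) x = \sum_i qform (A i) x.
Proof. by rewrite qformE mulmx_suml hsC hs_suml; apply: eq_bigr => i _; rewrite hsC qformE. Qed.

Lemma qform_gram m n (X : 'M[R]_(m, n)) x : qform (X^T *m X) x = hs (X *m x) (X *m x).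
Proof. by rewrite qformE hs_mulmx mulmxA. Qed.

Lemma qform_gram_tr m n (X : 'M[R]_(n, m)) x : qform (X *m X^T) x = hs (X^T *m x) (X^T *m x).
Proof. by rewrite -{1}(trmxK X) qform_gram. Qed.

Lemma qform_mulmx m n (X : 'M[R]_(m, n)) (A : 'M[R]_m) x :
  qform (X^T *m A *m X) x = qform A (X *m x).
Proof. by rewrite !qformE hs_mulmx !mulmxA. Qed.

Lemma qform_sandwich m n (X : 'M[R]_(n, m)) (A : 'M[R]_m) x :
  qform (X *m A *m X^T) x = qform A (X^T *m x).
Proof. by rewrite -{1}(trmxK X) qform_mulmx. Qed.

Lemma tr_form_le m n (A : 'M[R]_m) b (X : 'M[R]_(m, n)) :
  qform_le A b%:M -> hs X (A *m X) <= b * hs X X.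
Proof.
move=> Ab.
have hs_cols (Z : 'M[R]_(m, n)) : hs X Z = \sum_j hs (col j X) (col j Z).
  rewrite hsE exchange_big; apply: eq_bigr => j _; rewrite hsE.
  by apply: eq_bigr => i _; rewrite big_ord1 !mxE.
rewrite !hs_cols mulr_sumr; apply: ler_sum => j _.
by rewrite -qform_scalar (colE j (A *m X)) -mulmxA -colE -qformE.
Qed.

Lemma gram_le_trace m n (X : 'M[R]_(m, n)) x :
  qform (X *m X^T) x <= hs X X * hs x x.
Proof. by rewrite qform_gram_tr; apply: le_trans (hs_mulmx_le _ _) _; rewrite hs_trmx. Qed.

Lemma hs_trE m n (X : 'M[R]_(m, n)) : hs X X = \tr (X *m X^T).
Proof. by rewrite /hs mxtrace_mulC. Qed.

End HilbertSchmidt.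

Section TraceInequalities.
Context {R : realFieldType}.

Lemma trmx_exp n (A : 'M[R]_n) j : A^T = A -> (A ^+ j)^T = A ^+ j.
Proof.
by move=> sA; elim: j => [|j IH]; rewrite ?trmx1 // exprS -mulmxE trmx_mul IH sA mulmxE -exprSr exprS.
Qed.

(** A midpoint-convex sequence attains its maximum at an end. *)
Lemma convex_seq_le (m : nat) (g : nat -> R) :
  (forall a, 0 <= g a) ->
  (forall a, (a.+2 <= m)%N -> 2 * g a.+1 <= g a + g a.+2) ->
  forall a, (a <= m)%N -> g a <= g 0%N + g m.
Proof.
move=> g0 gc a am.
elim: m gc a am => [|m IH] gc a am; first by move: am; rewrite leqn0 => /eqP->; rewrite lerDl.
have gcm b : (b.+2 <= m)%N -> 2 * g b.+1 <= g b + g b.+2 by move=> bm; apply: gc; exact: leqW.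
move: am; rewrite leq_eqVlt => /orP[/eqP->|]; first by rewrite lerDr.
rewrite ltnS => am; have [le_m|lt_m] := leP (g m) (g m.+1).
  by apply: le_trans (IH gcm a am) _; rewrite lerD2l.
(* The last step goes down, so by convexity every earlier step does. *)
have down k : (k <= m)%N -> g (m - k).+1 <= g (m - k)%N.
  elim: k => [|k IHk] km; first by rewrite subn0 ltW.
  have := IHk (ltnW km); have := gc (m - k.+1)%N.
  by rewrite -subSn // subSS ltnS leq_subr => /(_ isT); lra.
have le0 b : (b <= m)%N -> g b <= g 0%N.
  elim: b => [|b IHb] bm; first by [].
  apply: le_trans (IHb (ltnW bm)).
  by have := down (m - b)%N (leq_subr _ _); rewrite subKn // ltnW.
by apply: le_trans (le0 a am) _; rewrite lerDl.
Qed.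

(** With [H] in between, the traces [\tr (H A^j H B^(N - j))] interpolate
between their values at [j = 0] and [j = N]: by the Hilbert-Schmidt inner
product they form a midpoint-convex sequence along even [j], and odd [j] lie
below the mean of their two neighbours. *)
Lemma trace_young n (A B H : 'M[R]_n) (m j : nat) :
  A^T = A -> B^T = B -> H^T = H -> (j <= m.*2)%N ->
  \tr (H * A ^+ j * H * B ^+ (m.*2 - j)) <=
  \tr (H * H * A ^+ m.*2) + \tr (H * H * B ^+ m.*2).
Proof.
move=> sA sB sH jm.
pose X a b := A ^+ a * H * B ^+ b.
have hsX a b a' b' : hs (X a b) (X a' b') = \tr (H * A ^+ (a + a') * H * B ^+ (b + b')).
  rewrite /hs /X -!mulmxE !trmx_mul !trmx_exp // sH (addnC b) !exprD -!mulmxE.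
  by rewrite -!mulmxA mxtrace_mulC !mulmxA.
have hs2 a b a' b' : 2 * hs (X a b) (X a' b') <=
    \tr (H * A ^+ a.*2 * H * B ^+ b.*2) + \tr (H * A ^+ a'.*2 * H * B ^+ b'.*2).
  by rewrite -!addnn -!hsX; exact: hs_young.
pose g a := \tr (H * A ^+ a.*2 * H * B ^+ (m.*2 - a.*2)).
have gE a b : (a + b)%N = m -> g a = \tr (H * A ^+ a.*2 * H * B ^+ b.*2).
  by rewrite /g => <-; rewrite doubleD addKn.
have g_ge0 a : (a <= m)%N -> 0 <= g a.
  by move=> am; rewrite (gE a (m - a)%N) ?subnKC // -!addnn -hsX hs_ge0.
have gend a : (a <= m)%N -> g a <= g 0%N + g m.
  pose g' a := if (a <= m)%N then g a else 0.
  move=> am; have := @convex_seq_le m g' _ _ a am; rewrite /g' am leq0n leqnn; apply.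
    by move=> b; case: ifP => // /g_ge0.
  move=> b bm; rewrite bm (ltnW bm) (ltnW (ltnW bm)).
  have [c mE] : exists c, m = (b + c.+2)%N.
    by exists (m - b.+2)%N; lia.
  rewrite (gE b c.+2) // (gE b.+1 c.+1) ?(gE b.+2 c); [|lia|lia].
  have -> : (b.+1.*2 = b + b.+2)%N by lia.
  have -> : (c.+1.*2 = c.+2 + c)%N by lia.
  by rewrite -hsX; exact: hs2.
have g0m : g 0%N + g m = \tr (H * H * A ^+ m.*2) + \tr (H * H * B ^+ m.*2).
  rewrite /g subnn subn0 !expr0 !mulr1 addrC -!mulmxE; congr (_ + _).
  by rewrite mxtrace_mulC mulmxA.
rewrite -g0m; move: jm; rewrite -(odd_double_half j); move: j./2 => a.
case: (odd j) => /=; rewrite ?add1n ?add0n; last by rewrite leq_double => /gend.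
rewrite ltn_double => am.
have [c mE] : exists c, m = (a + c.+1)%N by exists (m - a.+1)%N; lia.
have := hs2 a c.+1 a.+1 c; rewrite -gE // -gE; last by lia.
rewrite hsX.
have -> : (c.+1 + c = m.*2 - a.*2.+1)%N by lia.
rewrite addnS addnn.
have := gend a (ltnW am); have := gend a.+1 am; lra.
Qed.

End TraceInequalities.

(** * Trace moments of sampled rank-one matrices *)

Section Averages.
Context {R : realFieldType}.

(** The signs and the draws of the Hadamard transform are uniform on finite types,
so their expectations are means of this kind. *)
Definition avg (T : finType) (f : T -> R) : R := (\sum_t f t) / #|T|%:R.

Lemma avg_le (T : finType) (f g : T -> R) : (forall t, f t <= g t) -> avg f <= avg g.
Proof. by move=> fg; rewrite ler_wpM2r ?invr_ge0 ?ler0n // ler_sum. Qed.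

Lemma eq_avg (T : finType) (f g : T -> R) : f =1 g -> avg f = avg g.
Proof. by move=> fg; rewrite /avg (eq_bigr _ (fun t _ => fg t)). Qed.

Lemma avgD (T : finType) (f g : T -> R) : avg (fun t => f t + g t) = avg f + avg g.
Proof. by rewrite /avg big_split mulrDl. Qed.

Lemma avgZ (T : finType) a (f : T -> R) : avg (fun t => a * f t) = a * avg f.
Proof. by rewrite /avg -mulr_sumr mulrA. Qed.

Lemma avgN (T : finType) (f : T -> R) : avg (fun t => - f t) = - avg f.
Proof. by rewrite /avg sumrN mulNr. Qed.

Lemma avgB (T : finType) (f g : T -> R) : avg (fun t => f t - g t) = avg f - avg g.
Proof. by rewrite avgD avgN. Qed.

Lemma avg_sum (T I : finType) (f : I -> T -> R) :
  avg (fun t => \sum_i f i t) = \sum_i avg (f i).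
Proof. by rewrite /avg exchange_big -mulr_suml. Qed.

Lemma avg_cst (T : finType) (a : R) : (0 < #|T|)%N -> avg (fun _ : T => a) = a.
Proof.
move=> T0; rewrite /avg sumr_const -(mulr_natr a) mulfK //.
by rewrite pnatr_eq0 -lt0n.
Qed.

Lemma avg_ge0 (T : finType) (f : T -> R) : (forall t, 0 <= f t) -> 0 <= avg f.
Proof. by move=> f0; rewrite divr_ge0 ?ler0n // sumr_ge0. Qed.

Lemma avg_inv (T : finType) (s : T -> T) (f : T -> R) :
  involutive s -> avg (f \o s) = avg f.
Proof.
by move=> sK; rewrite /avg [in RHS](reindex_inj (inv_inj sK)).
Qed.

Lemma avg_exchange (T U : finType) (f : T -> U -> R) :
  avg (fun t => avg (f t)) = avg (fun u => avg (f ^~ u)).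
Proof. by rewrite /avg -!mulr_suml exchange_big mulrAC. Qed.

Lemma avg_pair (T U : finType) (f : T * U -> R) :
  avg f = avg (fun t => avg (fun u => f (t, u))).
Proof.
rewrite /avg -mulr_suml pair_bigA card_prod natrM invfM mulrA mulrAC.
by congr (_ / _ / _); apply: eq_bigr => -[].
Qed.

End Averages.

Section SampledMoments.
Context {R : realFieldType}.

Lemma subrX_telescope (S : pzRingType) (A B : S) (N : nat) :
  A ^+ N.+1 - B ^+ N.+1 = \sum_(j < N.+1) A ^+ j * (A - B) * B ^+ (N - j).
Proof.
elim: N => [|N IH]; first by rewrite big_ord1 !expr0 mul1r mulr1 !expr1.
rewrite big_ord_recl expr0 mul1r subn0 /=.
under eq_bigr => i _ do rewrite /bump add1n exprS subSS -!mulrA.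
rewrite -mulr_sumr; under eq_bigr => i _ do rewrite mulrA.
by rewrite -IH mulrBr mulrBl -!exprS [RHS]addrC addrA subrK.
Qed.

(* Matrices of size zero form a trivial ring, so for a general size the rules
   [scalerAl] and [scalerAr] of algebras are not available. *)
Lemma sqmx_scaleAl n (a : R) (X Y : 'M[R]_n) : a *: (X * Y) = (a *: X) * Y.
Proof. exact: scalemxAl. Qed.

Lemma sqmx_scaleAr n (a : R) (X Y : 'M[R]_n) : a *: (X * Y) = X * (a *: Y).
Proof. exact: scalemxAr. Qed.

Definition outer n (v : 'cV[R]_n) : 'M[R]_n := v *m v^T.

Lemma outer_sym n (v : 'cV[R]_n) : (outer v)^T = outer v.
Proof. by rewrite /outer trmx_mul trmxK. Qed.

Lemma tr_outer n (v : 'cV[R]_n) : \tr (outer v) = hs v v.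
Proof. by rewrite hs_trE. Qed.

Lemma tr_outer_sq n (v : 'cV[R]_n) (Q : 'M[R]_n) : Q^T = Q ->
  \tr (outer v * (Q * Q)) = hs (Q *m v) (Q *m v).
Proof.
move=> sQ; rewrite /hs trmx_mul sQ /outer -!mulmxE -mulmxA mxtrace_mulC.
by rewrite !mulmxA.
Qed.

(** The square of the difference of two rank-one matrices costs only a factor
[L]; this is the source of the variance [L / s] in the sampling bound. *)
Lemma tr_outer_diff n (v w : 'cV[R]_n) (L : R) (Q : 'M[R]_n) : Q^T = Q ->
  hs v v <= L -> hs w w <= L ->
  \tr ((outer v - outer w) * (outer v - outer w) * (Q * Q)) <=
  2 * L * (\tr (outer v * (Q * Q)) + \tr (outer w * (Q * Q))).
Proof.
move=> sQ vL wL; set H := outer v - outer w.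
have sH : H^T = H by rewrite /H linearB /= !outer_sym.
have -> : \tr (H * H * (Q * Q)) = hs (H *m Q) (H *m Q).
  rewrite /hs trmx_mul sH sQ -!mulmxE [RHS]mxtrace_mulC !mulmxA.
  by rewrite mxtrace_mulC !mulmxA.
rewrite !tr_outer_sq // /H mulmxBl.
have bound (z : 'cV[R]_n) : hs z z <= L ->
    hs (outer z *m Q) (outer z *m Q) <= L * hs (Q *m z) (Q *m z).
  move=> zL; rewrite /outer -mulmxA; apply: le_trans (hs_mulmx_le _ _) _.
  have -> : z^T *m Q = (Q *m z)^T by rewrite trmx_mul sQ.
  by rewrite hs_trmx ler_wpM2r ?hs_ge0.
have := bound v vL; have := bound w wL.
have := hs_ge0 (outer v *m Q + outer w *m Q).
rewrite !(hsDl, hsDr, hsNl, hsNr) (hsC (outer w *m Q)); lra.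
Qed.

Variables (n s : nat) (T : finType) (u : T -> 'cV[R]_n) (L beta : R).
Hypothesis s0 : (0 < s)%N.
Hypothesis T0 : (0 < #|T|)%N.
Hypothesis uL : forall t, hs (u t) (u t) <= L.

Local Notation sample := {ffun 'I_s -> T}.

Definition mean_outer : 'M[R]_n := #|T|%:R^-1 *: \sum_t outer (u t).
Definition sample_outer (p : sample) : 'M[R]_n :=
  s%:R^-1 *: \sum_k outer (u (p k)).
Definition sample_dev p := sample_outer p - mean_outer.

Hypothesis Mbeta : qform_le mean_outer beta%:M.

Lemma mean_outer_sym : mean_outer^T = mean_outer.
Proof.
by rewrite /mean_outer linearZ linear_sum; under eq_bigr do rewrite /= outer_sym.
Qed.

Lemma sample_dev_sym p : (sample_dev p)^T = sample_dev p.
Proof.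
rewrite /sample_dev linearB /= mean_outer_sym /sample_outer linearZ linear_sum.
by under eq_bigr do rewrite /= outer_sym.
Qed.

(** The exchange of the [k]-th draw with a spare independent one; being an
involution, it preserves the joint uniform law. *)
Definition swap_sample (k : 'I_s) (pt : sample * T) :=
  ([ffun i => if i == k then pt.2 else pt.1 i], pt.1 k).

Lemma swap_sampleK k : involutive (swap_sample k).
Proof.
case=> p t; rewrite /swap_sample /= ffunE eqxx; congr pair.
by apply/ffunP => i; rewrite !ffunE; case: eqP => [->|].
Qed.

Lemma sample_dev_swap k p t :
  sample_dev p - sample_dev (swap_sample k (p, t)).1 =
  s%:R^-1 *: (outer (u (p k)) - outer (u t)).
Proof.
rewrite /sample_dev opprB addrA addrNK /sample_outer -scalerBr; congr (_ *: _).
rewrite -sumrB (bigD1 k) //= ffunE eqxx big1 ?addr0 // => i ik.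
by rewrite ffunE (negbTE ik) subrr.
Qed.

Let ns0 : s%:R != 0 :> R. Proof. by rewrite pnatr_eq0 -lt0n. Qed.

(** One coordinate of the sample is exchanged with an independent copy. The
swap preserves the joint law and changes the deviation by a difference of two
rank-one terms, so the telescoped power difference is quadratic in it. *)
Lemma swap_moment m k :
  avg (fun p : sample => \tr ((outer (u (p k)) - mean_outer) * sample_dev p ^+ m.*2.+1)) <=
  2 * (m.*2.+1)%:R * L / s%:R *
  avg (fun p : sample => avg (fun t => \tr (outer (u (p k)) * sample_dev p ^+ m.*2) +
                              \tr (outer (u t) * sample_dev p ^+ m.*2))).
Proof.
set N := m.*2; pose D (pt : sample * T) := sample_dev pt.1.
pose H (pt : sample * T) := outer (u (pt.1 k)) - outer (u pt.2).
have HsD pt : H (swap_sample k pt) = - H pt.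
  by case: pt => p t; rewrite /H /swap_sample /= ffunE eqxx opprB.
have -> : avg (fun p : sample => \tr ((outer (u (p k)) - mean_outer) * sample_dev p ^+ N.+1)) =
    avg (fun pt : sample * T => \tr (H pt * D pt ^+ N.+1)).
  rewrite avg_pair; apply: eq_avg => p; rewrite /H /D /=.
  rewrite mulrBl linearB /=.
  under eq_avg => t do rewrite mulrBl linearB /=.
  rewrite avgB avg_cst //; congr (_ - _).
  rewrite /avg /mean_outer -sqmx_scaleAl linearZ /= mulrC; congr (_ * _).
  by rewrite mulr_suml linear_sum.
have -> : avg (fun pt : sample * T => \tr (H pt * D pt ^+ N.+1)) =
    2^-1 * avg (fun pt : sample * T => \tr (H pt * (D pt ^+ N.+1 - D (swap_sample k pt) ^+ N.+1))).
  have e : avg (fun pt : sample * T => \tr (H pt * D (swap_sample k pt) ^+ N.+1)) =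
           - avg (fun pt : sample * T => \tr (H pt * D pt ^+ N.+1)).
    rewrite -(avg_inv _ (swap_sampleK k)) -avgN; apply: eq_avg => pt /=.
    by rewrite swap_sampleK HsD mulNr linearN.
  under [in RHS]eq_avg => pt do rewrite mulrBr linearB /=.
  by rewrite avgB e; lra.
pose G pt := \tr (H pt * H pt * D pt ^+ N).
have step pt : \tr (H pt * (D pt ^+ N.+1 - D (swap_sample k pt) ^+ N.+1)) <=
    N.+1%:R / s%:R * (G pt + G (swap_sample k pt)).
  have sH : (H pt)^T = H pt by rewrite /H linearB /= !outer_sym.
  rewrite subrX_telescope mulr_sumr linear_sum /=.
  have -> : D pt - D (swap_sample k pt) = s%:R^-1 *: H pt.
    by case: pt {sH} => p t; exact: sample_dev_swap.
  have -> : N.+1%:R / s%:R * (G pt + G (swap_sample k pt)) =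
      \sum_(j < N.+1) s%:R^-1 * (G pt + G (swap_sample k pt)).
    by rewrite sumr_const card_ord -(mulr_natl (_ * _)) mulrA.
  apply: ler_sum => j _.
  rewrite -sqmx_scaleAr -sqmx_scaleAl -sqmx_scaleAr linearZ /= ler_wpM2l ?invr_ge0 ?ler0n //.
  rewrite /G HsD mulrNN !mulrA.
  by apply: trace_young => //; [exact: sample_dev_sym..|rewrite -ltnS].
have -> : avg (fun p : sample => avg (fun t => \tr (outer (u (p k)) * sample_dev p ^+ N) +
     \tr (outer (u t) * sample_dev p ^+ N))) =
   avg (fun pt : sample * T => \tr (outer (u (pt.1 k)) * D pt ^+ N) + \tr (outer (u pt.2) * D pt ^+ N)).
  by rewrite avg_pair.
have le1 : avg (fun pt : sample * T => \tr (H pt * (D pt ^+ N.+1 - D (swap_sample k pt) ^+ N.+1))) <=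
    N.+1%:R / s%:R * (2 * avg G).
  apply: le_trans (avg_le step) _; rewrite avgZ avgD.
  by rewrite (avg_inv G (swap_sampleK k)) mulr2n mulrDl mul1r.
have le2 : avg G <= 2 * L * avg (fun pt : sample * T => \tr (outer (u (pt.1 k)) * D pt ^+ N) +
     \tr (outer (u pt.2) * D pt ^+ N)).
  rewrite -avgZ; apply: avg_le => pt; rewrite /G /N -addnn exprD.
  by apply: tr_outer_diff => //; rewrite trmx_exp ?sample_dev_sym.
have Ns : 0 <= N.+1%:R / s%:R :> R by rewrite divr_ge0 ?ler0n.
have := ler_wpM2l Ns le2; move: le1.
set x := avg _; set y := avg G; set z := avg _; move=> h1 h2.
have -> : 2 * N.+1%:R * L / s%:R * z = N.+1%:R / s%:R * (2 * L * z) by ring.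
by lra.
Qed.

(** Summed over the draws, the first rank-one term of [swap_moment] recombines
into the deviation plus the mean, the second into the mean. *)
Lemma sum_swap_moment m (a := 2 * (m.*2.+1)%:R * L / s%:R) :
  avg (fun p : sample => \tr (sample_dev p ^+ m.*2.+2)) <=
  a * (avg (fun p : sample => \tr (sample_dev p ^+ m.*2.+1)) +
       2 * avg (fun p : sample => \tr (mean_outer * sample_dev p ^+ m.*2))).
Proof.
have sumW p : sample_dev p = s%:R^-1 *: \sum_k (outer (u (p k)) - mean_outer).
  rewrite /sample_dev /sample_outer sumrB sumr_const card_ord scalerBr.
  by rewrite -scaler_nat scalerA mulVf // scale1r.
have -> : avg (fun p : sample => \tr (sample_dev p ^+ m.*2.+2)) =
   s%:R^-1 * \sum_k avg (fun p : sample => \tr ((outer (u (p k)) - mean_outer) * sample_dev p ^+ m.*2.+1)).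
  rewrite -avg_sum -avgZ; apply: eq_avg => p.
  by rewrite exprS {1}sumW -sqmx_scaleAl linearZ /= mulr_suml linear_sum.
have -> : avg (fun p : sample => \tr (sample_dev p ^+ m.*2.+1)) +
       2 * avg (fun p : sample => \tr (mean_outer * sample_dev p ^+ m.*2)) =
   s%:R^-1 * \sum_k avg (fun p : sample => avg (fun t => \tr (outer (u (p k)) * sample_dev p ^+ m.*2) +
                              \tr (outer (u t) * sample_dev p ^+ m.*2))).
  rewrite -avg_sum -!avgZ -avgD; apply: eq_avg => p.
  have e1 : s%:R^-1 * \sum_k \tr (outer (u (p k)) * sample_dev p ^+ m.*2) =
      \tr (sample_dev p ^+ m.*2.+1) + \tr (mean_outer * sample_dev p ^+ m.*2).
    rewrite exprS {2}/sample_dev /sample_outer mulrBl linearB /= subrK.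
    by rewrite -sqmx_scaleAl linearZ /= mulr_suml linear_sum.
  have e2 : avg (fun t => \tr (outer (u t) * sample_dev p ^+ m.*2)) =
      \tr (mean_outer * sample_dev p ^+ m.*2).
    rewrite /avg /mean_outer -sqmx_scaleAl linearZ /= mulrC; congr (_ * _).
    by rewrite mulr_suml linear_sum.
  under eq_bigr => k _ do rewrite avgD avg_cst // e2.
  rewrite big_split /= mulrDr e1 sumr_const card_ord -(mulr_natl (\tr _)) mulKf //.
  by ring.
rewrite mulrCA ler_wpM2l ?invr_ge0 ?ler0n // mulr_sumr.
by apply: ler_sum => k _; exact: swap_moment.
Qed.

Lemma tr_mean_le m p : \tr (mean_outer * sample_dev p ^+ m.*2) <=
  beta * \tr (sample_dev p ^+ m.*2).
Proof.
have sQ := trmx_exp m (sample_dev_sym p).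
rewrite -addnn exprD; set Q := _ ^+ m in sQ *.
have -> : \tr (Q * Q) = hs Q Q by rewrite /hs sQ.
have -> : \tr (mean_outer * (Q * Q)) = hs Q (mean_outer *m Q).
  by rewrite /hs sQ -!mulmxE mulmxA mxtrace_mulC mulmxA.
exact: tr_form_le.
Qed.

(** Two trace powers are gained for the price of a small constant, so the moments
decay geometrically in their order. *)
Lemma sample_moment_step m (a : R) : 0 <= a -> 2 * (m.*2.+1)%:R * L / s%:R <= a ->
  avg (fun p : sample => \tr (sample_dev p ^+ m.*2.+2)) <=
  (a ^+ 2 + 4 * a * beta) * avg (fun p : sample => \tr (sample_dev p ^+ m.*2)).
Proof.
move=> a0 aL; have := sum_swap_moment m.
set E2 := avg _; set E1 := avg _; set EM := avg _ => h.
set E0 := avg _.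
have EM_le : EM <= beta * E0 by rewrite -avgZ; apply: avg_le => p; exact: tr_mean_le.
have EM_ge0 : 0 <= EM.
  apply: avg_ge0 => p; have sQ := trmx_exp m (sample_dev_sym p).
  rewrite -addnn exprD /mean_outer -sqmx_scaleAl linearZ /= mulr_ge0 ?invr_ge0 ?ler0n //.
  by rewrite mulr_suml linear_sum sumr_ge0 // => t _; rewrite /= tr_outer_sq ?hs_ge0.
have E1_ge0 : 0 <= E1 + EM.
  rewrite -avgD; apply: avg_ge0 => p; have sQ := trmx_exp m (sample_dev_sym p).
  rewrite exprS -linearD -mulrDl /sample_dev subrK -addnn exprD.
  rewrite /sample_outer -sqmx_scaleAl linearZ /= mulr_ge0 ?invr_ge0 ?ler0n //.
  by rewrite mulr_suml linear_sum sumr_ge0 // => t _; rewrite /= tr_outer_sq ?hs_ge0.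
(* The odd moment lies between its two even neighbours: expand the square of
   [D^(m.+1) - a D^m]. *)
have E1_le : 2 * a * E1 <= E2 + a ^+ 2 * E0.
  rewrite -!avgZ -avgD; apply: avg_le => p.
  have sQ := trmx_exp m (sample_dev_sym p); have sQ1 := trmx_exp m.+1 (sample_dev_sym p).
  have := hs_young (sample_dev p ^+ m.+1) (a *: sample_dev p ^+ m).
  rewrite hsZl !hsZr /hs sQ sQ1 !mulmxE -!exprD !addSn !addnS addnn.
  by rewrite mulrA expr2 mulrA.
set c := 2 * _ * L / _ in h aL.
have h1 : E2 <= a * (E1 + 2 * EM).
  by apply: le_trans h _; rewrite ler_wpM2r //; lra.
have : a * EM <= a * (beta * E0) by rewrite ler_wpM2l.
lra.
Qed.

Lemma tr_sample_outer_le p : \tr (sample_outer p) <= L.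
Proof.
rewrite /sample_outer linearZ /= linear_sum /= mulrC ler_pdivrMr ?ltr0n //.
rewrite mulr_natr -[X in _ *+ X]card_ord -sumr_const.
by apply: ler_sum => k _; rewrite /= tr_outer.
Qed.

Lemma tr_mean_outer_le : \tr mean_outer <= L.
Proof.
rewrite /mean_outer linearZ /= linear_sum /= mulrC ler_pdivrMr ?ltr0n //.
rewrite mulr_natr -sumr_const.
by apply: ler_sum => k _; rewrite /= tr_outer.
Qed.

(** The recursion starts from the traces of the sample and of the mean, which are
at most [L], and not from the trace of the identity: this is why the dimension
[n] does not appear. *)
Lemma sample_moment r (a : R) : 2 * (r.*2.+1)%:R * L / s%:R <= a -> 0 <= beta ->
  avg (fun p : sample => \tr (sample_dev p ^+ r.+1.*2)) <=
  (a ^+ 2 + 4 * a * beta) ^+ r * (2 * a * L).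
Proof.
move=> aL b0.
have L0 : 0 <= L by case/card_gt0P: T0 => t _; apply: le_trans (uL t); exact: hs_ge0.
have a0 : 0 <= a by apply: le_trans aL; rewrite divr_ge0 ?ler0n // !mulr_ge0 ?ler0n.
elim: r aL => [|r IH] aL.
  rewrite expr0 mul1r; have := sum_swap_moment 0; rewrite double0.
  have e1 : avg (fun p : sample => \tr (sample_dev p ^+ 1)) =
      avg (fun p : sample => \tr (sample_outer p)) - \tr mean_outer.
    rewrite -[\tr mean_outer](@avg_cst _ sample) ?card_ffun ?expn_gt0 ?T0 // -avgB.
    by apply: eq_avg => p; rewrite expr1 linearB.
  have e0 : avg (fun p : sample => \tr (mean_outer * sample_dev p ^+ 0)) = \tr mean_outer.
    rewrite -[RHS](@avg_cst _ sample) ?card_ffun ?expn_gt0 ?T0 //.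
    by apply: eq_avg => p; rewrite expr0 mulr1.
  rewrite e1 e0 => h; apply: le_trans h _.
  have hY : avg (fun p => \tr (sample_outer p)) <= L.
    rewrite -[leRHS](@avg_cst _ sample) ?card_ffun ?expn_gt0 ?T0 //.
    by apply: avg_le => p; exact: tr_sample_outer_le.
  have hM := tr_mean_outer_le.
  have hM0 : 0 <= \tr mean_outer.
    rewrite /mean_outer linearZ /= linear_sum mulr_ge0 ?invr_ge0 ?ler0n //.
    by rewrite sumr_ge0 // => t _; rewrite /= tr_outer hs_ge0.
  set y := avg _ in hY *; set t := \tr _ in hM hM0 *; set c := 2 * _ * L / _ in aL *.
  have y0 : 0 <= y.
    apply: avg_ge0 => p; rewrite /sample_outer linearZ /= linear_sum.
    rewrite mulr_ge0 ?invr_ge0 ?ler0n //.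
    by rewrite sumr_ge0 // => i _; rewrite /= tr_outer hs_ge0.
  have e : y - t + 2 * t = y + t by ring.
  rewrite e; apply: le_trans (ler_wpM2r _ aL) _; first exact: addr_ge0.
  by have := ler_wpM2l a0 (lerD hY hM); lra.
have aL' : 2 * (r.*2.+1)%:R * L / s%:R <= a.
  apply: le_trans aL; rewrite ler_wpM2r ?invr_ge0 ?ler0n // ler_wpM2r //.
  by rewrite ler_wpM2l // ler_nat doubleS; lia.
apply: le_trans (sample_moment_step a0 aL) _.
rewrite (exprS _ r) -[in leRHS]mulrA ler_wpM2l ?IH // addr_ge0 ?sqr_ge0 // !mulr_ge0 //.
Qed.

End SampledMoments.

(** * Operator norms from traces, and moments of Rademacher sums *)

Section FormFromTrace.
Context {R : realFieldType}.

(** The trace of a power of two of [D] dominates the same power of its largest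
eigenvalue: each squaring of [D] is one Cauchy-Schwarz step. *)
Lemma qform_le_trace_pow2 n (k : nat) (D : 'M[R]_n) (th : R) :
  D^T = D -> 0 <= th -> \tr (D ^+ (2 ^ k.+1)) <= th ^+ (2 ^ k.+1) ->
  forall x, `|qform D x| <= th * hs x x.
Proof.
elim: k D th => [|k IH] D th sD th0 trD x.
all: have xx := hs_ge0 x.
all: suff h : hs (D *m x) (D *m x) <= th ^+ 2 * hs x x.
1,3: rewrite ler_norml -ler_norml -(@ler_pXn2r _ 2) ?nnegrE ?mulr_ge0 // real_normK ?num_real //.
1,2: rewrite qformE exprMn; apply: le_trans (hs_cauchy _ _) _.
1,2: by rewrite [X in _ <= _ * X]expr2 mulrCA ler_wpM2l.
- apply: le_trans (hs_mulmx_le _ _) _; rewrite ler_wpM2r //.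
  by move: trD; rewrite /hs sD expn1 !expr2.
- have -> : hs (D *m x) (D *m x) = qform (D ^+ 2) x.
    by rewrite qformE expr2 -mulmxE -mulmxA hs_mulmx sD.
  apply: le_trans (ler_norm _) _; apply: IH; rewrite ?exprn_ge0 ?trmx_exp //.
  by rewrite -!exprM -expnS.
Qed.

Lemma qform_outer n (v x : 'cV[R]_n) : qform (outer v) x = hs v x ^+ 2.
Proof. by rewrite /outer qform_gram_tr [LHS]hsE !big_ord1 -expr2 /hs trace_mx11. Qed.

End FormFromTrace.

Section RademacherMoments.
Context {R : realFieldType}.
Variables (n : nat) (I : finType) (v : I -> 'cV[R]_n) (F beta : R).
Hypothesis vF : \sum_l hs (v l) (v l) <= F.
Hypothesis vbeta : qform_le (\sum_l outer (v l)) beta%:M.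

Local Notation signs := {ffun I -> bool}.

Definition sign_sum (e : signs) : 'cV[R]_n := \sum_l (-1) ^+ e l *: v l.

Definition flip (l : I) (e : signs) : signs :=
  [ffun i => if i == l then ~~ e i else e i].

Lemma flipK l : involutive (flip l).
Proof. by move=> e; apply/ffunP => i; rewrite !ffunE; case: eqP => // _; rewrite negbK. Qed.

Lemma sign_sum_flip l e :
  sign_sum (flip l e) = sign_sum e - (2 * (-1) ^+ e l) *: v l.
Proof.
rewrite /sign_sum (bigD1 l) //= [in RHS](bigD1 l) //= ffunE eqxx.
rewrite (eq_bigr (fun i => (-1) ^+ e i *: v i)); last first.
  by move=> i il; rewrite ffunE (negbTE il).
rewrite addrAC; congr (_ + _); rewrite -scalerBl; congr (_ *: _).
by case: (e l); rewrite /= ?expr0 ?expr1; ring.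
Qed.

(** [S] is the sum of the [x^(N - i) y^i]; each term is at most the [N]-th power of
the larger of [x] and [y]. *)
Lemma powB_bounds (x y : R) (N : nat) : 0 <= x -> 0 <= y ->
  exists2 S, x ^+ N.+1 - y ^+ N.+1 = (x - y) * S &
    0 <= S <= N.+1%:R * (x ^+ N + y ^+ N).
Proof.
move=> x0 y0; exists (\sum_(i < N.+1) x ^+ (N - i) * y ^+ i); first by rewrite subrXX.
apply/andP; split; first by apply: sumr_ge0 => i _; rewrite mulr_ge0 ?exprn_ge0.
rewrite mulr_natl -[X in _ *+ X]card_ord -sumr_const; apply: ler_sum => i _.
have iN : (i <= N)%N by rewrite -ltnS.
have [xy|/ltW yx] := leP x y.
  apply: le_trans (_ : y ^+ N <= _); last by rewrite lerDr exprn_ge0.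
  by rewrite -[X in _ <= y ^+ X](subnK iN) exprD ler_wpM2r ?exprn_ge0 // lerXn2r.
apply: le_trans (_ : x ^+ N <= _); last by rewrite lerDl exprn_ge0.
by rewrite -[X in _ <= x ^+ X](subnK iN) exprD ler_wpM2l ?exprn_ge0 // lerXn2r.
Qed.

(** [w + a] and [w - a] stand for [s <v, u>] before and after the sign [s] of
[v] is flipped in [u], and [Q], [Q'] for [|u|^2]. The larger of [Q], [Q'] goes
with the larger of [|w + a|], [|w - a|], which lets [a^2] be replaced by them. *)
Lemma flip_pair_le (w a Q Q' : R) (m : nat) : 0 <= w -> 0 <= Q -> 0 <= Q' ->
  Q - Q' = 4 * a ->
  (w + a) * Q ^+ m + (w - a) * Q' ^+ m <=
  w * (Q ^+ m + Q' ^+ m) +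
  4 * m%:R * ((w + a) ^+ 2 * Q ^+ m.-1 + (w - a) ^+ 2 * Q' ^+ m.-1).
Proof.
move=> w0 Q0 Q0' Qa; case: m => [|N]; first by rewrite !expr0; lra.
have [S powS /andP[S0 Sle]] := powB_bounds N Q0 Q0'.
have aQ : 0 <= a * (Q ^+ N - Q' ^+ N).
  case: N {powS Sle} => [|N]; first by rewrite !expr0 subrr mulr0.
  have [S' -> /andP[S'0 _]] := powB_bounds N Q0 Q0'.
  by rewrite Qa mulrA mulr_ge0 // mulrCA mulr_ge0 // -expr2 sqr_ge0.
have h1 : a ^+ 2 * (Q ^+ N + Q' ^+ N) <= (w + a) ^+ 2 * Q ^+ N + (w - a) ^+ 2 * Q' ^+ N.
  have := mulr_ge0 w0 aQ.
  have := mulr_ge0 (sqr_ge0 w) (addr_ge0 (exprn_ge0 N Q0) (exprn_ge0 N Q0')).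
  lra.
have h2 : a * (Q ^+ N.+1 - Q' ^+ N.+1) <= 4 * N.+1%:R * (a ^+ 2 * (Q ^+ N + Q' ^+ N)).
  rewrite powS Qa; have := ler_wpM2l (sqr_ge0 a) Sle; lra.
have : 4 * N.+1%:R * (a ^+ 2 * (Q ^+ N + Q' ^+ N)) <=
       4 * N.+1%:R * ((w + a) ^+ 2 * Q ^+ N + (w - a) ^+ 2 * Q' ^+ N).
  by rewrite ler_wpM2l // mulr_ge0 ?ler0n.
rewrite succnK; lra.
Qed.

Let Q e := hs (sign_sum e) (sign_sum e).

(** Averaging over [e] and [flip l e] together, [flip_pair_le] trades the factor
[<v l, u>] for its square at one power of [Q] less. *)
Lemma sign_coord_moment m l :
  avg (fun e : signs => (-1) ^+ e l * hs (v l) (sign_sum e) * Q e ^+ m) <=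
  hs (v l) (v l) * avg (fun e : signs => Q e ^+ m) +
  4 * m%:R * avg (fun e : signs => hs (v l) (sign_sum e) ^+ 2 * Q e ^+ m.-1).
Proof.
have pairE (f : signs -> R) : 2 * avg f = avg (fun e => f e + f (flip l e)).
  by rewrite avgD (avg_inv f (flipK l)); ring.
rewrite -(ler_pM2l (_ : 0 < 2 :> R)) // mulrDr (mulrCA 2 (hs _ _)) (mulrCA 2 (4 * _)).
rewrite !pairE -!avgZ -avgD; apply: avg_le => e.
set w := hs (v l) (v l); set X := (-1) ^+ e l * hs (v l) (sign_sum e).
have sq : ((-1) ^+ e l) ^+ 2 = 1 :> R by rewrite sqrr_sign.
have X2 : hs (v l) (sign_sum e) ^+ 2 = X ^+ 2 by rewrite /X exprMn sq mul1r.
have hf : hs (v l) (sign_sum (flip l e)) = hs (v l) (sign_sum e) - 2 * (-1) ^+ e l * w.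
  by rewrite sign_sum_flip hsDr hsNr hsZr.
have X' : (-1) ^+ flip l e l * hs (v l) (sign_sum (flip l e)) = 2 * w - X.
  rewrite hf ffunE eqxx /X; move: sq; case: (e l) => /= _; rewrite ?expr0 ?expr1; ring.
have X'2 : hs (v l) (sign_sum (flip l e)) ^+ 2 = (2 * w - X) ^+ 2.
  by rewrite -X' exprMn sqrr_sign mul1r.
have Q' : Q e - Q (flip l e) = 4 * (X - w).
  rewrite /Q sign_sum_flip !(hsDl, hsDr, hsNl, hsNr, hsZl, hsZr).
  rewrite (hsC (sign_sum e)) -/w /X; move: sq.
  set t := (-1) ^+ _; set c := hs (v l) _ => sq.
  transitivity (4 * t * c - 4 * t ^+ 2 * w); first by ring.
  by rewrite sq; ring.
rewrite X' X2 X'2; have := @flip_pair_le w (X - w) (Q e) (Q (flip l e)) m.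
rewrite (_ : w + (X - w) = X); last by ring.
rewrite (_ : w - (X - w) = 2 * w - X); last by ring.
by apply=> //; exact: hs_ge0.
Qed.

Hypothesis beta0 : 0 <= beta.

(** Rademacher sums have the moments of their Gaussian analogues: integration by
parts in each sign separately, in the discrete form of [flip_pair_le]. *)
Lemma sign_sum_moment_step m :
  avg (fun e : signs => Q e ^+ m.+1) <=
  (F + 4 * m%:R * beta) * avg (fun e : signs => Q e ^+ m).
Proof.
have Q0 e : 0 <= Q e by exact: hs_ge0.
have -> : avg (fun e : signs => Q e ^+ m.+1) =
    \sum_l avg (fun e : signs => (-1) ^+ e l * hs (v l) (sign_sum e) * Q e ^+ m).
  rewrite -avg_sum; apply: eq_avg => e; rewrite -mulr_suml exprS; congr (_ * _).
  by rewrite /Q {1}/sign_sum hs_suml; apply: eq_bigr => l _; rewrite hsZl.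
apply: le_trans (ler_sum _ (fun l _ => sign_coord_moment m l)) _.
rewrite big_split /= -mulr_suml -mulr_sumr [in leRHS]mulrDl; apply: lerD.
  by rewrite ler_wpM2r // avg_ge0 // => e; rewrite exprn_ge0.
case: m => [|m]; first by rewrite mulr0 !mul0r.
rewrite -!mulrA ler_wpM2l // ler_wpM2l // succnK -avg_sum -avgZ; apply: avg_le => e.
rewrite -mulr_suml exprS mulrA ler_wpM2r ?exprn_ge0 //.
rewrite -qform_scalar; apply: le_trans (vbeta _).
rewrite qform_sum le_eqVlt; apply/orP; left; apply/eqP; apply: eq_bigr => l _.
by rewrite qform_outer.
Qed.

Lemma sign_sum_moment m M : (m <= M)%N ->
  avg (fun e : signs => Q e ^+ m) <= (F + 4 * M%:R * beta) ^+ m.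
Proof.
have F0 : 0 <= F by apply: le_trans vF; apply: sumr_ge0 => l _; exact: hs_ge0.
elim: m => [|m IH] mM.
  by rewrite avg_cst ?card_ffun ?expn_gt0 ?card_bool.
apply: le_trans (sign_sum_moment_step m) _; rewrite exprS.
apply: ler_pM (IH (ltnW mM)).
- by rewrite addr_ge0 // !mulr_ge0.
- by apply: avg_ge0 => e; rewrite exprn_ge0 // hs_ge0.
- by rewrite lerD2l ler_wpM2r // ler_wpM2l // ler_nat ltnW.
Qed.

End RademacherMoments.

(** * Truncation of long vectors *)

Section Truncation.
Context {R : realFieldType}.
Variables (n : nat) (L : R).
Hypothesis L0 : 0 < L.

(** Sampling concentrates only for vectors of bounded length. Long ones are rare,
so they are dropped and their energy [tail] is bounded separately. *)
Definition trunc (v : 'cV[R]_n) : 'cV[R]_n := if hs v v <= L then v else 0.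
Definition tail (v : 'cV[R]_n) : R := if hs v v <= L then 0 else hs v v.

Lemma tail_ge0 v : 0 <= tail v.
Proof. by rewrite /tail; case: ifP => // _; exact: hs_ge0. Qed.

Lemma hs_trunc_le v : hs (trunc v) (trunc v) <= L.
Proof. by rewrite /trunc; case: ifP => // _; rewrite hs0l ltW. Qed.

Lemma qform_trunc_le v x : qform (outer (trunc v)) x <= qform (outer v) x.
Proof.
by rewrite /trunc; case: ifP => // _; rewrite !qform_outer hs0l expr0n sqr_ge0.
Qed.

Lemma qform_tail v x :
  qform (outer v) x <= qform (outer (trunc v)) x + tail v * hs x x.
Proof.
rewrite /trunc /tail; case: ifP => _; first by rewrite mul0r addr0.
by rewrite !qform_outer hs0l expr0n add0r hs_cauchy.
Qed.

Lemma tail_moment v r : tail v <= hs v v ^+ r.+1 / L ^+ r.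
Proof.
have hv := hs_ge0 v; have Lr : 0 < L ^+ r by rewrite exprn_gt0.
rewrite /tail; case: ifPn => [_|]; first by rewrite divr_ge0 ?exprn_ge0 // ltW.
rewrite -ltNge => Lv; rewrite ler_pdivlMr // exprS ler_wpM2l // lerXn2r ?nnegrE // ltW //.
Qed.

End Truncation.

Section SamplingFailure.
Context {R : realFieldType}.
Variables (n s : nat) (T : finType) (u : T -> 'cV[R]_n) (L beta : R).
Hypothesis s0 : (0 < s)%N.
Hypothesis T0 : (0 < #|T|)%N.
Hypothesis L0 : 0 < L.
Hypothesis beta0 : 0 <= beta.
Hypothesis Mbeta : qform_le (mean_outer u) beta%:M.

Local Notation sample := {ffun 'I_s -> T}.
Let ub t := trunc L (u t).

Definition bad_sample (p : sample) : bool :=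
  ~~ `[< forall x, `|qform (sample_dev u p) x| <= 4^-1 * hs x x >].

Lemma qform_mean (w : T -> 'cV[R]_n) x :
  qform (mean_outer w) x = avg (fun t => qform (outer (w t)) x).
Proof. by rewrite /mean_outer qformZ qform_sum mulrC. Qed.

Lemma qform_sample (w : T -> 'cV[R]_n) (p : sample) x :
  qform (sample_outer w p) x = avg (fun k => qform (outer (w (p k))) x).
Proof. by rewrite /sample_outer qformZ qform_sum mulrC /avg card_ord. Qed.

Lemma mean_trunc_le : qform_le (mean_outer ub) beta%:M.
Proof.
move=> x; apply: le_trans (Mbeta x); rewrite !qform_mean.
by apply: avg_le => t; exact: qform_trunc_le.
Qed.

(** Truncation only decreases both the sample and the mean, so the two errors
have opposite signs and do not add up. *)
Lemma sample_dev_trunc (p : sample) th ta :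
  (forall x, `|qform (sample_dev ub p) x| <= th * hs x x) ->
  avg (fun k => tail L (u (p k))) <= ta -> avg (fun t => tail L (u t)) <= ta ->
  forall x, `|qform (sample_dev u p) x| <= (th + ta) * hs x x.
Proof.
move=> Hth HY HM x; have := Hth x; have xx := hs_ge0 x.
rewrite /sample_dev !qformD !qformN !qform_mean !qform_sample.
have Y1 : avg (fun k => qform (outer (ub (p k))) x) <= avg (fun k => qform (outer (u (p k))) x).
  by apply: avg_le => k; exact: qform_trunc_le.
have M1 : avg (fun t => qform (outer (ub t)) x) <= avg (fun t => qform (outer (u t)) x).
  by apply: avg_le => t; exact: qform_trunc_le.
have Y2 : avg (fun k => qform (outer (u (p k))) x) <=
    avg (fun k => qform (outer (ub (p k))) x) + avg (fun k => tail L (u (p k))) * hs x x.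
  rewrite [_ * hs x x]mulrC -avgZ -avgD; apply: avg_le => k.
  by rewrite mulrC qform_tail.
have M2 : avg (fun t => qform (outer (u t)) x) <=
    avg (fun t => qform (outer (ub t)) x) + avg (fun t => tail L (u t)) * hs x x.
  rewrite [_ * hs x x]mulrC -avgZ -avgD; apply: avg_le => t.
  by rewrite mulrC qform_tail.
have := ler_wpM2r xx HY; have := ler_wpM2r xx HM.
rewrite !ler_norml mulrDl => h1 h2 /andP[h3 h4]; apply/andP; split; lra.
Qed.

Lemma avg_sample_coord (f : T -> R) k : avg (fun p : sample => f (p k)) = avg f.
Proof.
transitivity (avg (fun pt : sample * T => f (pt.1 k))).
  by rewrite avg_pair; apply: eq_avg => p; rewrite /= avg_cst.
rewrite -(avg_inv _ (swap_sampleK k)) avg_pair.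
transitivity (avg (fun _ : sample => avg f)); last first.
  by rewrite avg_cst // card_ffun expn_gt0 T0.
by apply: eq_avg => p; apply: eq_avg => t; rewrite /= ffunE eqxx.
Qed.

Lemma tr_even_ge0 (D : 'M[R]_n) m : D^T = D -> 0 <= \tr (D ^+ m.*2).
Proof.
move=> sD; rewrite -addnn exprD -{1}(trmx_exp m sD); exact: hs_ge0.
Qed.

(** Markov's inequality in pointwise form: one of the three terms is at least
[1] when the sample is bad. *)
Lemma bad_sample_le k (p : sample) :
  (bad_sample p)%:R <= 8 ^+ (2 ^ k.+1) * \tr (sample_dev ub p ^+ (2 ^ k.+1)) +
    8 * avg (fun j => tail L (u (p j))) + 8 * avg (fun t => tail L (u t)).
Proof.
have sD := sample_dev_sym ub p.
have tr0 : 0 <= 8 ^+ (2 ^ k.+1) * \tr (sample_dev ub p ^+ (2 ^ k.+1)).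
  by rewrite mulr_ge0 ?exprn_ge0 // expnS mul2n tr_even_ge0.
have Y0 : 0 <= avg (fun j => tail L (u (p j))) by apply: avg_ge0 => j; exact: tail_ge0.
have M0 : 0 <= avg (fun t => tail L (u t)) by apply: avg_ge0 => t; exact: tail_ge0.
rewrite /bad_sample; case: asboolP => /= bad; first by lra.
have [trD|] := leP (\tr (sample_dev ub p ^+ (2 ^ k.+1))) (8^-1 ^+ (2 ^ k.+1)); last first.
  rewrite exprVn -[X in X < _]mul1r ltr_pdivrMr ?exprn_gt0 // mulrC; lra.
have [HY|] := leP (avg (fun j => tail L (u (p j)))) 8^-1; last by lra.
have [HM|] := leP (avg (fun t => tail L (u t))) 8^-1; last by lra.
case: bad => x.
have h8 : 0 <= 8^-1 :> R by rewrite invr_ge0.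
have := sample_dev_trunc (qform_le_trace_pow2 sD h8 trD) HY HM x.
by rewrite (_ : 8^-1 + 8^-1 = 4^-1 :> R) //; lra.
Qed.

(** The truncated energy is linear in the sample, hence its mean over samples is
the mean over all rows: no union bound over the drawn rows is needed, and
the bound has no factor logarithmic in the number of draws. *)
Lemma avg_bad_sample k (r := (2 ^ k)%N) (a := 4 * r%:R * L / s%:R) :
  avg (fun p => (bad_sample p)%:R) <=
  64 ^+ r * ((a ^+ 2 + 4 * a * beta) ^+ r.-1 * (2 * a * L)) +
    16 * avg (fun t => tail L (u t)).
Proof.
apply: le_trans (avg_le (bad_sample_le k)) _.
rewrite !avgD !avgZ avg_cst ?card_ffun ?expn_gt0 ?T0 // -addrA -mulrDr.
have -> : avg (fun p : sample => avg (fun j => tail L (u (p j)))) = avg (fun t => tail L (u t)).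
  rewrite avg_exchange; transitivity (avg (fun _ : 'I_s => avg (fun t => tail L (u t)))).
    by apply: eq_avg => j; exact: (avg_sample_coord (fun t => tail L (u t))).
  by rewrite avg_cst // card_ord.
rewrite -/(avg _); apply: lerD; last by lra.
have -> : 8 ^+ (2 ^ k.+1) = 64 ^+ r :> R.
  by rewrite expnS exprM -natrX.
rewrite ler_wpM2l ?exprn_ge0 //.
have r0 : (0 < r)%N by rewrite expn_gt0.
have -> : (2 ^ k.+1)%N = (r.-1.+1.*2)%N by rewrite prednK // expnS mul2n.
apply: sample_moment => //.
- by move=> t; exact: hs_trunc_le.
- exact: mean_trunc_le.
- rewrite ler_wpM2r ?invr_ge0 ?ler0n // ler_wpM2r ?(ltW L0) //.
  by rewrite -!natrM ler_nat; lia.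
Qed.

End SamplingFailure.

(** * The subsampled randomized Hadamard transform *)

Section Hadamard.
Context {R : realType}.

Lemma hadamard_entry k i j : (@hadamard R k) i j ^+ 2 = 1.
Proof.
elim: k i j => [|k IH] i j; first by rewrite !ord1 mxE expr1n.
rewrite /= castmxE.
case: (split_ordP (cast_ord (esym (addn_exp2 k)) i)) => i' ->;
case: (split_ordP (cast_ord (esym (addn_exp2 k)) j)) => j' ->;
rewrite ?(block_mxEul, block_mxEur, block_mxEdl, block_mxEdr) ?mxE ?sqrrN; exact: IH.
Qed.

Lemma hadamard_gram k : (@hadamard R k)^T *m hadamard k = (2 ^ k)%:R%:M.
Proof.
elim: k => [|k IH]; first by rewrite /= trmx1 mul1mx.
have -> : (2 ^ k.+1)%:R = (2 ^ k)%:R + (2 ^ k)%:R :> R by rewrite -natrD addn_exp2.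
rewrite /=; move: (2 ^ k)%:R (hadamard k) IH (addn_exp2 k) => c H IH.
case: (2 ^ k.+1)%N / ; rewrite castmx_id.
have tN : (- H)^T = - H^T by rewrite linearN.
rewrite tr_block_mx tN mulmx_block !(mulmxN, mulNmx) opprK IH subrr.
by rewrite -raddfD -scalar_mx_block.
Qed.

End Hadamard.

Section RandomizedHadamard.
Context {R : realType}.

Lemma sum_outer_col n m (X : 'M[R]_(n, m)) : \sum_j outer (col j X) = X *m X^T.
Proof.
apply/matrixP => i l; rewrite summxE mxE; apply: eq_bigr => j _.
by rewrite mxE big_ord1 !mxE.
Qed.

Lemma hs_cols n m (X : 'M[R]_(n, m)) : \sum_j hs (col j X) (col j X) = hs X X.
Proof.
rewrite [RHS]hsE [RHS]exchange_big; apply: eq_bigr => j _; rewrite hsE.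
by apply: eq_bigr => i _; rewrite big_ord1 !mxE.
Qed.

Lemma sign_mx_sq m (b : {ffun 'I_m -> bool}) : @sign_mx R m b *m sign_mx b = 1%:M.
Proof.
rewrite /sign_mx mulmx_diag -diag_const_mx; congr diag_mx.
by apply/rowP => i; rewrite !mxE -expr2 sqrr_sign.
Qed.

Lemma sign_mx_sym m (b : {ffun 'I_m -> bool}) : (@sign_mx R m b)^T = sign_mx b.
Proof. exact: tr_diag_mx. Qed.

Variables (n k : nat) (V : 'M[R]_(n, 2 ^ k)).
Local Notation m := (2 ^ k)%N.
Local Notation signs := {ffun 'I_m -> bool}.

Definition mixed (b : signs) : 'M[R]_(n, m) := V *m sign_mx b *m (hadamard k)^T.
Definition mixed_col (b : signs) (j : 'I_m) : 'cV[R]_n := col j (mixed b).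

(** Signs and the Hadamard matrix form a multiple of an orthogonal matrix, so the
mean over all rows is the Gram matrix itself, whatever the signs. *)
Lemma mean_mixed b : mean_outer (mixed_col b) = V *m V^T.
Proof.
rewrite /mean_outer sum_outer_col card_ord /mixed !trmx_mul trmxK sign_mx_sym.
rewrite -!mulmxA (mulmxA _^T (hadamard k)) hadamard_gram mul_scalar_mx -!scalemxAr.
rewrite scalerA mulVf ?pnatr_eq0 ?expn_eq0 // scale1r (mulmxA (sign_mx b)).
by rewrite sign_mx_sq mul1mx.
Qed.

(** Each mixed column is a Rademacher sum: for fixed [j] the Hadamard matrix only
changes the signs of the columns of [V]. *)
Lemma mixed_colE b j :
  mixed_col b j = sign_sum (fun l => hadamard k j l *: col l V) b.
Proof.
apply/colP => i; rewrite /mixed_col /mixed mxE mxE /sign_sum summxE.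
apply: eq_bigr => l _; rewrite !mxE (bigD1 l) //= big1 ?addr0; last first.
  by move=> l' ll'; rewrite !mxE (negbTE ll') mulr0n mulr0.
by rewrite !mxE eqxx mulr1n [V i l * _]mulrC -mulrA [V i l * _]mulrC.
Qed.

Variables (F beta : R).
Hypothesis VF : hs V V <= F.
Hypothesis Vbeta : qform_le (V *m V^T) beta%:M.
Hypothesis beta0 : 0 <= beta.

Lemma mixed_col_moment r j :
  avg (fun b : signs => hs (mixed_col b j) (mixed_col b j) ^+ r) <=
  (F + 4 * r%:R * beta) ^+ r.
Proof.
under eq_avg => b do rewrite mixed_colE.
apply: sign_sum_moment => //.
  apply: le_trans VF; rewrite -hs_cols; apply: ler_sum => l _.
  by rewrite hsZl hsZr mulrA -expr2 hadamard_entry mul1r.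
rewrite (_ : \sum_l _ = V *m V^T) // -sum_outer_col; apply: eq_bigr => l _.
by rewrite /outer linearZ /= -scalemxAl -scalemxAr scalerA -expr2 hadamard_entry scale1r.
Qed.

(** Random signs spread the columns evenly: rows of squared length beyond twice
the scale [F + 4 r beta] carry a total energy exponentially small in [r], so
the sampling estimate can be applied to the truncated rows. *)
Lemma srht_failure s e (r := (2 ^ e)%N) (L := 2 * (F + 4 * r%:R * beta))
    (a := 4 * r%:R * L / s%:R) : (0 < s)%N -> 0 < L ->
  avg (fun b => avg (fun p : {ffun 'I_s -> 'I_m} => (bad_sample (mixed_col b) p)%:R)) <=
  64 ^+ r * ((a ^+ 2 + 4 * a * beta) ^+ r.-1 * (2 * a * L)) + 16 * (L / 2 ^+ r).
Proof.
move=> s0 L0; have m0 : (0 < #|'I_m|)%N by rewrite card_ord expn_gt0.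
have b0 : (0 < #|signs|)%N by rewrite card_ffun card_bool expn_gt0.
set c := 64 ^+ r * _.
have step (b : signs) : avg (fun p : {ffun 'I_s -> 'I_m} => (bad_sample (mixed_col b) p)%:R) <=
    c + 16 * avg (fun j => tail L (mixed_col b j)).
  by apply: avg_bad_sample => //; rewrite mean_mixed.
apply: le_trans (avg_le step) _.
rewrite avgD avg_cst // lerD2l avgZ ler_wpM2l // avg_exchange.
rewrite -[leRHS](@avg_cst _ 'I_m) //; apply: avg_le => j.
have r0 : (0 < r)%N by rewrite expn_gt0.
apply: le_trans (_ : avg (fun b => L ^- r.-1 * hs (mixed_col b j) (mixed_col b j) ^+ r) <= _).
  apply: avg_le => b; rewrite mulrC -{1}(prednK r0); exact: tail_moment.
rewrite avgZ mulrC ler_pdivrMr ?exprn_gt0 //; apply: le_trans (mixed_col_moment r j) _.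
have -> : F + 4 * r%:R * beta = L / 2 by rewrite /L [RHS]mulrC mulKf.
by rewrite exprMn exprVn mulrAC -exprS prednK.
Qed.

End RandomizedHadamard.

(** * Choice of the number of moments *)

Section SampleSize.
Context {R : realType}.

Lemma pow2_bracket (X : R) : 1 <= X ->
  exists e : nat, X <= (2 ^ e)%:R /\ (2 ^ e)%:R <= 2 * X.
Proof.
move=> X1.
have ex : exists e : nat, X <= (2 ^ e)%:R.
  have X0 : 0 <= X by lra.
  exists (Num.bound X); apply: le_trans (ltW (archi_boundP X0)) _.
  by rewrite ler_nat ltnW // ltn_expl.
case: (ex_minnP ex) => e Xe emin; exists e; split=> //.
case: e Xe emin => [|e] Xe emin; first by rewrite expn0; lra.
rewrite expnS natrM ler_pM2l // leNgt; apply/negP => /ltW /emin.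
by rewrite ltnn.
Qed.

Lemma expR_half_le2 : expR (2^-1) <= 2 :> R.
Proof.
have h := expR_ge1Dx (- 2^-1 : R); rewrite expRN in h.
rewrite -[leRHS]invrK -[leLHS]invrK lef_pV2 ?posrE ?invr_gt0 ?expR_gt0 //.
by apply: le_trans h; lra.
Qed.

Lemma exp_dominates_linear (z : R) : 0 <= z ->
  32 * 32 * 32 * z <= expR (16 * ln (2 + z)).
Proof.
move=> z0; have z2 : 2 <= 2 + z by rewrite lerDl.
rewrite expRM_natl lnK ?posrE; last by apply: lt_le_trans z2.
rewrite exprSr; have : 2 ^+ 15 <= (2 + z) ^+ 15 by rewrite lerXn2r ?nnegrE // (le_trans _ z2).
rewrite (_ : 2 ^+ 15 = 32 * 32 * 32); last by ring.
have : z <= 2 + z by rewrite lerDr.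
move: (2 + z) => w zw; move: (w ^+ 15) => y hy.
by apply: ler_pM => //; rewrite !mulr_ge0.
Qed.

Lemma exp_dominates_square (D : R) : 0 <= D -> 16 * D ^+ 2 <= expR (8 * D).
Proof.
move=> D0; rewrite (_ : 8 * D = 2 * (4 * D)); last by ring.
rewrite expRM_natl (_ : 16 * D ^+ 2 = (4 * D) ^+ 2); last by ring.
rewrite lerXn2r ?nnegrE ?expR_ge0 // ?mulr_ge0 //.
by apply: le_trans (expR_ge1Dx _); rewrite lerDr.
Qed.

(** The number [r] of moments is taken of order [ln (2 + sl) / delta]: then [2 ^ r]
beats every polynomial in [sl] and [1 / delta], while the sampling scale [a]
stays below a constant. *)
Lemma srht_parameters (C sl delta : R) (s : nat) :
  C = 2560 * (4 * (2 * 64 * (100 * 64))) ->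
  2^-1 <= sl -> 0 < delta < 1 ->
  C * sl * ln (2 + sl) / delta ^+ 2 <= s%:R ->
  (0 < s)%N /\ exists e : nat, let r := (2 ^ e)%N in
    let L := 2 * (2 * sl + 4 * r%:R * 2) in
    let a := 4 * r%:R * L / s%:R in
    64 ^+ r * ((a ^+ 2 + 4 * a * 2) ^+ r.-1 * (2 * a * L)) + 16 * (L / 2 ^+ r)
      <= 3 / 8 * delta.
Proof.
move=> hC sl2 /andP[d0 d1]; set l := ln _ => hs.
have C0 : 0 < C by lra.
move: hC.
(* Named numerals are not unfolded into unary numbers by conversion. *)
have [K hK] : exists K : R, K = 2560 by exists 2560.
have [E hE] : exists E : R, E = 256 by exists 256.
have K0 : 0 < K by lra.
have E0 : 0 < E by lra.
have l_ge : 2^-1 <= l.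
  rewrite -[2^-1]expRK ler_ln ?posrE ?expR_gt0 //; last by lra.
  by have := expR_half_le2; lra.
have l_le : l <= 3 * sl.
  have := @le_ln1Dx R (1 + sl); rewrite addrA => /(_ _); rewrite (_ : 1 + 1 = 2) // -/l.
  by move=> h; apply: le_trans (h _) _; lra.
have sl0 : 0 <= sl by lra.
have id0 : 0 < delta^-1 by rewrite invr_gt0.
have id1 : 1 <= delta^-1 by rewrite invf_ge1 // ltW.
set D := delta^-1 in id0 id1.
have hs' : C * (sl * l * D ^+ 2) <= s%:R.
  by move: hs; rewrite -exprVn -!mulrA.
have slD : 0 < sl * l * D ^+ 2 by rewrite !mulr_gt0 ?exprn_gt0 //; lra.
have s0 : 0 < s%:R :> R.
  by apply: lt_le_trans hs'; rewrite mulr_gt0.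
move=> hC; split; first by rewrite -(ltr0n R).
move: hC.
have lD : l <= l * D by rewrite ler_peMr //; lra.
have lD2 : 2^-1 * D <= l * D by rewrite ler_wpM2r // ltW.
(* The factor [64] gives [r / 2 >= 16 l + 8 D]: the exponentials of these two terms
   beat [sl] and the square of [1 / delta] respectively. *)
have [|e [Xr rX]] := @pow2_bracket (64 * (l * D)); first by lra.
move=> hC; exists e => r L a; move: hC.
have r0 : (0 < r)%N by rewrite expn_gt0.
have lDs : l * D <= 3 * (sl * D) by rewrite mulrA ler_wpM2r // ltW.
have slD1 : sl <= sl * D by rewrite ler_peMr //; lra.
have L_le : L <= 100 * 64 * (sl * D) by rewrite /L; lra.
have L0 : 0 < L by rewrite /L; have := ltr0n R r; rewrite r0; lra.
have rR : 0 < r%:R :> R by rewrite ltr0n.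
have a0 : 0 < a by rewrite /a divr_gt0 // mulr_gt0 // mulr_gt0.
have a_le : C = K * (4 * (2 * 64 * (100 * 64))) -> a <= K^-1.
  move=> hC.
  rewrite ler_pdivrMr // ler_pdivlMl //; apply: le_trans hs'.
  have : r%:R * L <= (2 * (64 * (l * D))) * (100 * 64 * (sl * D)).
    by apply: ler_pM => //; rewrite ?ler0n ?ltW.
  rewrite (expr2 D) hC -!mulrA ler_pM2l // ler_pM2l //; lra.
rewrite -hK => /a_le {}a_le; clearbody a; clearbody L.
have eta_le : a ^+ 2 + 4 * a * 2 <= E^-1.
  have : a ^+ 2 <= K^-1 * a by rewrite expr2 ler_wpM2r // ltW.
  by rewrite hE; move: a_le; rewrite hK; lra.
have eta0 : 0 <= a ^+ 2 + 4 * a * 2 by rewrite addr_ge0 ?sqr_ge0 // !mulr_ge0 // ltW.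
have two0 : 0 < 2 ^+ r :> R by rewrite exprn_gt0.
have first : 64 ^+ r * ((a ^+ 2 + 4 * a * 2) ^+ r.-1 * (2 * a * L)) <= L / 2 ^+ r.
  apply: le_trans (_ : 64 ^+ r * ((E^-1) ^+ r.-1 * (2 * K^-1 * L)) <= _).
    rewrite ler_wpM2l ?exprn_ge0 //; apply: ler_pM.
    - by rewrite exprn_ge0.
    - by rewrite !mulr_ge0 // ltW.
    - by rewrite lerXn2r ?nnegrE // invr_ge0 ltW.
    - by rewrite ler_wpM2r ?(ltW L0) // ler_wpM2l.
  rewrite ler_pdivlMr //.
  have e1 : E^-1 ^+ r.-1 = E * E^-1 ^+ r :> R.
    by rewrite -[in RHS](prednK r0) exprS mulrA mulfV ?mul1r ?gt_eqF.
  have e2 : 64 ^+ r * E^-1 ^+ r * 2 ^+ r = 2^-1 ^+ r :> R.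
    by rewrite -!exprMn; congr (_ ^+ r); rewrite hE; lra.
  have e3 : 2^-1 ^+ r <= 1 :> R by rewrite exprn_ile1 // ?invr_ge0 // invf_le1 // ler1n.
  rewrite e1.
  have -> : 64 ^+ r * (E * E^-1 ^+ r * (2 * K^-1 * L)) * 2 ^+ r =
     (64 ^+ r * E^-1 ^+ r * 2 ^+ r) * (E * 2 * K^-1 * L) by ring.
  rewrite e2; apply: le_trans (ler_wpM2r _ e3) _; last by rewrite hE hK; lra.
  by rewrite !mulr_ge0 ?invr_ge0 // ltW.
suff big : 48 * (L * D) <= 2 ^+ r.
  have : L / 2 ^+ r <= 48^-1 * delta.
    rewrite ler_pdivrMr //; have := ler_wpM2l (ltW d0) big.
    have dD : delta * D = 1 by rewrite mulfV // gt_eqF.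
    rewrite (_ : delta * (48 * (L * D)) = 48 * L * (delta * D)); last by ring.
    rewrite dD; lra.
  lra.
have h1 : 2 ^+ r >= expR (2^-1 * r%:R) :> R.
  by rewrite mulrC expRM_natl lerXn2r ?nnegrE ?expR_ge0 // expR_half_le2.
apply: le_trans h1.
have h2 : expR (16 * l + 8 * D) <= expR (2^-1 * r%:R) by rewrite ler_expR; lra.
apply: le_trans h2; rewrite expRD.
have h3 := exp_dominates_linear sl0; rewrite -/l in h3.
have h4 := exp_dominates_square (ltW id0).
apply: le_trans (_ : 32 * 32 * 32 * sl * (16 * D ^+ 2) <= _); last first.
  apply: ler_pM => //; rewrite ?mulr_ge0 ?exprn_ge0 ?(ltW id0) //; lra.
have : L * D <= 100 * 64 * (sl * D) * D by rewrite ler_wpM2r // ltW.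
have : 0 <= sl * D ^+ 2 by rewrite mulr_ge0 ?sqr_ge0 //; lra.
rewrite (expr2 D); lra.
Qed.

End SampleSize.

(** * Sums over paired multi-indices *)

Section FinfunSums.
Context {R : realType}.

Definition fcons (T : finType) q (a : T) (f : {ffun 'I_q -> T}) : {ffun 'I_q.+1 -> T} :=
  [ffun j => if unlift ord0 j is Some j' then f j' else a].

Lemma fcons0 (T : finType) q (a : T) (f : {ffun 'I_q -> T}) : fcons a f ord0 = a.
Proof. by rewrite ffunE unlift_none. Qed.

Lemma fconsS (T : finType) q (a : T) (f : {ffun 'I_q -> T}) j :
  fcons a f (lift ord0 j) = f j.
Proof. by rewrite ffunE liftK. Qed.

Lemma sum_ffunS (T : finType) q (F : {ffun 'I_q.+1 -> T} -> R) :
  \sum_f F f = \sum_a \sum_(g : {ffun 'I_q -> T}) F (fcons a g).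
Proof.
rewrite pair_bigA (reindex (fun p : T * {ffun 'I_q -> T} => fcons p.1 p.2)) //=.
exists (fun f : {ffun 'I_q.+1 -> T} => (f ord0, [ffun j => f (lift ord0 j)])).
  case=> a g _; rewrite /= fcons0; congr pair.
  by apply/ffunP => j; rewrite ffunE fconsS.
move=> f _; apply/ffunP => j; rewrite ffunE /=.
by case: unliftP => [j' ->|->] //=; rewrite ffunE.
Qed.

Lemma sum_ffun0 (T : finType) (F : {ffun 'I_0 -> T} -> R) f0 : \sum_f F f = F f0.
Proof.
rewrite (big_pred1 f0) // => f; symmetry; apply/eqP/ffunP => -[] //.
Qed.

Definition proj1 (T U : finType) q (f : {ffun 'I_q -> T * U}) : {ffun 'I_q -> T} :=
  [ffun j => (f j).1].
Definition proj2 (T U : finType) q (f : {ffun 'I_q -> T * U}) : {ffun 'I_q -> U} :=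
  [ffun j => (f j).2].

Lemma proj1_fcons (T U : finType) q a (f : {ffun 'I_q -> T * U}) :
  proj1 (fcons a f) = fcons a.1 (proj1 f).
Proof. by apply/ffunP => j; rewrite !ffunE; case: unlift => // j'; rewrite ffunE. Qed.

Lemma proj2_fcons (T U : finType) q a (f : {ffun 'I_q -> T * U}) :
  proj2 (fcons a f) = fcons a.2 (proj2 f).
Proof. by apply/ffunP => j; rewrite !ffunE; case: unlift => // j'; rewrite ffunE. Qed.

Lemma sum_ffun_pair (T U : finType) q
    (F : {ffun 'I_q -> T} -> {ffun 'I_q -> U} -> R) :
  \sum_f \sum_g F f g = \sum_(h : {ffun 'I_q -> T * U}) F (proj1 h) (proj2 h).
Proof.
rewrite pair_bigA /=.
rewrite (reindex (fun h : {ffun 'I_q -> T * U} => (proj1 h, proj2 h))) //=.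
exists (fun p : {ffun 'I_q -> T} * {ffun 'I_q -> U} => [ffun j => (p.1 j, p.2 j)]).
  by move=> h _; apply/ffunP => j; rewrite !ffunE; case: (h j).
by case=> f g _; congr pair; apply/ffunP => j; rewrite !ffunE.
Qed.

Definition l2 (T : finType) (f : T -> R) : R := Num.sqrt (\sum_t f t ^+ 2).

Lemma l2_ge0 (T : finType) (f : T -> R) : 0 <= l2 f.
Proof. exact: sqrtr_ge0. Qed.

Lemma l2_sq (T : finType) (f : T -> R) : l2 f ^+ 2 = \sum_t f t ^+ 2.
Proof. by rewrite sqr_sqrtr // sumr_ge0 // => t _; exact: sqr_ge0. Qed.

Lemma sum_cauchy (T : finType) (f g : T -> R) :
  (\sum_t f t * g t) ^+ 2 <= (\sum_t f t ^+ 2) * (\sum_t g t ^+ 2).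
Proof.
pose col (h : T -> R) : 'cV[R]_(#|T|) := \col_i h (enum_val i).
have hsc h k : hs (col h) (col k) = \sum_t h t * k t.
  rewrite hsE (reindex _ (onW_bij _ (@enum_val_bij T))); apply: eq_bigr => i _.
  by rewrite big_ord1 !mxE.
by have := hs_cauchy (col f) (col g); rewrite !hsc.
Qed.

Lemma sum_le_l2 (T : finType) (f g : T -> R) : \sum_t f t * g t <= l2 f * l2 g.
Proof.
apply: le_trans (ler_norm _) _.
rewrite -(@ler_pXn2r _ 2) ?nnegrE ?mulr_ge0 ?l2_ge0 // real_normK ?num_real //.
by rewrite exprMn !l2_sq sum_cauchy.
Qed.

End FinfunSums.

Section Pairings.
Context {R : realType}.
Variable T : finType.

Local Notation T4 := ((T * T) * (T * T))%type.

(** The four indices cancel in pairs: for a uniform four-wise independent sign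
function this is the expectation of the product of the four signs. *)
Definition paired (w : T4) : bool :=
  [|| (w.1.1 == w.1.2) && (w.2.1 == w.2.2),
      (w.1.1 == w.2.1) && (w.1.2 == w.2.2) |
      (w.1.1 == w.2.2) && (w.1.2 == w.2.1)].

Lemma sum_delta (g : T -> R) a : \sum_b (a == b)%:R * g b = g a.
Proof.
rewrite (bigD1 a) //= eqxx mul1r big1 ?addr0 // => b ba.
by rewrite eq_sym (negbTE ba) mul0r.
Qed.

Lemma paired_sum1 (f1 f2 f3 f4 : T -> R) :
  (forall t, 0 <= f1 t) -> (forall t, 0 <= f2 t) ->
  (forall t, 0 <= f3 t) -> (forall t, 0 <= f4 t) ->
  \sum_(w : T4) (paired w)%:R * (f1 w.1.1 * f2 w.1.2 * (f3 w.2.1 * f4 w.2.2)) <=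
  3 * (l2 f1 * l2 f2 * (l2 f3 * l2 f4)).
Proof.
move=> p1 p2 p3 p4.
pose c (a b c e : T) := f1 a * f2 b * (f3 c * f4 e).
have E4 (F : T4 -> R) : \sum_w F w = \sum_a \sum_b \sum_c \sum_e F ((a, b), (c, e)).
  rewrite [RHS]pair_bigA; under [RHS]eq_bigr do rewrite pair_bigA.
  by rewrite [RHS]pair_bigA /=; apply: eq_bigr => -[[? ?] [? ?]].
have c1 : \sum_(w : T4) ((w.1.1 == w.1.2) && (w.2.1 == w.2.2))%:R *
    (f1 w.1.1 * f2 w.1.2 * (f3 w.2.1 * f4 w.2.2)) = (\sum_a f1 a * f2 a) * (\sum_a f3 a * f4 a).
  rewrite E4 /= mulr_suml; apply: eq_bigr => a _.
  rewrite mulr_sumr -[RHS](sum_delta (fun b => \sum_c f1 a * f2 b * (f3 c * f4 c)) a).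
  apply: eq_bigr => b _; rewrite mulr_sumr; apply: eq_bigr => c' _.
  rewrite -(sum_delta (fun e => f1 a * f2 b * (f3 c' * f4 e)) c') mulr_sumr.
  by apply: eq_bigr => e _; rewrite -mulnb natrM -!mulrA.
have c2 : \sum_(w : T4) ((w.1.1 == w.2.1) && (w.1.2 == w.2.2))%:R *
    (f1 w.1.1 * f2 w.1.2 * (f3 w.2.1 * f4 w.2.2)) = (\sum_a f1 a * f3 a) * (\sum_a f2 a * f4 a).
  rewrite E4 /= mulr_suml; apply: eq_bigr => a _; rewrite mulr_sumr; apply: eq_bigr => b _.
  rewrite [RHS](_ : _ = f1 a * f2 b * (f3 a * f4 b)); last by ring.
  rewrite -[RHS](sum_delta (fun c => f1 a * f2 b * (f3 c * f4 b)) a).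
  apply: eq_bigr => c' _; rewrite -(sum_delta (fun e => f1 a * f2 b * (f3 c' * f4 e)) b).
  by rewrite mulr_sumr; apply: eq_bigr => e _; rewrite -mulnb natrM -!mulrA.
have c3 : \sum_(w : T4) ((w.1.1 == w.2.2) && (w.1.2 == w.2.1))%:R *
    (f1 w.1.1 * f2 w.1.2 * (f3 w.2.1 * f4 w.2.2)) = (\sum_a f1 a * f4 a) * (\sum_a f2 a * f3 a).
  rewrite E4 /= mulr_suml; apply: eq_bigr => a _; rewrite mulr_sumr; apply: eq_bigr => b _.
  rewrite [RHS](_ : _ = f1 a * f2 b * (f3 b * f4 a)); last by ring.
  rewrite -[RHS](sum_delta (fun c => f1 a * f2 b * (f3 c * f4 a)) b).
  apply: eq_bigr => c' _; rewrite -(sum_delta (fun e => f1 a * f2 b * (f3 c' * f4 e)) a).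
  by rewrite mulr_sumr; apply: eq_bigr => e _; rewrite -mulnb natrM [(a == e)%:R * _]mulrC -!mulrA.
have cs (f g h k : T -> R) : (forall t, 0 <= f t) -> (forall t, 0 <= g t) ->
    (forall t, 0 <= h t) -> (forall t, 0 <= k t) ->
    (\sum_a f a * g a) * (\sum_a h a * k a) <= l2 f * l2 g * (l2 h * l2 k).
  move=> *; apply: ler_pM; rewrite ?sum_le_l2 //.
    by apply: sumr_ge0 => a _; rewrite mulr_ge0.
  by apply: sumr_ge0 => a _; rewrite mulr_ge0.
have h1 := cs f1 f2 f3 f4 p1 p2 p3 p4.
have h2 := cs f1 f3 f2 f4 p1 p3 p2 p4.
have h3 := cs f1 f4 f2 f3 p1 p4 p2 p3.
rewrite -c1 in h1; rewrite -c2 in h2; rewrite -c3 in h3.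
apply: le_trans (_ : _ <= l2 f1 * l2 f2 * (l2 f3 * l2 f4) + l2 f1 * l2 f3 * (l2 f2 * l2 f4)
   + l2 f1 * l2 f4 * (l2 f2 * l2 f3)) _; last by lra.
apply: le_trans (lerD (lerD h1 h2) h3).
rewrite -!big_split /=; apply: ler_sum => w _.
rewrite -!mulrDl ler_wpM2r ?mulr_ge0 // /paired -!natrD ler_nat.
by do 3 case: (_ && _).
Qed.

(** Tensorization: peeling off one coordinate multiplies the constant by the
[3] pairings of four indices. *)
Lemma paired_sum q (f1 f2 f3 f4 : {ffun 'I_q -> T} -> R) :
  (forall t, 0 <= f1 t) -> (forall t, 0 <= f2 t) ->
  (forall t, 0 <= f3 t) -> (forall t, 0 <= f4 t) ->
  \sum_(w : {ffun 'I_q -> T4}) (\prod_j (paired (w j))%:R) *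
     (f1 (proj1 (proj1 w)) * f2 (proj2 (proj1 w)) *
      (f3 (proj1 (proj2 w)) * f4 (proj2 (proj2 w)))) <=
  3 ^+ q * (l2 f1 * l2 f2 * (l2 f3 * l2 f4)).
Proof.
elim: q f1 f2 f3 f4 => [|q IH] f1 f2 f3 f4 p1 p2 p3 p4.
  have [w0|] := pickP {ffun 'I_0 -> T4}; last first.
    by move=> no; rewrite big1 => [|w]; [rewrite !mulr_ge0 ?l2_ge0|have := no w].
  move=> _; rewrite (sum_ffun0 _ w0) big_ord0 expr0 !mul1r /l2.
  rewrite !(sum_ffun0 _ (proj1 (proj1 w0))) !sqrtr_sqr.
  have e (w w' : {ffun 'I_0 -> T}) : w = w' by apply/ffunP => -[].
  rewrite (e (proj2 (proj1 w0)) (proj1 (proj1 w0))) (e (proj1 (proj2 w0)) (proj1 (proj1 w0))).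
  by rewrite (e (proj2 (proj2 w0)) (proj1 (proj1 w0))) !ger0_norm.
have l2S (f : {ffun 'I_q.+1 -> T} -> R) :
    l2 f = l2 (fun a => l2 (fun g : {ffun 'I_q -> T} => f (fcons a g))).
  rewrite /l2 sum_ffunS; congr Num.sqrt; apply: eq_bigr => a _.
  by rewrite sqr_sqrtr // sumr_ge0 // => g _; exact: sqr_ge0.
rewrite sum_ffunS (l2S f1) (l2S f2) (l2S f3) (l2S f4) exprSr -mulrA.
apply: le_trans (ler_wpM2l (exprn_ge0 q _) (paired_sum1 _ _ _ _)) => //;
  try by move=> t; exact: l2_ge0.
rewrite mulr_sumr; apply: ler_sum => a _.
rewrite mulrCA; under eq_bigr => w _.
  rewrite big_ord_recl fcons0; under eq_bigr do rewrite fconsS.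
  rewrite !(proj1_fcons, proj2_fcons) -mulrA; over.
by rewrite -mulr_sumr ler_wpM2l // IH.
Qed.

End Pairings.

(** * Second moments of the TensorSketch cross terms *)

Section TensorSketchMoment.
Context {R : realType}.
Variables d s : nat.
Hypothesis s0 : (0 < s)%N.
Local Notation hashes := {ffun 'I_d -> 'I_s}.
Local Notation signs := {ffun 'I_d -> bool}.
Local Notation indices q := {ffun 'I_q -> 'I_d}.
Local Notation index_pairs q := {ffun 'I_q -> 'I_d * 'I_d}.

(** The consequence of independence that enters the collision bound. *)
Definition pairwise_hash (mu : hashes -> R) :=
  [/\ forall h, 0 <= mu h, \sum_h mu h = 1 &
      forall i i' b b', i != i' ->
        \sum_h mu h * ((h i == b) && (h i' == b'))%:R = s%:R^-1 ^+ 2].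

(** The consequence of independence that enters the second moment, where four
signs of the same function meet in each coordinate. *)
Definition fourwise_sign (nu : signs -> R) :=
  (forall g, 0 <= nu g) /\
  forall w : ('I_d * 'I_d) * ('I_d * 'I_d),
    \sum_g nu g * ((-1) ^+ g w.1.1 * (-1) ^+ g w.1.2 *
                   ((-1) ^+ g w.2.1 * (-1) ^+ g w.2.2)) = (paired w)%:R.

Lemma sum_modn_le1 x y : \sum_(b < s) (x + b == y %[mod s])%:R <= 1 :> R.
Proof.
have [b0 /eqP h0|no] := pickP (fun b : 'I_s => x + b == y %[mod s]); last first.
  by rewrite big1 // => b _; rewrite no.
rewrite (bigD1 b0) //= h0 eqxx big1 ?addr0 // => b bb0.
case: eqP => // hb; case/eqP: bb0; apply: val_inj => /=.
have /eqP := etrans hb (esym h0); rewrite eqn_modDl => /eqP.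
by rewrite !modn_small.
Qed.

(** Given the value at [i'], one value at [i] at most collides with it. The offsets
[x], [y] carry the other hashes in the induction of [multi_collision]. *)
Lemma pairwise_collision (mu : hashes -> R) x y (i i' : 'I_d) :
  pairwise_hash mu -> i != i' ->
  \sum_h mu h * (x + h i == y + h i' %[mod s])%:R <= s%:R^-1.
Proof.
case=> mu0 mu1 mu2 ii'.
have -> : \sum_h mu h * (x + h i == y + h i' %[mod s])%:R =
    \sum_(b' < s) \sum_(b < s) s%:R^-1 ^+ 2 * (x + b == y + b' %[mod s])%:R.
  transitivity (\sum_(b' < s) \sum_(b < s) \sum_h
      (mu h * ((h i == b) && (h i' == b'))%:R) * (x + b == y + b' %[mod s])%:R); last first.
    by apply: eq_bigr => b' _; apply: eq_bigr => b _; rewrite -mulr_suml mu2.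
  under [RHS]eq_bigr do rewrite exchange_big; rewrite exchange_big /=.
  apply: eq_bigr => h _; symmetry.
  rewrite (bigD1 (h i')) //= (bigD1 (h i)) //= !eqxx mulr1 !big1 ?addr0 //.
    by move=> b' bh; rewrite big1 // => b _; rewrite [h i' == _]eq_sym (negbTE bh) andbF mulr0 mul0r.
  by move=> b bh; rewrite [h i == _]eq_sym (negbTE bh) mulr0 mul0r.
apply: le_trans (_ : \sum_(b' < s) s%:R^-1 ^+ 2 <= _).
  apply: ler_sum => b' _; rewrite -mulr_sumr -[leRHS]mulr1.
  by rewrite ler_wpM2l ?sqr_ge0 ?sum_modn_le1.
by rewrite sumr_const card_ord -(mulr_natl (_ ^+ 2)) expr2 mulVKf // pnatr_eq0 -lt0n.
Qed.

Lemma sum_prod_ffun (T : finType) q (F : 'I_q -> T -> R) :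
  \sum_(f : {ffun 'I_q -> T}) \prod_j F j (f j) = \prod_j \sum_t F j t.
Proof. by rewrite bigA_distr_bigA. Qed.

(** A sum of independent hashes collides as rarely as one of them, at any
coordinate where the two multi-indices differ. *)
Lemma multi_collision q (mu : 'I_q -> hashes -> R) x y (I J : indices q) :
  (forall j, pairwise_hash (mu j)) -> I != J ->
  \sum_(eta : {ffun 'I_q -> hashes}) (\prod_j mu j (eta j)) *
    (x + \sum_j eta j (I j) == y + \sum_j eta j (J j) %[mod s])%:R <= s%:R^-1.
Proof.
elim: q mu x y I J => [|q IH] mu x y I J hmu IJ.
  by case/eqP: IJ; apply/ffunP => -[].
have hmu' j : pairwise_hash (mu (lift ord0 j)) by [].
have [mu0 mu1 _] := hmu ord0.
pose tail (K : indices q.+1) : indices q := [ffun j => K (lift ord0 j)].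
have split (a : hashes) (g : {ffun 'I_q -> hashes}) (K : indices q.+1) z :
    (z + \sum_j fcons a g j (K j) = z + a (K ord0) + \sum_j g j (tail K j))%N.
  rewrite big_ord_recl fcons0 addnA; congr addn.
  by apply: eq_bigr => j _; rewrite fconsS ffunE.
have prodS (a : hashes) (g : {ffun 'I_q -> hashes}) :
    \prod_j mu j (fcons a g j) = mu ord0 a * \prod_j mu (lift ord0 j) (g j).
  by rewrite big_ord_recl fcons0; congr (_ * _); apply: eq_bigr => j _; rewrite fconsS.
rewrite sum_ffunS; under eq_bigr => a _ do
  under eq_bigr => g _ do rewrite prodS !split -mulrA.
have [I0|I0] := eqVneq (I ord0) (J ord0).
  have IJ' : tail I != tail J.
    apply: contra IJ => /eqP/ffunP e; apply/eqP/ffunP => j.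
    by case: (unliftP ord0 j) => [j' ->|->] //; have := e j'; rewrite !ffunE.
  apply: le_trans (_ : \sum_a mu ord0 a * s%:R^-1 <= _); last by rewrite -mulr_suml mu1 mul1r.
  apply: ler_sum => a _.
  by rewrite -mulr_sumr; apply: ler_wpM2l => //; exact: (IH (fun j => mu (lift ord0 j))) hmu' IJ'.
rewrite exchange_big /=.
apply: le_trans (_ : \sum_(g : {ffun 'I_q -> hashes})
   (\prod_j mu (lift ord0 j) (g j)) * s%:R^-1 <= _).
  apply: ler_sum => g _.
  under eq_bigr => a _ do rewrite mulrCA addnAC [(y + _ + _)%N]addnAC.
  rewrite -mulr_sumr ler_wpM2l ?pairwise_collision //.
  by apply: prodr_ge0 => j _; case: (hmu' j).
rewrite -mulr_suml (sum_prod_ffun (fun j => mu (lift ord0 j))) big1 ?mul1r // => j _.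
by case: (hmu' j).
Qed.

Variable q : nat.
Variables (mu : 'I_q -> hashes -> R) (nu : 'I_q -> signs -> R).
Hypothesis hmu : forall j, pairwise_hash (mu j).
Hypothesis hnu : forall j, fourwise_sign (nu j).

Definition sketch_mean (F : {ffun 'I_q -> hashes} -> {ffun 'I_q -> signs} -> R) : R :=
  \sum_(eta : {ffun 'I_q -> hashes}) \sum_(gam : {ffun 'I_q -> signs}) ((\prod_j mu j (eta j)) * (\prod_j nu j (gam j))) * F eta gam.

Definition collide (eta : {ffun 'I_q -> hashes}) (Q : index_pairs q) : bool :=
  (\sum_j eta j (proj1 Q j) == \sum_j eta j (proj2 Q j) %[mod s]).

Definition pair_sign (gam : {ffun 'I_q -> signs}) (Q : index_pairs q) : R :=
  \prod_j ((-1) ^+ gam j (Q j).1 * (-1) ^+ gam j (Q j).2).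

(** The error of the sketched inner product of [u] and [v]; see [sketch_error]. *)
Definition cross_terms (u v : indices q -> R) eta gam : R :=
  \sum_Q (proj1 Q != proj2 Q)%:R * (u (proj1 Q) * v (proj2 Q)) *
     (pair_sign gam Q * (collide eta Q)%:R).

Lemma mean_pair_sign (Q Q' : index_pairs q) :
  \sum_(gam : {ffun 'I_q -> signs}) (\prod_j nu j (gam j)) *
    (pair_sign gam Q * pair_sign gam Q') = \prod_j (paired (Q j, Q' j))%:R.
Proof.
pose F j (g : signs) : R := nu j g * ((-1) ^+ g (Q j).1 * (-1) ^+ g (Q j).2 *
    ((-1) ^+ g (Q' j).1 * (-1) ^+ g (Q' j).2)).
transitivity (\sum_(gam : {ffun 'I_q -> signs}) \prod_j F j (gam j)).
  by apply: eq_bigr => gam _; rewrite /pair_sign /F !big_split.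
rewrite sum_prod_ffun; apply: eq_bigr => j _; have [_ h] := hnu j.
by rewrite -(h (Q j, Q' j)).
Qed.

(** The second collision is bounded by one: the signs alone account for the
dependence between the two pairs of indices. *)
Lemma mean_collide (Q Q' : index_pairs q) : proj1 Q != proj2 Q ->
  0 <= \sum_(eta : {ffun 'I_q -> hashes}) (\prod_j mu j (eta j)) *
    ((collide eta Q)%:R * (collide eta Q')%:R) <= s%:R^-1.
Proof.
move=> QQ.
have w0 (eta : {ffun 'I_q -> hashes}) : 0 <= \prod_j mu j (eta j).
  by apply: prodr_ge0 => j _; case: (hmu j).
apply/andP; split.
  by apply: sumr_ge0 => eta _; rewrite mulr_ge0 // mulr_ge0 ?ler0n.
apply: le_trans (multi_collision 0 0 hmu QQ); apply: ler_sum => eta _.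
by rewrite ler_wpM2l // /collide -[leRHS]mulr1 !add0n ler_wpM2l ?ler0n // lern1 leq_b1.
Qed.

(** Signs leave only the index quadruples that pair up in every coordinate,
collisions contribute [1 / s], and [paired_sum] bounds what remains. *)
Lemma cross_moment (u v u' v' : indices q -> R) :
  sketch_mean (fun eta gam => cross_terms u v eta gam * cross_terms u' v' eta gam) <=
  3 ^+ q / s%:R * (l2 u * l2 v * (l2 u' * l2 v')).
Proof.
pose c (a b : indices q -> R) (Q : index_pairs q) : R :=
  (proj1 Q != proj2 Q)%:R * (a (proj1 Q) * b (proj2 Q)).
have -> : sketch_mean (fun eta gam => cross_terms u v eta gam * cross_terms u' v' eta gam) =
    \sum_(Q : index_pairs q) \sum_(Q' : index_pairs q) c u v Q * c u' v' Q' *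
     ((\sum_(gam : {ffun 'I_q -> signs}) (\prod_j nu j (gam j)) *
        (pair_sign gam Q * pair_sign gam Q')) *
      (\sum_(eta : {ffun 'I_q -> hashes}) (\prod_j mu j (eta j)) *
         ((collide eta Q)%:R * (collide eta Q')%:R))).
  pose t eta gam a b Q : R := c a b Q * (pair_sign gam Q * (collide eta Q)%:R).
  transitivity (\sum_(eta : {ffun 'I_q -> hashes}) \sum_(gam : {ffun 'I_q -> signs})
      \sum_Q \sum_Q'
      (\prod_j mu j (eta j)) * (\prod_j nu j (gam j)) * (t eta gam u v Q * t eta gam u' v' Q')).
    rewrite /sketch_mean; apply: eq_bigr => eta _; apply: eq_bigr => gam _.
    rewrite /cross_terms mulr_suml mulr_sumr; apply: eq_bigr => Q _.
    by rewrite !mulr_sumr.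
  under eq_bigr => eta _ do rewrite exchange_big /=.
  rewrite exchange_big /=; apply: eq_bigr => Q _.
  under eq_bigr => eta _ do rewrite exchange_big /=.
  rewrite exchange_big /=; apply: eq_bigr => Q' _.
  rewrite [_ * \sum_eta _]mulrC mulr_suml mulr_sumr; apply: eq_bigr => eta _.
  by rewrite !mulr_sumr; apply: eq_bigr => gam _; rewrite /t; ring.
apply: le_trans (_ : \sum_(Q : index_pairs q) \sum_(Q' : index_pairs q) s%:R^-1 * ((\prod_j (paired (Q j, Q' j))%:R) *
   (`|u (proj1 Q)| * `|v (proj2 Q)| * (`|u' (proj1 Q')| * `|v' (proj2 Q')|))) <= _).
  apply: ler_sum => Q _; apply: ler_sum => Q' _; rewrite mean_pair_sign.
  have p0 : 0 <= \prod_j (paired (Q j, Q' j))%:R :> R by apply: prodr_ge0 => j _; rewrite ler0n.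
  have [QQ|/(mean_collide Q')/andP[e0 e1]] := eqVneq (proj1 Q) (proj2 Q).
    by rewrite /c QQ eqxx !mul0r mulr_ge0 ?invr_ge0 ?ler0n // mulr_ge0 // !mulr_ge0.
  apply: le_trans (ler_norm _) _; rewrite normrM [leRHS]mulrCA mulrC.
  rewrite normrM (ger0_norm p0) (ger0_norm e0) -[leLHS]mulrA ler_wpM2l //.
  apply: ler_pM => //; rewrite /c !normrM !normr_nat.
  by apply: ler_pM; rewrite ?mulr_ge0 ?ler0n // ler_piMl ?mulr_ge0 // lern1 leq_b1.
under eq_bigr => Q _ do rewrite -mulr_sumr; rewrite -mulr_sumr (mulrC (3 ^+ q)) -[leRHS]mulrA ler_wpM2l ?invr_ge0 ?ler0n //.
rewrite (sum_ffun_pair (fun Q Q' : index_pairs q => (\prod_j (paired (Q j, Q' j))%:R) *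
   (`|u (proj1 Q)| * `|v (proj2 Q)| * (`|u' (proj1 Q')| * `|v' (proj2 Q')|)))).
have l2n (f : indices q -> R) : l2 f = l2 (fun I => `|f I|).
  by congr Num.sqrt; apply: eq_bigr => I _; rewrite real_normK ?num_real.
rewrite (l2n u) (l2n v) (l2n u') (l2n v').
apply: le_trans (paired_sum _ _ _ _) => //; apply: ler_sum => w _.
rewrite le_eqVlt; apply/orP; left; apply/eqP; congr (_ * _).
by apply: eq_bigr => j _; rewrite !ffunE; case: (w j).
Qed.

End TensorSketchMoment.

(** * The Gram matrix of a sketched matrix *)

Section SketchedGram.
Context {R : realType}.
Variables d s q : nat.
Hypothesis s0 : (0 < s)%N.
Local Notation hashes := {ffun 'I_d -> 'I_s}.
Local Notation signs := {ffun 'I_d -> bool}.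
Local Notation indices := {ffun 'I_q -> 'I_d}.
Local Notation index_pairs := {ffun 'I_q -> 'I_d * 'I_d}.
Local Notation N := #|[the finType of indices]|.

Definition coords (u : 'cV[R]_N) (I : indices) : R := u (enum_rank I) 0.

Lemma hs_coords (u v : 'cV[R]_N) : hs u v = \sum_I coords u I * coords v I.
Proof.
rewrite hsE (reindex _ (onW_bij _ (@enum_rank_bij _))).
by apply: eq_bigr => I _; rewrite big_ord1.
Qed.

Lemma l2_coords (u : 'cV[R]_N) : l2 (coords u) ^+ 2 = hs u u.
Proof. by rewrite l2_sq hs_coords; apply: eq_bigr => I _; rewrite expr2. Qed.

Variables (eta : {ffun 'I_q -> hashes}) (gam : {ffun 'I_q -> signs}).
Local Notation S := (@tensor_sketch_mx R d q s eta gam).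

Lemma sketch_mulE (u : 'cV[R]_N) (r : 'I_s) :
  (S *m u) r 0 = \sum_(I : indices) (\prod_j (-1) ^+ gam j (I j)) *
    (val r == ((\sum_j eta j (I j)) %% s)%N)%:R * coords u I.
Proof.
rewrite mxE (reindex _ (onW_bij _ (@enum_rank_bij _))).
by apply: eq_bigr => I _; rewrite mxE enum_rankK.
Qed.

Lemma sum_bucket (x y : nat) :
  \sum_(r < s) (val r == (x %% s)%N)%:R * (val r == (y %% s)%N)%:R =
  (x == y %[mod s])%:R :> R.
Proof.
rewrite (bigD1 (Ordinal (ltn_pmod x s0))) //= eqxx mul1r big1 ?addr0 // => r rx.
rewrite (_ : (val r == _) = false) ?mul0r //; apply: contraNF rx => /eqP e.
exact/eqP/val_inj.
Qed.

(** The diagonal terms of the sketched inner product add up to the exact one,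
because signs square to one and every index collides with itself. *)
Lemma sketch_error (u v : 'cV[R]_N) :
  hs (S *m u) (S *m v) - hs u v = cross_terms (coords u) (coords v) eta gam.
Proof.
pose F (I J : indices) : R := coords u I * coords v J *
   ((\prod_j (-1) ^+ gam j (I j)) * (\prod_j (-1) ^+ gam j (J j)) *
    (\sum_j eta j (I j) == \sum_j eta j (J j) %[mod s])%:R).
have -> : hs (S *m u) (S *m v) = \sum_I \sum_J F I J.
  rewrite hsE.
  transitivity (\sum_(r < s) \sum_I \sum_J coords u I * coords v J *
     ((\prod_j (-1) ^+ gam j (I j)) * (\prod_j (-1) ^+ gam j (J j)) *
      ((val r == ((\sum_j eta j (I j)) %% s)%N)%:R *
       (val r == ((\sum_j eta j (J j)) %% s)%N)%:R))).
    apply: eq_bigr => r _; rewrite big_ord1 !sketch_mulE mulr_suml.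
    by apply: eq_bigr => I _; rewrite mulr_sumr; apply: eq_bigr => J _; ring.
  rewrite exchange_big /=; apply: eq_bigr => I _.
  rewrite exchange_big /=; apply: eq_bigr => J _.
  by rewrite -!mulr_sumr sum_bucket.
have diag : hs u v = \sum_(I : indices) F I I.
  rewrite hs_coords; apply: eq_bigr => I _; rewrite /F eqxx mulr1 -big_split /=.
  rewrite big1 ?mulr1 // => j _; rewrite -expr2 sqrr_sign //.
have -> : cross_terms (coords u) (coords v) eta gam = \sum_I \sum_J (I != J)%:R * F I J.
  rewrite sum_ffun_pair; apply: eq_bigr => Q _; rewrite /F -!mulrA; congr (_ * _).
  rewrite /pair_sign big_split /= -!mulrA; congr (_ * (_ * (_ * (_ * _)))).
    by apply: eq_bigr => j _; rewrite ffunE.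
  by apply: eq_bigr => j _; rewrite ffunE.
rewrite diag -sumrB; apply: eq_bigr => I _.
rewrite (bigD1 I) //= [in RHS](bigD1 I) //= eqxx mul0r add0r addrAC subrr add0r.
by apply: eq_bigr => J; rewrite eq_sym => ->; rewrite mul1r.
Qed.

End SketchedGram.

Section GoodSketch.
Context {R : realType}.

(** Keeping the Gram matrix in Frobenius norm controls the operator norm; keeping
its trace controls the total energy that the sampling step has to spread. *)
Definition good_sketch n m N (B : 'M[R]_(n, N)) (B1 : 'M[R]_(n, m)) : bool :=
  let D := B1 *m B1^T - B *m B^T in (hs D D <= 16^-1) && ((\tr D) ^+ 2 <= 4^-1).

End GoodSketch.

Section SketchedMoments.
Context {R : realType}.
Variables d s q n : nat.
Hypothesis s0 : (0 < s)%N.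
Local Notation hashes := {ffun 'I_d -> 'I_s}.
Local Notation signs := {ffun 'I_d -> bool}.
Local Notation indices := {ffun 'I_q -> 'I_d}.
Local Notation N := #|[the finType of indices]|.
Variables (mu : 'I_q -> hashes -> R) (nu : 'I_q -> signs -> R).
Hypothesis hmu : forall j, pairwise_hash (mu j).
Hypothesis hnu : forall j, fourwise_sign (nu j).
Variable B : 'M[R]_(n, N).

Definition gram_error (eta : {ffun 'I_q -> hashes}) (gam : {ffun 'I_q -> signs}) : 'M[R]_n :=
  let S := tensor_sketch_mx eta gam in (B *m S^T) *m (B *m S^T)^T - B *m B^T.

Let brow i : 'cV[R]_N := (row i B)^T.

Lemma gram_errorE eta gam i j : gram_error eta gam i j =
  cross_terms (coords (brow i)) (coords (brow j)) eta gam.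
Proof.
rewrite -sketch_error // /gram_error; set S := tensor_sketch_mx _ _.
have e (m : nat) (X : 'M[R]_(n, m)) : (X *m X^T) i j = hs (row i X)^T (row j X)^T.
  by rewrite hsE mxE; apply: eq_bigr => l _; rewrite big_ord1 !mxE.
rewrite mxE [X in _ + X]mxE !e; congr (_ - _).
by rewrite !row_mul !trmx_mul !trmxK.
Qed.

Lemma sum_brow : \sum_i hs (brow i) (brow i) = hs B B.
Proof.
rewrite [RHS]hsE; apply: eq_bigr => i _; rewrite hsE.
by apply: eq_bigr => l _; rewrite big_ord1 !mxE.
Qed.

Lemma sketch_mean_sum (I : finType) F :
  sketch_mean mu nu (fun eta gam => \sum_(i : I) F i eta gam) =
  \sum_i sketch_mean mu nu (F i).
Proof.
rewrite /sketch_mean [RHS]exchange_big; apply: eq_bigr => eta _.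
by rewrite [RHS]exchange_big; apply: eq_bigr => gam _; rewrite mulr_sumr.
Qed.

Lemma sketch_mean_le F G : (forall eta gam, F eta gam <= G eta gam) ->
  sketch_mean mu nu F <= sketch_mean mu nu G.
Proof.
move=> FG; apply: ler_sum => eta _; apply: ler_sum => gam _; rewrite ler_wpM2l //.
by rewrite mulr_ge0 // prodr_ge0 // => j _; [case: (hmu j)|case: (hnu j)].
Qed.

Lemma sketch_meanD a b F G :
  sketch_mean mu nu (fun eta gam => a * F eta gam + b * G eta gam) =
  a * sketch_mean mu nu F + b * sketch_mean mu nu G.
Proof.
rewrite /sketch_mean !mulr_sumr -big_split /=; apply: eq_bigr => eta _.
rewrite !mulr_sumr -big_split /=; apply: eq_bigr => gam _; ring.
Qed.

Let prod_rows : \sum_i \sum_j 3 ^+ q / s%:R * (hs (brow i) (brow i) * hs (brow j) (brow j)) =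
  3 ^+ q / s%:R * hs B B ^+ 2.
Proof.
rewrite expr2 -sum_brow mulr_suml mulr_sumr; apply: eq_bigr => i _.
by rewrite mulr_sumr mulr_sumr.
Qed.

Lemma gram_error_moment :
  sketch_mean mu nu (fun eta gam => hs (gram_error eta gam) (gram_error eta gam)) <=
  3 ^+ q / s%:R * hs B B ^+ 2.
Proof.
rewrite -prod_rows.
have -> : (fun eta gam => hs (gram_error eta gam) (gram_error eta gam)) =
  (fun eta gam => \sum_i \sum_j cross_terms (coords (brow i)) (coords (brow j)) eta gam *
                   cross_terms (coords (brow i)) (coords (brow j)) eta gam).
  apply/funext => eta; apply/funext => gam; rewrite hsE.
  by do 2 (apply: eq_bigr => ? _); rewrite !gram_errorE.
rewrite sketch_mean_sum; apply: ler_sum => i _.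
rewrite sketch_mean_sum; apply: ler_sum => j _.
apply: le_trans (cross_moment _ hmu hnu _ _ _ _) _ => //.
by rewrite -!l2_coords !expr2 le_eqVlt; apply/orP; left; apply/eqP; ring.
Qed.

(** The trace error is the sum of the errors of the squared row norms; their
products are covered by [cross_moment] with distinct rows. *)
Lemma gram_trace_moment :
  sketch_mean mu nu (fun eta gam => (\tr (gram_error eta gam)) ^+ 2) <=
  3 ^+ q / s%:R * hs B B ^+ 2.
Proof.
rewrite -prod_rows.
have -> : (fun eta gam => (\tr (gram_error eta gam)) ^+ 2) =
  (fun eta gam => \sum_i \sum_j cross_terms (coords (brow i)) (coords (brow i)) eta gam *
                   cross_terms (coords (brow j)) (coords (brow j)) eta gam).
  apply/funext => eta; apply/funext => gam; rewrite expr2 /mxtrace mulr_suml.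
  by apply: eq_bigr => i _; rewrite mulr_sumr; apply: eq_bigr => j _; rewrite !gram_errorE.
rewrite sketch_mean_sum; apply: ler_sum => i _.
rewrite sketch_mean_sum; apply: ler_sum => j _.
apply: le_trans (cross_moment _ hmu hnu _ _ _ _) _ => //.
by rewrite -!l2_coords !expr2.
Qed.

(** Markov's inequality for [16] times the squared Frobenius error plus [4] times
the squared trace error: [20 / 32] of [delta] is spent here. *)
Lemma sketch_failure (delta : R) : 0 < delta ->
  32 * (2 + 3 ^+ q) * hs B B ^+ 2 / delta <= s%:R ->
  sketch_mean mu nu (fun eta gam =>
    (~~ good_sketch B (B *m (tensor_sketch_mx eta gam)^T))%:R) <= 5 / 8 * delta.
Proof.
move=> d0 hs1; have sR : 0 < s%:R :> R by rewrite ltr0n.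
apply: le_trans (_ : 16 * (3 ^+ q / s%:R * hs B B ^+ 2) + 4 * (3 ^+ q / s%:R * hs B B ^+ 2) <= _).
  apply: le_trans (lerD (ler_wpM2l _ gram_error_moment) (ler_wpM2l _ gram_trace_moment)) => //.
  rewrite -sketch_meanD; apply: sketch_mean_le => eta gam; rewrite /good_sketch -/(gram_error eta gam).
  have h0 := hs_ge0 (gram_error eta gam); have t0 := sqr_ge0 (\tr (gram_error eta gam)).
  have [h1|h1] := leP (hs (gram_error eta gam) _) 16^-1; rewrite /=; last by lra.
  by have [h2|h2] := leP ((\tr (gram_error eta gam)) ^+ 2) 4^-1; rewrite /=; lra.
rewrite ler_pdivrMr // in hs1.
have H0 : 0 <= hs B B ^+ 2 by exact: sqr_ge0.
have c : 3 ^+ q / s%:R * hs B B ^+ 2 <= delta / 32.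
  rewrite mulrAC ler_pdivrMr //; lra.
lra.
Qed.

End SketchedMoments.

(** * Preconditioned conjugate gradients at condition number three *)

Section Projection.
Context {R : realType}.
Variables (n : nat) (A : 'M[R]_n).
Hypothesis sA : A^T = A.
Hypothesis A0 : forall x, x != 0 -> 0 < qform A x.

Let ip (x y : 'cV[R]_n) : R := hs x (A *m y).

Lemma ipC x y : ip x y = ip y x.
Proof. by rewrite /ip hsC hs_mulmx sA hsC hsC. Qed.

Lemma ip_suml x y z : ip (x + y) z = ip x z + ip y z.
Proof. exact: hsDl. Qed.

(** Gram-Schmidt in the inner product of [A], one generator at a time. *)
Lemma span_projection (ws : seq ('cV[R]_n)) (c : 'cV[R]_n) :
  exists2 x, x \in span ws & forall v, v \in span ws -> ip (x - c) v = 0.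
Proof.
elim: ws c => [|v ws IH] c.
  exists 0; first exact: mem0v.
  by move=> v; rewrite span_nil memv0 => /eqP ->; rewrite /ip mulmx0 hsC hs0l.
have [p ps pv] := IH v; have [x xs xc] := IH c.
pose v' := v - p; pose a := ip (c - x) v' / ip v' v'.
have v's w : w \in span ws -> ip v' w = 0.
  by move=> w_in; rewrite /v' -opprB /ip hsNl; have := pv w w_in; rewrite /ip => ->; rewrite oppr0.
have v'span : v' \in span (v :: ws).
  by rewrite rpredB // span_cons; [rewrite (subvP (addvSl _ _)) ?memv_line|rewrite (subvP (addvSr _ _))].
exists (x + a *: v').
  by rewrite rpredD ?rpredZ // span_cons (subvP (addvSr _ _)).
have orth_s w : w \in span ws -> ip (x + a *: v' - c) w = 0.
  move=> w_in; rewrite addrAC /ip hsDl hsZl.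
  by have := xc w w_in; have := v's w w_in; rewrite /ip => -> ->; rewrite mulr0 addr0.
have orth_v' : ip (x + a *: v' - c) v' = 0.
  rewrite addrAC -opprB [- _ + _]addrC /ip hsDl hsNl hsZl -/(ip v' v') -/(ip (c - x) v').
  have [v0|v0] := eqVneq v' 0.
    by rewrite /ip v0 mulmx0 ![hs _ 0]hsC !hs0l; ring.
  by rewrite /a divfK ?subrr // gt_eqF // /ip -qformE A0.
move=> w; rewrite span_cons => /memv_addP[w1 /vlineP[k ->] [w2 w2s ->]].
rewrite ipC ip_suml ipC (ipC w2) (orth_s w2) // addr0 /ip -scalemxAr hsZr.
suff -> : v = v' + p by rewrite mulmxDr hsDr -/(ip _ v') -/(ip _ p) orth_v' (orth_s p) // addr0 mulr0.
by rewrite /v' subrK.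
Qed.

Lemma span_minimizer (ws : seq ('cV[R]_n)) (c : 'cV[R]_n) :
  exists2 x, x \in span ws &
    forall x', x' \in span ws -> qform A (x - c) <= qform A (x' - c).
Proof.
have [x xs orth] := span_projection ws c; exists x => // x' x's.
have -> : x' - c = (x - c) + (x' - x) by rewrite [RHS]addrC addrA subrK.
set z := x' - x; have zs : z \in span ws by rewrite rpredB.
have h1 := orth z zs; move: h1; set y := x - c => h1; clearbody y z.
rewrite !qformE mulmxDr !hsDl !hsDr.
have h2 := ipC z y; rewrite /ip in h1 h2; rewrite h2 !h1 addr0 add0r lerDl -qformE.
by have [->|/A0/ltW//] := eqVneq z 0; rewrite qformE hs0l.
Qed.

End Projection.

Section ChebyshevBound.
Context {R : realType}.

(** The Chebyshev polynomials [T_k], [U_(k-1)] evaluated at [e]. For the eigenvalues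
[z] of the preconditioned matrix, which lie between [2/3] and [2], the value
[e = 2 - 3 z / 2] lies between [-1] and [1]; at [z = 0] it is [2]. *)
Fixpoint cheb (S : pzRingType) (e : S) (k : nat) : S * S :=
  if k is k'.+1 then
    let: (t, u) := cheb e k' in (e * t + (e ^+ 2 - 1) * u, t + e * u)
  else (1, 0).

Lemma chebS (S : pzRingType) (e : S) k :
  cheb e k.+1 = (e * (cheb e k).1 + (e ^+ 2 - 1) * (cheb e k).2, (cheb e k).1 + e * (cheb e k).2).
Proof. by rewrite /=; case: (cheb e k). Qed.

Lemma cheb_pell (S : comPzRingType) (e : S) k :
  (cheb e k).1 ^+ 2 - (e ^+ 2 - 1) * (cheb e k).2 ^+ 2 = 1.
Proof.
elim: k => [|k IH]; first by rewrite /= expr1n expr0n mulr0 subr0.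
rewrite chebS /= -[RHS]IH; ring.
Qed.

Lemma cheb_rmorph (S S' : pzRingType) (f : {rmorphism S -> S'}) (e : S) k :
  cheb (f e) k = (f (cheb e k).1, f (cheb e k).2).
Proof.
elim: k => [|k IH]; first by rewrite /= rmorph1 rmorph0.
by rewrite !chebS IH /= !rmorphD !rmorphM rmorphB rmorphXn rmorph1.
Qed.

(** At [2] both [t + sqrt 3 u] is a power of [2 + sqrt 3] and [t^2 - 3 u^2 = 1],
so [t] is at least half of that power. *)
Lemma cheb2_growth k : (2 + Num.sqrt 3) ^+ k <= 2 * (cheb (2 : R) k).1.
Proof.
set r := Num.sqrt 3; have r0 : 0 <= r by exact: sqrtr_ge0.
have r2 : r ^+ 2 = 3 by rewrite sqr_sqrtr.
set t := fun k => (cheb (2 : R) k).1; set u := fun k => (cheb (2 : R) k).2.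
have e : (2 + r) ^+ k = t k + r * u k.
  elim: k => [|k IH]; first by rewrite expr0 /t /u /= mulr0 addr0.
  rewrite exprS IH /t /u chebS /=; set a := (cheb _ _).1; set b := (cheb _ _).2.
  transitivity (2 * a + r ^+ 2 * b + r * (a + 2 * b)); first by ring.
  by rewrite r2; ring.
have pos : 0 <= t k /\ 0 <= u k.
  elim: k {e} => [|k [IH1 IH2]]; first by rewrite /t /u /=; split.
  move: IH1 IH2; rewrite /t /u chebS /=; set a := (cheb _ _).1; set b := (cheb _ _).2.
  by move=> a0 b0; split; lra.
have pell := cheb_pell (2 : R) k; rewrite -/(t k) -/(u k) in pell.
suff : r * u k <= t k by rewrite e /t; lra.
rewrite -(@ler_pXn2r _ 2) ?nnegrE ?mulr_ge0 //; [|by case: pos..].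
rewrite exprMn r2; lra.
Qed.

Lemma cheb_size (e : {poly R}) k : (size e <= 2)%N ->
  (size (cheb e k).1 <= k.+1)%N /\ (size (cheb e k).2 <= k)%N.
Proof.
move=> e2; elim: k => [|k [IH1 IH2]]; first by rewrite /= size_poly1 size_poly0.
rewrite chebS /=.
have sMM (p p' : {poly R}) m m' : (size p <= m)%N -> (size p' <= m')%N ->
    (size (p * p')%R <= (m + m').-1)%N.
  move=> pm p'm; apply: leq_trans (size_polyMleq _ _) _.
  by rewrite -!subn1 leq_sub2r // leq_add.
have sM (p : {poly R}) m : (size p <= m)%N -> (size (e * p)%R <= m.+1)%N.
  exact: (sMM _ _ 2).
have sE : (size (e ^+ 2 - 1)%R <= 3)%N.
  apply: leq_trans (size_polyD _ _) _; rewrite size_polyN size_poly1 geq_max andbT.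
  by rewrite expr2; exact: sM.
split; apply: leq_trans (size_polyD _ _) _; rewrite geq_max; apply/andP; split.
- exact: sM.
- exact: (sMM _ _ 3 k).
- by [].
- exact: sM.
Qed.

Lemma cheb_horner n (E : 'M[R]_n.+1) k :
  cheb E k = (horner_mx E (cheb ('X : {poly R}) k).1, horner_mx E (cheb ('X : {poly R}) k).2).
Proof.
by have := cheb_rmorph (horner_mx E) 'X k; rewrite /= (horner_mx_X E).
Qed.

Lemma cheb_pell_mx n (E : 'M[R]_n.+1) k :
  let P := (cheb E k).1 in let Q := (cheb E k).2 in
  P * P - (E * E - 1) * (Q * Q) = 1.
Proof.
rewrite cheb_horner /=; set p := (cheb _ k).1; set q := (cheb _ k).2.
transitivity (horner_mx E (p ^+ 2 - ('X ^+ 2 - 1) * q ^+ 2)).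
  have -> : p ^+ 2 - ('X ^+ 2 - 1) * q ^+ 2 = p * p - ('X * 'X - 1) * (q * q) by rewrite !expr2.
  rewrite (rmorphB (horner_mx E)) !(rmorphM (horner_mx E)) (rmorphB (horner_mx E)).
  rewrite (rmorphM (horner_mx E)) (rmorph1 (horner_mx E)).
  by rewrite /= horner_mx_X.
by rewrite cheb_pell rmorph1.
Qed.

(** Compares the decay rate [exp (- 2 / sqrt 3)] asked for with the Chebyshev rate
[1 / (2 + sqrt 3) = (sqrt 3 - 1) / (sqrt 3 + 1)]. *)
Lemma expR_2sqrt3 : expR (2 / Num.sqrt 3) <= 2 + Num.sqrt 3 :> R.
Proof.
set r := Num.sqrt 3; have r0 : 0 < r by rewrite sqrtr_gt0.
have r2 : r ^+ 2 = 3 by rewrite sqr_sqrtr.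
have r_le : r <= 7 / 4.
  rewrite -(@ler_pXn2r _ 2) ?nnegrE ?ltW // r2; lra.
have r_ge : 17 / 10 <= r.
  rewrite -(@ler_pXn2r _ 2) ?nnegrE ?ltW // r2; lra.
pose y := r / 12.
have -> : 2 / r = 8 * y.
  rewrite /y; apply: (mulfI (lt0r_neq0 r0)).
  rewrite mulrCA mulfV ?gt_eqF // (_ : r * (8 * (r / 12)) = r ^+ 2 * (8 / 12)); last by ring.
  rewrite r2; lra.
rewrite expRM_natl.
have h : expR y <= 27 / 23.
  have h := expR_ge1Dx (- y); rewrite expRN in h.
  rewrite -[leLHS]invrK -[leRHS]invrK lef_pV2 ?posrE ?invr_gt0 ?expR_gt0 //.
  apply: le_trans h; rewrite /y invf_div; lra.
have sq (a b : R) : 0 <= a -> a <= b -> a ^+ 2 <= b ^+ 2.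
  by move=> a0 ab; rewrite lerXn2r ?nnegrE // (le_trans a0).
have e8 : expR y ^+ 8 = ((expR y ^+ 2) ^+ 2) ^+ 2 by rewrite -!exprM.
have h2 : expR y ^+ 2 <= 18 / 13 by apply: le_trans (sq _ _ (expR_ge0 _) h) _; lra.
have h4 : (expR y ^+ 2) ^+ 2 <= 48 / 25 by apply: le_trans (sq _ _ (sqr_ge0 _) h2) _; lra.
by rewrite e8; apply: le_trans (sq _ _ (sqr_ge0 _) h4) _; lra.
Qed.

End ChebyshevBound.

Section Preconditioned.
Context {R : realType}.
Variables (n : nat) (A M : 'M[R]_n.+1).
Hypotheses (sA : A^T = A) (sM : M^T = M).
Hypothesis A0 : forall x, x != 0 -> 0 < qform A x.
Hypothesis lo : forall x, 2^-1 * qform A x <= qform M x.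
Hypothesis hi : forall x, qform M x <= 3 / 2 * qform A x.

Lemma posdef_unit m (B : 'M[R]_m) : (forall x, x != 0 -> 0 < qform B x) -> B \in unitmx.
Proof.
move=> B0; rewrite -unitmx_tr -row_free_unit -kermx_eq0; apply/eqP/row_matrixP => i.
rewrite row0; set v := row i _.
have vB : v *m B^T = 0 by apply/sub_kermxP; exact: row_sub.
apply/eqP; rewrite -trmx_eq0; apply/negPn/negP => /B0.
by rewrite /qform trmxK -[B]trmxK -mulmxA -trmx_mul vB trmx0 mulmx0 mxE ltxx.
Qed.

Lemma M_posdef x : x != 0 -> 0 < qform M x.
Proof. by move=> /A0 Ax; apply: lt_le_trans (lo x); lra. Qed.

Let N := invmx M *m A.
Let E : 'M[R]_n.+1 := 2%:M - (3 / 2) *: N.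

Let MN (y : 'cV[R]_n.+1) : M *m (N *m y) = A *m y.
Proof. by rewrite !mulmxA mulmxV ?mul1mx //; apply: posdef_unit M_posdef. Qed.

(** With [w = M^-1 A y], the comparison of [A] and [M] turns into one of
[y^T A y] and [w^T M w = y^T A M^-1 A y], by completing a square in [M] for one
side and in [A] for the other. *)
Let N_bounds (y : 'cV[R]_n.+1) : let b := hs (N *m y) (A *m y) in
  qform A y <= 3 / 2 * b /\ b <= 2 * qform A y.
Proof.
move=> b; set w := N *m y.
have bM : b = qform M w by rewrite qformE MN.
have bA : hs y (A *m w) = b by rewrite hsC hs_mulmx sA.
have bM' : hs y (M *m w) = qform A y by rewrite MN qformE.
have bM'' : hs w (M *m y) = qform A y by rewrite hsC hs_mulmx sM bM'.
have pos (B : 'M[R]_n.+1) z : (forall x, x != 0 -> 0 < qform B x) -> 0 <= qform B z.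
  by move=> B0; have [->|/B0/ltW//] := eqVneq z 0; rewrite qformE hs0l.
split.
  have := pos M (y - (3 / 2) *: w) M_posdef; have := hi y.
  rewrite !qformE mulmxBr -scalemxAr !(hsDl, hsDr, hsNl, hsNr, hsZl, hsZr).
  move: bM bM' bM''; rewrite !qformE => <- -> ->; lra.
have := pos A (y - 2^-1 *: w) A0; have := lo w; rewrite -bM.
rewrite !qformE mulmxBr -scalemxAr !(hsDl, hsDr, hsNl, hsNr, hsZl, hsZr) bA -/b; lra.
Qed.

Let adj (X : 'M[R]_n.+1) := X^T *m A = A *m X.

Let adjN : adj N.
Proof. by rewrite /adj /N trmx_mul trmx_inv sA sM mulmxA. Qed.

Let adjE : adj E.
Proof.
rewrite /adj /E linearB /= linearZ /= tr_scalar_mx mulmxBl mulmxBr -scalemxAl -scalemxAr.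
by rewrite adjN scalar_mxC.
Qed.

Let adjD X Y : adj X -> adj Y -> adj (X + Y).
Proof. by rewrite /adj => aX aY; rewrite linearD mulmxDl mulmxDr aX aY. Qed.

Let adjM X Y : adj X -> adj Y -> GRing.comm X Y -> adj (X * Y).
Proof.
by rewrite /adj => aX aY cXY; rewrite cXY -mulmxE trmx_mul -mulmxA aY mulmxA aX -mulmxA mulmxE cXY.
Qed.

Let ip (x y : 'cV[R]_n.+1) : R := hs x (A *m y).

Let ip_adj X x y : adj X -> ip (X *m x) y = ip x (X *m y).
Proof. by rewrite /ip hs_mulmx [X^T *m _]mulmxA => ->; rewrite mulmxA. Qed.

Let ipDl x y z : ip (x + y) z = ip x z + ip y z.
Proof. exact: hsDl. Qed.

Let ipNl x z : ip (- x) z = - ip x z.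
Proof. exact: hsNl. Qed.

Let ipZl a x z : ip (a *: x) z = a * ip x z.
Proof. exact: hsZl. Qed.

Let E_le1 (z : 'cV[R]_n.+1) : ip (E *m (E *m z)) z <= ip z z.
Proof.
have pm y : 0 <= ip y y - ip (E *m y) y /\ 0 <= ip y y + ip (E *m y) y.
  have := N_bounds y; rewrite /E mulmxBl mul_scalar_mx -scalemxAl ipDl ipNl !ipZl /ip -qformE.
  by move=> [h1 h2]; split; lra.
set z1 := E *m z; set z2 := E *m z1.
have [_ h1] := pm (z - z1); have [h2 _] := pm (z + z1).
have eC x y : ip x y = ip y x by rewrite /ip hsC hs_mulmx sA.
have e1 : ip z z1 = ip z1 z by rewrite eC.
have e2 : ip z1 z1 = ip z2 z by rewrite /z2 ip_adj.
have e3 : ip z1 z2 = ip z2 z1 by rewrite eC.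
have e4 : ip z z2 = ip z2 z by rewrite eC.
move: h1 h2; rewrite (mulmxDr E z (- z1)) (mulmxDr E z z1) mulmxN -/z1 -/z2.
move: e1 e2 e3 e4; clearbody z1 z2; rewrite /ip => e1 e2 e3 e4.
rewrite !mulmxDr !mulmxN !(hsDl, hsDr, hsNl, hsNr); lra.
Qed.

Let adj0 : adj 0.
Proof. by rewrite /adj trmx0 mul0mx mulmx0. Qed.

Let adj1 : adj 1.
Proof. by rewrite /adj trmx1 mul1mx mulmx1. Qed.

Let commE k : GRing.comm E (cheb E k).1 /\ GRing.comm E (cheb E k).2.
Proof.
have cE2 : GRing.comm E (E ^+ 2 - 1).
  by apply: commrB; [exact: commrX|exact: commr1].
elim: k => [|k [IH1 IH2]]; first by split; [exact: commr1|exact: commr0].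
rewrite chebS; split; apply: commrD => //; apply: commrM => //; exact: commr_refl.
Qed.

Let adj_cheb k : adj (cheb E k).1 /\ adj (cheb E k).2.
Proof.
elim: k => [|k [IH1 IH2]]; first by split; [exact: adj1|exact: adj0].
have [c1 c2] := commE k; rewrite chebS.
have aE2 : adj (E ^+ 2 - 1).
  rewrite /adj linearB /= mulmxBl mulmxBr trmx1 mul1mx mulmx1; congr (_ - _).
  by rewrite -/(adj _) expr2; apply: adjM => //; exact: commr_refl.
split; apply: adjD => //; apply: adjM => //.
by rewrite /GRing.comm mulrBl mulrBr mul1r mulr1 expr2 mulrA -c2 -!mulrA -c2.
Qed.

(** The Pell identity, read in the inner product of [A], bounds the residual
polynomial on the whole space without diagonalizing [M^-1 A]. *)
Lemma cheb_energy_le k c : qform A ((cheb E k).1 *m c) <= qform A c.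
Proof.
set P := (cheb E k).1; set Q := (cheb E k).2.
have [aP aQ] := adj_cheb k; have [cP cQ] := commE k.
have pell : P * P - (E * E - 1) * (Q * Q) = 1 by exact: cheb_pell_mx.
have pell' : P * P - Q * (E * (E * Q)) + Q * Q = 1.
  have EQ : E * E * (Q * Q) = Q * (E * (E * Q)).
    by rewrite !mulrA -cQ -(mulrA E Q E) -cQ !mulrA.
  by rewrite -EQ -[RHS]pell [in RHS]mulrBl mul1r opprB addrA addrAC.
have eC x y : ip x y = ip y x by rewrite /ip hsC hs_mulmx sA.
have -> : qform A c = ip (P *m c) (P *m c) - ip (E *m (E *m (Q *m c))) (Q *m c) +
    ip (Q *m c) (Q *m c).
  rewrite (ip_adj _ _ aP) [ip _ (Q *m c)]eC !(ip_adj _ _ aQ) qformE.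
  have ipDr x y z : ip z (x + y) = ip z x + ip z y by rewrite eC ipDl !(eC z).
  have ipNr x z : ip z (- x) = - ip z x by rewrite eC ipNl (eC z).
  rewrite -ipNr -!ipDr; congr (hs c (A *m _)).
  rewrite -[LHS]mul1mx -[1%:M]pell' mulmxDl mulmxBl -!mulmxE !mulmxA.
  by [].
rewrite qformE -/(ip _ _); have := E_le1 (Q *m c); lra.
Qed.

Lemma horner_mx_sum m (p : {poly R}) : (size p <= m)%N ->
  horner_mx N p = \sum_(i < m) p`_i *: N ^+ i.
Proof.
move=> pm; have -> : p = \sum_(i < m) p`_i *: 'X^i.
  rewrite -poly_def; apply/polyP => i; rewrite coef_poly; case: ltnP => // mi.
  by rewrite nth_default // (leq_trans pm).
rewrite rmorph_sum /=; apply: eq_bigr => i _.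
rewrite linearZ /= rmorphXn /= horner_mx_X; congr (_ *: _).
by rewrite -poly_def coef_poly ltn_ord.
Qed.

(** The error over the Krylov space can be [p(N) c] for any [p] of degree at most
[k] with [p(0) = 1]; the candidate comes from the shifted Chebyshev
polynomial, divided by its value at [0]. *)
Lemma krylov_candidate k (c y : 'cV[R]_n.+1) : A *m c = y ->
  exists2 x', x' \in krylov A M y (Posz k) &
    energy_norm A (x' - c) <= ((cheb (2 : R) k).1)^-1 * energy_norm A c.
Proof.
move=> Acy; set tau := (cheb (2 : R) k).1.
have tau0 : 0 < tau.
  have := @cheb2_growth R k; have : 0 < (2 + Num.sqrt 3 : R) ^+ k.
    by rewrite exprn_gt0 // ltr_wpDr ?sqrtr_ge0.
  by rewrite -/tau => g0 g; have := lt_le_trans g0 g; rewrite pmulr_rgt0.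
pose e : {poly R} := 2%:P - (3 / 2) *: 'X; pose p := (cheb e k).1.
have sp : (size p <= k.+1)%N.
  case: (@cheb_size _ e k) => //; apply: leq_trans (size_polyD _ _) _.
  rewrite size_polyN geq_max (leq_trans (size_polyC_leq1 _)) //.
  by rewrite (leq_trans (size_scale_leq _ _)) // size_polyX.
have EN : horner_mx N e = E.
  by rewrite /e rmorphB /= horner_mx_C linearZ /= horner_mx_X.
have PN : (cheb E k).1 = horner_mx N p.
  by have := cheb_rmorph (horner_mx N) e k; rewrite /= EN => ->.
have p0 : p`_0 = tau.
  rewrite -horner_coef0; have := cheb_rmorph (horner_eval (0 : R)) e k.
  have he : horner_eval (0 : R) e = 2 by rewrite /horner_eval /e !hornerE; ring.
  by rewrite /= he /tau => ->.
pose x' := - (tau^-1 *: \sum_(i < k) p`_i.+1 *: (N ^+ i *m (N *m c))).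
exists x'.
  rewrite /x' /krylov rpredN rpredZ // rpred_sum // => i _; rewrite rpredZ //.
  rewrite -Acy; apply: memv_span; apply/mapP; exists (nat_of_ord i).
    by rewrite mem_iota add0n ltn_ord.
  by rewrite /N !mulmxA.
have -> : x' - c = (- tau^-1) *: ((cheb E k).1 *m c).
  rewrite PN (horner_mx_sum sp) big_ord_recl p0 expr0 mulmxDl mulmx_suml.
  rewrite scalerDr -scalemxAl mul1mx scalerA mulNr mulVf ?gt_eqF // scaleN1r addrC.
  congr (_ + _); rewrite /x' scaleNr; congr (- (_ *: _)); apply: eq_bigr => i _.
  by rewrite -scalemxAl lift0 exprSr -mulmxE mulmxA.
have -> : energy_norm A (- tau^-1 *: ((cheb E k).1 *m c)) =
    tau^-1 * Num.sqrt (qform A ((cheb E k).1 *m c)).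
  rewrite /energy_norm -/(qform A _) qformE -scalemxAr hsZl hsZr mulrA mulrNN -expr2 -qformE.
  by rewrite sqrtrM ?sqr_ge0 // sqrtr_sqr ger0_norm // invr_ge0 ltW.
apply: ler_wpM2l; first by rewrite invr_ge0 ltW.
apply: ler_wsqrtr; exact: cheb_energy_le.
Qed.



(** With condition number [3] the classical bound [2 ((sqrt 3 - 1) / (sqrt 3 + 1)) ^ k]
drops below [eps] after [sqrt 3 / 2 * ln (2 / eps)] steps. *)
Lemma pcg_converges (c y : 'cV[R]_n.+1) (eps : R) (t : int) : A *m c = y -> 0 < eps ->
  Num.sqrt 3 / 2 * ln (2 / eps) <= t%:~R ->
  exists x, pcg_iterate A M y t x /\ energy_norm A (x - c) <= eps * energy_norm A c.
Proof.
move=> Acy e0 ht.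
have cE : invmx A *m y = c by rewrite -Acy mulKmx // posdef_unit.
have [x xK xmin] := span_minimizer sA A0
  [seq (invmx M *m A) ^+ j *m (invmx M *m y) | j <- iota 0 (if t is Posz m then m else 0)] c.
exists x; split.
  split; rewrite ?cE // => x' x'K; rewrite /energy_norm ler_wsqrtr //.
  exact: xmin.
pose k := if t is Posz m then m else 0%N.
have kt : Num.sqrt 3 / 2 * ln (2 / eps) <= k%:R.
  apply: le_trans ht _; rewrite /k; case: (t) => m //=.
  by rewrite NegzE mulrNz lerNl oppr0 ler0n.
have [x' x'K x'le] := krylov_candidate k Acy.
have xx' : energy_norm A (x - c) <= energy_norm A (x' - c).
  rewrite /energy_norm ler_wsqrtr //; apply: xmin; move: x'K; rewrite /krylov /k.
  by [].
apply: le_trans xx' (le_trans x'le _); rewrite ler_wpM2r ?sqrtr_ge0 //.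
have g0 : 0 < (2 + Num.sqrt 3 : R) ^+ k.
  by rewrite exprn_gt0 // ltr_wpDr ?sqrtr_ge0.
have g1 : 2 / eps <= (2 + Num.sqrt 3) ^+ k.
  apply: le_trans (_ : expR (2 / Num.sqrt 3) ^+ k <= _); last first.
    by rewrite lerXn2r ?nnegrE ?expR_ge0 ?addr_ge0 ?sqrtr_ge0 // expR_2sqrt3.
  rewrite -expRM_natl -[leLHS]lnK ?posrE ?divr_gt0 // ler_expR.
  have r0 : 0 < Num.sqrt 3 :> R by rewrite sqrtr_gt0.
  rewrite mulrA ler_pdivlMr //; move: kt; lra.
have g2 := @cheb2_growth R k.
have tau0 : 0 < (cheb (2 : R) k).1 by have := lt_le_trans g0 g2; rewrite pmulr_rgt0.
rewrite -[eps]invrK lef_pV2 ?posrE ?invr_gt0 //.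
rewrite ler_pdivrMr // in g1; rewrite -div1r ler_pdivrMr //.
have := ler_wpM2r (ltW e0) g2; lra.
Qed.

End Preconditioned.

Lemma pcg_converges_pos (R : realType) n (A M : 'M[R]_n) (c y : 'cV[R]_n) (eps : R) (t : int) :
  (0 < n)%N -> A^T = A -> M^T = M -> (forall x, x != 0 -> 0 < qform A x) ->
  (forall x, 2^-1 * qform A x <= qform M x /\ qform M x <= 3 / 2 * qform A x) ->
  A *m c = y -> 0 < eps -> Num.sqrt 3 / 2 * ln (2 / eps) <= t%:~R ->
  exists x, pcg_iterate A M y t x /\ energy_norm A (x - c) <= eps * energy_norm A c.
Proof.
case: n A M c y => // n A M c y _ sA sM A0 bnd; apply: pcg_converges => // x.
  by case: (bnd x).
by case: (bnd x).
Qed.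

(** * Congruence to the identity and the statistical dimension *)

Section Congruence.
Context {R : realType}.

(** Cholesky: one step of elimination on a block matrix, the Schur complement
being positive definite again. *)
Lemma cholesky n (A : 'M[R]_n) : A^T = A -> (forall x, x != 0 -> 0 < qform A x) ->
  exists L : 'M[R]_n, L *m A *m L^T = 1%:M.
Proof.
elim: n A => [|n IH] A sA A0; first by exists 1%:M; apply/matrixP => -[].
change 'M[R]_(1 + n) in A.
have {}A0 : forall x : 'cV[R]_(1 + n), x != 0 -> 0 < qform A x := A0.
pose a := A 0 0; pose b : 'rV[R]_n := ursubmx A.
pose D : 'M[R]_n := drsubmx A.
have sD : D^T = D by rewrite /D trmx_drsub sA.
have AE : A = block_mx a%:M b b^T D.
  rewrite -[A in LHS]submxK; congr block_mx.
    by apply/matrixP => i j; rewrite !ord1 !mxE eqxx mulr1n; congr (A _ _); apply: val_inj.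
  by rewrite /b trmx_ursub sA.
have qA (u : 'cV[R]_1) (v : 'cV[R]_n) : qform A (col_mx u v) =
    a * hs u u + 2 * hs u (b *m v) + qform D v.
  rewrite !qformE AE mul_block_col /hs tr_col_mx mul_row_col mxtraceD !mulmxDr !mxtraceD.
  rewrite mul_scalar_mx -scalemxAr mxtraceZ.
  have -> : \tr (v^T *m (b^T *m u)) = \tr (u^T *m (b *m v)).
    by rewrite mulmxA -trmx_mul; exact: hsC.
  by ring.
have a0 : 0 < a.
  have := A0 (col_mx (1%:M : 'cV[R]_1) (0 : 'cV[R]_n)); rewrite qA mulmx0 qformE hs0l (hsC _ 0) hs0l mulr0 !addr0.
  rewrite /hs trmx1 mul1mx mxtrace1 mulr1; apply.
  by rewrite col_mx_eq0 negb_and oner_neq0.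
pose S := D - a^-1 *: (b^T *m b).
have sS : S^T = S by rewrite /S linearB linearZ /= trmx_mul trmxK sD.
have S0 v : v != 0 -> 0 < qform S v.
  move=> v0; have := A0 (col_mx (- a^-1 *: (b *m v)) v); rewrite qA.
  rewrite hsZl hsZr hsZl /S qformD qformN qformZ qform_gram => h.
  suff -> : qform D v - a^-1 * hs (b *m v) (b *m v) =
    a * (- a^-1 * (- a^-1 * hs (b *m v) (b *m v))) +
      2 * (- a^-1 * hs (b *m v) (b *m v)) + qform D v.
    by apply: h; rewrite col_mx_eq0 negb_and v0 orbT.
  have -> : a * (- a^-1 * (- a^-1 * hs (b *m v) (b *m v))) =
      (a * a^-1) * (a^-1 * hs (b *m v) (b *m v)) by ring.
  by rewrite mulfV ?gt_eqF //; ring.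
have [L' hL'] := IH S sS S0.
pose s := (Num.sqrt a)^-1.
have s2 : s * a * s = 1.
  have r0 : Num.sqrt a != 0 by rewrite gt_eqF // sqrtr_gt0.
  have ra : a = Num.sqrt a * Num.sqrt a by rewrite -expr2 sqr_sqrtr // ltW.
  by rewrite /s [X in _ * X * _]ra mulKf // mulfV.
suff : exists L : 'M[R]_(1 + n), L *m A *m L^T = 1%:M by [].
exists (block_mx s%:M 0 (- a^-1 *: (L' *m b^T)) L').
have aV : a^-1 * a = 1 by rewrite mulVf ?gt_eqF.
rewrite AE mulmx_block tr_block_mx mulmx_block !mul0mx !addr0 tr_scalar_mx trmx0.
rewrite !mulmx0 !addr0 -!scalar_mxM s2.
have z1 : - a^-1 *: (L' *m b^T) *m a%:M + L' *m b^T = 0.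
  by rewrite mul_mx_scalar scalerA mulrN mulrC aV scaleN1r addNr.
rewrite z1 !mul0mx !add0r.
have -> : - a^-1 *: (L' *m b^T) *m b + L' *m D = L' *m S.
  by rewrite /S mulmxBr addrC -scalemxAl -scalemxAr mulmxA scaleNr.
rewrite hL'.
have -> : (s * a)%:M *m (- a^-1 *: (L' *m b^T))^T + s%:M *m b *m L'^T = 0.
  rewrite linearZ /= trmx_mul trmxK !mul_scalar_mx scalerA -scalemxAl.
  by rewrite mulrN -mulrA (mulrC a) aV mulr1 scaleNr addNr.
by rewrite -scalar_mx_block.
Qed.

Variables (n N : nat) (V : 'M[R]_(n, N)) (lambda : R) (L : 'M[R]_n).
Hypothesis lambda0 : 0 < lambda.
Let K := V *m V^T.
Let A := K + lambda%:M.
Hypothesis hL : L *m A *m L^T = 1%:M.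

Lemma congr_inverse : L^T *m L *m A = 1%:M.
Proof.
by have := hL; rewrite -mulmxA => /mulmx1C; rewrite -(mulmxA A) => /mulmx1C.
Qed.

Lemma congr_surj (z : 'cV[R]_n) : L^T *m (L *m (A *m z)) = z.
Proof. by rewrite !mulmxA congr_inverse mul1mx. Qed.

Lemma qform_congr (x : 'cV[R]_n) : qform A (L^T *m x) = hs x x.
Proof. by rewrite -qform_sandwich hL qform_scalar mul1r. Qed.

Lemma statistical_dimE : statistical_dim lambda K = hs (L *m V) (L *m V).
Proof.
have Au : A \in unitmx by case/mulmx1_unit: congr_inverse.
rewrite /statistical_dim -/A.
have -> : invmx A = L^T *m L by rewrite -[RHS]mulmx1 -(mulmxV Au) mulmxA congr_inverse mul1mx.
by rewrite hs_trE trmx_mul -[_ *m K]mulmxA [LHS]mxtrace_mulC /K !mulmxA.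
Qed.

Lemma congr_gram_le1 : qform_le ((L *m V) *m (L *m V)^T) 1%:M.
Proof.
move=> x; rewrite trmx_mul mulmxA -(mulmxA L) -/K qform_sandwich qform_scalar mul1r.
rewrite -qform_congr /A qformD lerDl qform_scalar mulr_ge0 ?hs_ge0 ?ltW //.
Qed.

(** If the statistical dimension were below [1/2], then [K] would lie below
[sl / (1 - sl) * lambda < lambda] in all directions. *)
Lemma statistical_dim_ge_half : lambda <= spectral_norm K ->
  2^-1 <= hs (L *m V) (L *m V).
Proof.
move=> lK; set sl := hs _ _; rewrite leNgt; apply/negP => sl2.
have sl0 : 0 <= sl by exact: hs_ge0.
pose rho := sl * lambda / (1 - sl).
have d0 : 0 < 1 - sl by lra.
have rho0 : 0 <= rho by rewrite divr_ge0 ?(ltW d0) // mulr_ge0 ?(ltW lambda0).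
have rhol : rho < lambda.
  by rewrite ltr_pdivrMr //; have := ltr_pM2r lambda0 sl 2^-1; rewrite sl2 => h; lra.
have Kle z : qform K z <= rho * hs z z.
  have h : qform K z <= sl * qform A z.
    rewrite -(congr_surj z); set x := L *m _.
    rewrite qform_congr -qform_sandwich.
    have := gram_le_trace (L *m V) x; by rewrite trmx_mul mulmxA -(mulmxA L).
  rewrite /rho mulrAC ler_pdivlMr //; move: h; rewrite /A qformD qform_scalar; lra.
have Kn (z : 'cV[R]_n) : hs (K *m z) (K *m z) <= rho ^+ 2 * hs z z.
  have [->|m0] := eqVneq (K *m z) 0; first by rewrite hs0l mulr_ge0 ?sqr_ge0 ?hs_ge0.
  have m1 := hs_gt0 m0; set m := hs _ _ in m1 *.
  rewrite -(ler_pM2r m1).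
  have -> : m * m = hs (V^T *m z) (V^T *m (K *m z)) ^+ 2.
    by rewrite -expr2 hsC hs_mulmx trmxK mulmxA.
  apply: le_trans (hs_cauchy _ _) _; rewrite -!qform_gram_tr -/K.
  apply: le_trans (ler_pM _ _ (Kle z) (Kle (K *m z))) _.
  - by rewrite /K qform_gram_tr hs_ge0.
  - by rewrite /K qform_gram_tr hs_ge0.
  - by rewrite expr2 -/m; lra.
suff : spectral_norm K <= rho by lra.
apply: ge_sup; first by exists (l2norm (K *m 0)), 0; rewrite //= /l2norm mulmx0 mxE sqrtr0 ler01.
move=> _ [z /= z1 <-]; rewrite /l2norm in z1 *.
have e (u : 'cV[R]_n) : (u^T *m u) 0 0 = hs u u by rewrite /hs trace_mx11.
rewrite !e in z1 *; have z2 : hs z z <= 1.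
  by rewrite -(sqr_sqrtr (hs_ge0 z)) exprn_ile1 ?sqrtr_ge0 //.
rewrite -[rho]ger0_norm // -sqrtr_sqr ler_wsqrtr //; apply: le_trans (Kn z) _.
by rewrite ler_piMr ?sqr_ge0.
Qed.

(** In the coordinates where [A] is the identity, an error of [1/2] in the Gram
matrix means a preconditioner between [A / 2] and [3 A / 2]. *)
Lemma preconditioner_bounds m (Z : 'M[R]_(n, m)) :
  (forall x, `|qform ((L *m Z) *m (L *m Z)^T - (L *m V) *m (L *m V)^T) x| <= 2^-1 * hs x x) ->
  forall z, 2^-1 * qform A z <= qform (Z *m Z^T + lambda%:M) z /\
            qform (Z *m Z^T + lambda%:M) z <= 3 / 2 * qform A z.
Proof.
move=> h z; rewrite -(congr_surj z); set x := L *m _.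
have := h x; have := hs_ge0 (L^T *m x).
have e (p : nat) (W : 'M[R]_(n, p)) : qform ((L *m W) *m (L *m W)^T) x = qform (W *m W^T) (L^T *m x).
  by rewrite trmx_mul mulmxA -(mulmxA L) qform_sandwich.
have := qform_congr x; rewrite /A !qformD qformN !e -/K qform_scalar ler_norml.
by move=> <- h0 /andP[h1 h2]; split; lra.
Qed.

End Congruence.

Section KernelGram.
Context {R : realType}.

Lemma tensor_power_dot d q (x z : 'cV[R]_d) :
  hs (tensor_power q x) (tensor_power q z) = poly_kernel q x z.
Proof.
rewrite hsE (reindex _ (onW_bij _ (@enum_rank_bij _))) /=.
transitivity (\sum_(I : {ffun 'I_q -> 'I_d}) \prod_(j < q) (x (I j) 0 * z (I j) 0)).
  by apply: eq_bigr => I _; rewrite big_ord1 !mxE enum_rankK big_split.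
rewrite -(bigA_distr_bigA (fun (j : 'I_q) i => x i 0 * z i 0)) prodr_const card_ord.
by rewrite /poly_kernel mxE; congr (_ ^+ _); apply: eq_bigr => i _; rewrite mxE.
Qed.

Definition feature_mx n d q (x : 'I_n -> 'cV[R]_d) : 'M[R]_(n, #|{ffun 'I_q -> 'I_d}|) :=
  \matrix_(i, I) tensor_power q (x i) I 0.

Lemma kernel_matrixE n d q (x : 'I_n -> 'cV[R]_d) :
  kernel_matrix q x = feature_mx q x *m (feature_mx q x)^T.
Proof.
apply/matrixP => i j; rewrite !mxE -tensor_power_dot hsE.
by apply: eq_bigr => I _; rewrite big_ord1 !mxE.
Qed.

Lemma feature_sketch n d q s (x : 'I_n -> 'cV[R]_d)
    (S : 'M[R]_(s, #|{ffun 'I_q -> 'I_d}|)) :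
  feature_mx q x *m S^T = \matrix_(i, r) (S *m tensor_power q (x i)) r 0.
Proof.
apply/matrixP => i r; rewrite !mxE; apply: eq_bigr => I _.
by rewrite [RHS]mulrC !mxE.
Qed.

End KernelGram.

(** * Random elements with finitely many values *)

Section FiniteLaws.
Context {R : realType} {disp : measure_display} {T : measurableType disp}.
Variable P : probability T R.

Definition pr (A : set T) : R := fine (P A).

Lemma prE A : measurable A -> P A = (pr A)%:E.
Proof. by move=> mA; rewrite /pr fineK // fin_num_measure. Qed.

Lemma pr_ge0 A : 0 <= pr A.
Proof. exact: fine_ge0. Qed.

Lemma prU A B : measurable A -> measurable B -> A `&` B = set0 ->
  pr (A `|` B) = pr A + pr B.
Proof.
move=> mA mB AB; rewrite /pr measureU // fineD // fin_num_measure //.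
Qed.

Lemma pr_le A B : measurable A -> measurable B -> A `<=` B -> pr A <= pr B.
Proof. by move=> mA mB AB; rewrite -lee_fin -!prE // le_measure // inE. Qed.

Variables (U : finType) (X : T -> U).
Hypothesis mX : forall u, measurable (X @^-1` [set u]).

Lemma fin_measurable (a : set U) : measurable (X @^-1` a).
Proof.
have -> : X @^-1` a = \bigcup_(u in a) (X @^-1` [set u]).
  by apply/seteqP; split => [w aw|w [u au /= ->]] //; exists (X w).
apply: fin_bigcup_measurable => // .
Qed.

Definition law (u : U) : R := pr (X @^-1` [set u]).

Lemma law_ge0 u : 0 <= law u.
Proof. exact: pr_ge0. Qed.

Lemma pr_law (a : U -> bool) : pr [set w | a (X w)] = \sum_u (a u)%:R * law u.
Proof.
have h (r : seq U) : uniq r -> pr [set w | X w \in r] = \sum_(u <- r) law u.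
  elim: r => [|u r IH] /=.
    by move=> _; rewrite big_nil /pr (_ : [set w | _] = set0) ?measure0 // -subset0 => w.
  move=> /andP[ur ru]; rewrite big_cons -IH // /law -prU //.
  - by congr (pr _); apply/seteqP; split => w /=; rewrite inE => /predU1P.
  - exact: (fin_measurable [set v | v \in r]).
  - by rewrite -subset0 => w [/= -> ]; rewrite (negbTE ur).
rewrite (eq_bigr (fun u => if a u then law u else 0)); last first.
  by move=> u _; case: (a u); rewrite ?mul1r ?mul0r.
rewrite -big_mkcond -big_filter -h ?filter_uniq ?index_enum_uniq //.
congr (pr _); apply/seteqP; split => w /=; rewrite mem_filter.
  by move=> ->; rewrite mem_index_enum.
by case/andP.
Qed.

Lemma sum_law : \sum_u law u = 1.
Proof.
have := pr_law (fun _ => true); under eq_bigr do rewrite mul1r.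
move=> <-; rewrite /pr (_ : [set _ | _] = setT) ?probability_setT //.
by apply/seteqP; split.
Qed.

End FiniteLaws.

Section Independence.
Context {R : realType} {disp : measure_display} {T : measurableType disp}.
Variable P : probability T R.

(** A random choice between finitely many values [X w] is fixed first; the
event in the independent [Y] may then depend on that value. Different codes in
[C] may give the same [X], so each value is counted at one chosen code. *)
Lemma indep2_conditional_le (C : finType) (U V : Type) (code : T -> C) (Phi : C -> U)
    (X : T -> U) (Y : T -> V) (G : U -> bool) (D : U -> set V) (e : R) :
  random_element code -> random_element Y -> (forall w, X w = Phi (code w)) ->
  indep2 P X Y -> (forall c, G (Phi c) -> pr P (Y @^-1` D (Phi c)) <= e) -> 0 <= e ->
  let E := [set w | G (X w) /\ D (X w) (Y w)] in measurable E /\ pr P E <= e.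
Proof.
move=> mcode mY XE ind De e0 E.
pose rep c := odflt c [pick c' | `[< Phi c' = Phi c >]].
have repE c : Phi (rep c) = Phi c.
  by rewrite /rep; case: pickP => [c' /asboolP|].
have rep_eq c c' : Phi c = Phi c' -> rep c = rep c'.
  move=> h; rewrite /rep.
  have -> : [pick c0 | `[< Phi c0 = Phi c >]] = [pick c0 | `[< Phi c0 = Phi c' >]].
    by apply: eq_pick => c0; rewrite /= h.
  by case: pickP => // /(_ c'); case: asboolP.
pose psi w := rep (code w).
have mpsi u : measurable (psi @^-1` [set u]) by exact: (mcode (rep @^-1` [set u])).
have psiX w c : rep c = c -> (psi w == c) = `[< X w = Phi c >].
  move=> cc; apply/eqP/asboolP => [<-|h]; first by rewrite XE repE.
  by rewrite /psi -cc; apply: rep_eq; rewrite -h XE.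
have mX u : measurable (X @^-1` [set u]).
  have -> : X @^-1` [set u] = code @^-1` [set c | Phi c = u].
    by apply/seteqP; split => w /=; rewrite XE.
  exact: mcode.
pose F c := if G (Phi c) then psi @^-1` [set c] `&` Y @^-1` D (Phi c) else set0.
have mF c : measurable (F c).
  by rewrite /F; case: ifP => // _; apply: measurableI => //; exact: mY.
have EF : E = [set w | F (psi w) w].
  apply/seteqP; split => w /=; rewrite /F /psi repE -XE.
    by move=> [-> Dw].
  by case: ifP => // Gw [_ Dw].
have h (r : seq C) : uniq r -> measurable [set w | psi w \in r /\ F (psi w) w] /\
    pr P [set w | psi w \in r /\ F (psi w) w] <= \sum_(c <- r) law P psi c * e.
  elim: r => [|c r IH] /=.
    rewrite (_ : [set w | _] = set0); last by apply/seteqP; split => w //= [].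
    by rewrite big_nil /pr measure0.
  move=> /andP[cr /IH[m1 h1]].
  have -> : [set w | psi w \in c :: r /\ F (psi w) w] =
      F c `|` [set w | psi w \in r /\ F (psi w) w].
    apply/seteqP; split => w /=.
      by rewrite inE => -[/predU1P[<-|]]; [left|right].
    move=> [Fc|[wr Fw]]; last by rewrite inE wr orbT.
    have <- : psi w = c by move: Fc; rewrite /F; case: ifP => // _ [].
    rewrite mem_head; split => //.
    by have <- : c = psi w by move: Fc; rewrite /F; case: ifP => // _ [].
  split; first exact: measurableU.
  rewrite prU //; last first.
    rewrite -subset0 => w [Fc [wr _]]; move: Fc wr; rewrite /F; case: ifP => // _ [/= -> _].
    by rewrite (negbTE cr).
  rewrite big_cons lerD // /F; case: ifPn => [Gc|_]; last first.
    by rewrite /pr measure0 mulr_ge0 // law_ge0.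
  have [cc|cc] := eqVneq (rep c) c; last first.
    rewrite (_ : psi @^-1` [set c] = set0) ?set0I /pr ?measure0 ?mulr_ge0 ?law_ge0 //.
    apply/seteqP; split => w //= pc; case/eqP: cc; rewrite -pc /psi.
    by apply: rep_eq; rewrite repE.
  have -> : psi @^-1` [set c] = X @^-1` [set Phi c].
    apply/seteqP; split => w /= h.
      by apply/asboolP; rewrite -psiX // h.
    by apply/eqP; rewrite psiX //; apply/asboolP.
  have := ind [set Phi c] (D (Phi c)); rewrite /pr => ->.
  rewrite fineM; [|exact: fin_num_measure (mX _)|exact: fin_num_measure (mY _)].
  rewrite /law /pr (_ : psi @^-1` [set c] = X @^-1` [set Phi c]).
    by apply: ler_wpM2l (De c Gc); exact: pr_ge0.
  apply/seteqP; split => w /= h.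
    by apply/asboolP; rewrite -psiX // h.
  by apply/eqP; rewrite psiX //; apply/asboolP.
have := h (index_enum C) (index_enum_uniq _).
have -> : [set w | psi w \in index_enum C /\ F (psi w) w] = E.
  by rewrite EF; apply/seteqP; split => w /=; rewrite mem_index_enum // => -[].
by rewrite -mulr_suml sum_law // mul1r.
Qed.

Lemma uniform_ffun_law (I B : finType) (X : T -> {ffun I -> B}) :
  (forall i, uniform P (fun w => X w i)) -> mutual_indep P (fun i w => X w i) ->
  forall f, law P X f = #|{ffun I -> B}|%:R^-1.
Proof.
move=> uX iX f; have := iX [set: I]%SET (fun i => [set f i]).
rewrite /law /pr (_ : [set w | _] = X @^-1` [set f]) => [->|]; last first.
  apply/seteqP; split => w /= h; first by apply/ffunP => i; apply: h; rewrite inE.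
  by move=> i _; rewrite h.
under eq_bigr => i _ do rewrite uX.
rewrite prodEFin /= (eq_bigl xpredT); last by move=> i; rewrite inE.
by rewrite prodr_const card_ffun natrX exprVn.
Qed.

End Independence.

(** * Laws of the hash and sign functions *)

Section HashLaws.
Context {R : realType} {disp : measure_display} {T : measurableType disp}.
Variable P : probability T R.

Lemma kwise_pr k (I : finType) (B : finType) (X : T -> {ffun I -> B}) (J : {set I})
    (b : I -> B) :
  (forall i, uniform P (fun w => X w i)) -> kwise_indep P k (fun i w => X w i) ->
  (#|J| <= k)%N ->
  pr P [set w | [forall i in J, X w i == b i]] = (#|B|%:R^-1) ^+ #|J|.
Proof.
move=> uX kX Jk; have := kX J Jk (fun i => [set b i]); rewrite /pr.
rewrite (_ : [set w | _] = [set w | [forall i in J, X w i == b i]]) => [->|]; last first.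
  apply/seteqP; split => w /= h.
    by apply/forall_inP => i iJ; apply/eqP; exact: h.
  by move=> i iJ; apply/eqP; move/forall_inP: h; apply.
by under eq_bigr => i _ do rewrite uX; rewrite prodEFin /= prodr_const.
Qed.

Lemma random_elementP (U : finType) (X : T -> U) :
  random_element X -> forall u, measurable (X @^-1` [set u]).
Proof. by move=> mX u; exact: mX. Qed.

Lemma pairwise_hash_law d s (h : T -> {ffun 'I_d -> 'I_s}) :
  random_element h -> (forall i, uniform P (fun w => h w i)) ->
  kwise_indep P 3 (fun i w => h w i) -> pairwise_hash (law P h).
Proof.
move=> mh uh kh; split; [exact: law_ge0|exact: sum_law (random_elementP mh)|].
move=> i i' b b' ii'.
under eq_bigr do rewrite mulrC; rewrite -(pr_law P (random_elementP mh)).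
have := kwise_pr (J := [set i; i']%SET) (fun k => if k == i then b else b') uh kh.
rewrite cards2 ii' card_ord => <- //; congr pr; apply/seteqP; split => w /=.
  move=> /andP[/eqP hi /eqP hi']; apply/forall_inP => k; rewrite !inE => /orP[]/eqP->.
    by rewrite eqxx hi.
  by rewrite [i' == i]eq_sym (negbTE ii') hi'.
move=> /forall_inP hJ; have := hJ i; have := hJ i'.
by rewrite !inE !eqxx orbT [i' == i]eq_sym (negbTE ii') => -> // ->.
Qed.

Section Signs.
Variables (d : nat) (g : T -> {ffun 'I_d -> bool}).
Hypothesis mg : random_element g.
Hypothesis ug : forall i, uniform P (fun w => g w i).
Hypothesis kg : kwise_indep P 4 (fun i w => g w i).
Local Notation mean F := (\sum_f law P g f * (F : {ffun 'I_d -> bool} -> R) f).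

Let ones (J : {set 'I_d}) (f : {ffun 'I_d -> bool}) : R := [forall i in J, f i]%:R.

Let mean_ones (J : {set 'I_d}) : (#|J| <= 4)%N -> mean (ones J) = 2^-1 ^+ #|J|.
Proof.
move=> J4; under eq_bigr do rewrite mulrC; rewrite -(pr_law P (random_elementP mg)).
have := kwise_pr (fun=> true) ug kg J4; rewrite card_bool => <-.
congr pr; apply/seteqP; split => w /=; move=> /forall_inP hJ; apply/forall_inP => i iJ.
  by rewrite hJ.
by have := hJ i iJ; move/eqP.
Qed.

(** Write the sign as [1 - 2 b]: imposing [b] on top of the event [ones J] halves its
probability. *)
Let mean_sign_ones x (J : {set 'I_d}) : x \notin J -> (#|J| <= 3)%N ->
  mean (fun f => (-1) ^+ f x * ones J f) = 0.
Proof.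
move=> xJ J3.
have xJ4 : (#|x |: J| <= 4)%N by rewrite cardsU1 xJ add1n.
have e (f : {ffun 'I_d -> bool}) : (-1) ^+ f x * ones J f = ones J f - 2 * ones (x |: J) f.
  have -> : ones (x |: J) f = (f x)%:R * ones J f.
    rewrite -natrM mulnb; congr ((nat_of_bool _)%:R); apply/forall_inP/andP.
      move=> h; split; first by rewrite h // setU11.
      by apply/forall_inP => i iJ; rewrite h // !inE iJ orbT.
    by move=> [fx /forall_inP h] i; rewrite !inE => /orP[/eqP->|/h].
  by case: (f x); rewrite /= ?expr0 ?expr1; ring.
under eq_bigr => f _ do rewrite e mulrBr mulrCA.
rewrite sumrB -mulr_sumr !mean_ones ?(leq_trans J3) //.
by rewrite cardsU1 xJ add1n exprS mulrA mulfV ?mul1r ?subrr.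
Qed.

Let mean_signs0 x y z t : x != y -> x != z -> x != t ->
  mean (fun f => (-1) ^+ f x * (-1) ^+ f y * ((-1) ^+ f z * (-1) ^+ f t)) = 0.
Proof.
move=> xy xz xt.
have expand (f : {ffun 'I_d -> bool}) :
    law P g f * ((-1) ^+ f x * (-1) ^+ f y * ((-1) ^+ f z * (-1) ^+ f t)) =
    law P g f * ((-1) ^+ f x * ones finset.set0 f)
    - 2 * (law P g f * ((-1) ^+ f x * ones [set y]%SET f))
    - 2 * (law P g f * ((-1) ^+ f x * ones [set z]%SET f))
    - 2 * (law P g f * ((-1) ^+ f x * ones [set t]%SET f))
    + 4 * (law P g f * ((-1) ^+ f x * ones [set y; z]%SET f))
    + 4 * (law P g f * ((-1) ^+ f x * ones [set y; t]%SET f))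
    + 4 * (law P g f * ((-1) ^+ f x * ones [set z; t]%SET f))
    - 8 * (law P g f * ((-1) ^+ f x * ones [set y; z; t]%SET f)).
  have o0 : ones finset.set0 f = 1.
    by rewrite /ones (_ : [forall i in _, _] = true) //; apply/forall_inP => i; rewrite inE.
  have o1 a : ones [set a]%SET f = (f a)%:R.
    congr ((nat_of_bool _)%:R); apply/forall_inP/idP => [h|fa i]; first by rewrite h // inE.
    by rewrite inE => /eqP->.
  have o2 a b : ones [set a; b]%SET f = (f a)%:R * (f b)%:R.
    rewrite -natrM mulnb; congr ((nat_of_bool _)%:R); apply/forall_inP/andP.
      by move=> h; split; rewrite h // !inE eqxx ?orbT.
    by move=> [fa fb] i; rewrite !inE => /orP[]/eqP->.
  have o3 a b c : ones [set a; b; c]%SET f = (f a)%:R * (f b)%:R * (f c)%:R.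
    rewrite -!natrM !mulnb; congr ((nat_of_bool _)%:R); apply/forall_inP/idP.
      by move=> h; apply/andP; split; [apply/andP; split|]; rewrite h // !inE eqxx ?orbT.
    by move=> /andP[/andP[fa fb] fc] i; rewrite !inE => /orP[/orP[]|]/eqP->.
  rewrite o0 !o1 !o2 o3; case: (f y); case: (f z); case: (f t);
    rewrite /= ?expr0 ?expr1; ring.
under eq_bigr do rewrite expand.
have c2 (a b : 'I_d) : (#|[set a; b]%SET| <= 3)%N by rewrite cards2; case: (_ != _).
have c3 : (#|[set y; z; t]%SET| <= 3)%N.
  rewrite finset.setUC; apply: leq_trans (leq_card_setU _ _) _; rewrite cards1 add1n ltnS.
  by rewrite cards2; case: (_ != _).
rewrite !(big_split, sumrN) /= -!mulr_sumr.
rewrite !mean_sign_ones ?cards0 ?cards1 ?inE ?negb_or ?xy ?xz ?xt //.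
by rewrite !mulr0 oppr0 !addr0.
Qed.

(** If the four indices do not pair up, one of them occurs once and its sign
averages out. *)
Lemma fourwise_sign_law : fourwise_sign (law P g).
Proof.
split; first exact: law_ge0.
case=> [[a b] [c e]] /=; have sq (f : {ffun 'I_d -> bool}) i : (-1) ^+ f i * (-1) ^+ f i = 1 :> R.
  by rewrite -expr2 sqrr_sign.
have one F : (forall f : {ffun 'I_d -> bool}, F f = 1) -> mean F = 1.
  by move=> F1; under eq_bigr do rewrite F1 mulr1; exact: sum_law (random_elementP mg).
have perm F F' : (forall f : {ffun 'I_d -> bool}, F f = F' f) -> mean F' = 0 -> mean F = 0.
  by move=> FF h; rewrite -[RHS]h; apply: eq_bigr => f _; rewrite FF.
(* One of the four indices differs from the three others, unless they pair up. *)
have alone_a : a != b -> a != c -> a != e -> mean (fun f =>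
    (-1) ^+ f a * (-1) ^+ f b * ((-1) ^+ f c * (-1) ^+ f e)) = 0 by exact: mean_signs0.
have alone_b : b != a -> b != c -> b != e -> mean (fun f =>
    (-1) ^+ f a * (-1) ^+ f b * ((-1) ^+ f c * (-1) ^+ f e)) = 0.
  by move=> *; apply: perm (@mean_signs0 b a c e _ _ _) => // f; ring.
have alone_c : c != e -> c != a -> c != b -> mean (fun f =>
    (-1) ^+ f a * (-1) ^+ f b * ((-1) ^+ f c * (-1) ^+ f e)) = 0.
  by move=> *; apply: perm (@mean_signs0 c e a b _ _ _) => // f; ring.
have alone_e : e != c -> e != a -> e != b -> mean (fun f =>
    (-1) ^+ f a * (-1) ^+ f b * ((-1) ^+ f c * (-1) ^+ f e)) = 0.
  by move=> *; apply: perm (@mean_signs0 e c a b _ _ _) => // f; ring.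
rewrite /paired /=; have [ab|ab] := eqVneq a b.
  have [ce|ce] /= := eqVneq c e.
    by apply: one => f; rewrite ab ce !sq mulr1.
  have [ac|ac] := eqVneq a c.
    have be : (b == e) = false by rewrite -ab ac (negbTE ce).
    have ae : (a == e) = false by rewrite ac (negbTE ce).
    by rewrite be ae /=; apply: alone_e; rewrite ?[e == _]eq_sym ?be ?ae // eq_sym.
  have ca : c != a by rewrite eq_sym.
  have bc : (b == c) = false by rewrite -ab (negbTE ac).
  by rewrite bc andbF /=; apply: alone_c; rewrite // eq_sym ?bc.
have ba : b != a by rewrite eq_sym.
have [ac|ac] /= := eqVneq a c.
  have [be|be] /= := eqVneq b e.
    by apply: one => f; rewrite ac be mulrACA !sq mulr1.
  have bc : b != c by rewrite -ac.
  by rewrite (negbTE bc) andbF; exact: alone_b.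
have [ae|ae] /= := eqVneq a e.
  have [bc|bc] /= := eqVneq b c; last by apply: alone_b; rewrite -?ae.
  by apply: one => f; rewrite ae bc mulrA -(mulrA ((-1) ^+ f e)) sq mulr1 sq.
exact: alone_a.
Qed.

End Signs.
End HashLaws.

(** * Joint laws and good events *)

Section Assembly.
Context {R : realType} {disp : measure_display} {T : measurableType disp}.
Variable P : probability T R.

Lemma random_element_pair (U V : finType) (X : T -> U) (Y : T -> V) :
  random_element X -> random_element Y -> random_element (fun w => (X w, Y w)).
Proof.
move=> mX mY; apply: fin_measurable => -[u v].
have -> : (fun w => (X w, Y w)) @^-1` [set (u, v)] = X @^-1` [set u] `&` Y @^-1` [set v].
  by apply/seteqP; split => w /= [-> ->].
by apply: measurableI; [exact: mX|exact: mY].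
Qed.

Lemma random_element_ffun (I B : finType) (X : I -> T -> B) :
  (forall i, random_element (X i)) -> random_element (fun w => [ffun i => X i w]).
Proof.
move=> mX; apply: fin_measurable => f.
have -> : (fun w => [ffun i => X i w]) @^-1` [set f] = \bigcap_i (X i @^-1` [set f i]).
  apply/seteqP; split => w /=; first by move=> <- i _; rewrite /= ffunE.
  by move=> h; apply/ffunP => i; rewrite ffunE; exact: h.
apply: fin_bigcap_measurable => // i _; exact: mX.
Qed.

Section SketchLaw.
Variables (d q s : nat) (h : 'I_q -> T -> {ffun 'I_d -> 'I_s})
  (g : 'I_q -> T -> {ffun 'I_d -> bool}).
Hypotheses (mh : forall j, random_element (h j)) (mg : forall j, random_element (g j)).
Hypothesis hg : mutual_indep P (hash_sign_family h g).

Definition sketch_code w : {ffun 'I_q -> {ffun 'I_d -> 'I_s}} * {ffun 'I_q -> {ffun 'I_d -> bool}} :=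
  ([ffun j => h j w], [ffun j => g j w]).

Lemma sketch_code_random : random_element sketch_code.
Proof. by apply: random_element_pair; exact: random_element_ffun. Qed.

Lemma sketch_code_law c : law P sketch_code c =
  (\prod_j law P (h j) (c.1 j)) * (\prod_j law P (g j) (c.2 j)).
Proof.
case: c => eta gam.
pose A (i : 'I_q + 'I_q) : set {ffun 'I_d -> if i is inl _ then 'I_s else bool} :=
  match i with inl j => [set eta j] | inr j => [set gam j] end.
have := hg [set: 'I_q + 'I_q]%SET A.
rewrite (_ : [set w | _] = sketch_code @^-1` [set (eta, gam)]); last first.
  apply/seteqP; split => w /=.
    move=> hA; congr pair; apply/ffunP => j; rewrite ffunE.
      by have := hA (inl j); rewrite inE => /(_ isT).
    by have := hA (inr j); rewrite inE => /(_ isT).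
  by move=> [e1 e2] [] j _; rewrite /A /= -?e1 -?e2 ffunE.
have inT i : (i \in [set: 'I_q + 'I_q]%SET) = true by rewrite inE.
rewrite (eq_bigl _ _ inT)
 big_sumType /= {1}/law /pr => ->.
have -> : (\prod_j P (h j @^-1` [set eta j]) = (\prod_j law P (h j) (eta j))%:E)%E.
  by rewrite -prodEFin; apply: eq_bigr => j _; apply: prE; exact: mh.
have -> : (\prod_j P (g j @^-1` [set gam j]) = (\prod_j law P (g j) (gam j))%:E)%E.
  by rewrite -prodEFin; apply: eq_bigr => j _; apply: prE; exact: mg.
by [].
Qed.

Lemma pr_sketch (a : {ffun 'I_q -> {ffun 'I_d -> 'I_s}} -> {ffun 'I_q -> {ffun 'I_d -> bool}} -> bool) :
  pr P [set w | a (sketch_code w).1 (sketch_code w).2] =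
  sketch_mean (fun j => law P (h j)) (fun j => law P (g j)) (fun eta gam => (a eta gam)%:R).
Proof.
rewrite (pr_law P (random_elementP sketch_code_random) (fun c => a c.1 c.2)).
rewrite /sketch_mean pair_bigA; apply: eq_bigr => c _.
by rewrite sketch_code_law mulrC.
Qed.

End SketchLaw.

Section SrhtLaw.
Variables (s m : nat) (b : T -> {ffun 'I_m -> bool}) (p : T -> {ffun 'I_s -> 'I_m}).
Hypotheses (mb : random_element b) (mp : random_element p).
Hypothesis ub : forall i, uniform P (fun w => b w i).
Hypothesis ib : mutual_indep P (fun i w => b w i).
Hypothesis up : forall i, uniform P (fun w => p w i).
Hypothesis ip : mutual_indep P (fun i w => p w i).
Hypothesis bp : indep2 P b p.

Lemma pr_srht (a : {ffun 'I_m -> bool} -> {ffun 'I_s -> 'I_m} -> bool) :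
  pr P [set w | a (b w) (p w)] = avg (fun e => avg (fun r => (a e r)%:R)).
Proof.
have mbp := random_element_pair mb mp.
rewrite (pr_law P (random_elementP mbp) (fun c => a c.1 c.2)).
have lawE c : law P (fun w => (b w, p w)) c =
    #|{ffun 'I_m -> bool}|%:R^-1 * #|{ffun 'I_s -> 'I_m}|%:R^-1.
  rewrite -(uniform_ffun_law ub ib c.1) -(uniform_ffun_law up ip c.2) /law /pr -fineM.
  - rewrite -bp; congr (fine (P _)); apply/seteqP; split => w /=; first by move=> <-.
    by case: c => c1 c2 /= [-> ->].
  - by apply: fin_num_measure; exact: mb.
  - by apply: fin_num_measure; exact: mp.
rewrite /avg -mulr_suml pair_bigA mulr_suml mulr_suml; apply: eq_bigr => c _.
by rewrite lawE mulrA mulrAC.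
Qed.

End SrhtLaw.
End Assembly.

Section SampledForm.
Context {R : realType}.

Lemma srht_sample_outer n k s (B : 'M[R]_(n, 2 ^ k)) (b : {ffun 'I_(2 ^ k) -> bool})
    (p : {ffun 'I_s -> 'I_(2 ^ k)}) :
  let S := (Num.sqrt s%:R)^-1 *: (sampling_mx p *m hadamard k *m sign_mx b) in
  (B *m S^T) *m (B *m S^T)^T = sample_outer (mixed_col B b) p.
Proof.
move=> S; have -> : B *m S^T = (Num.sqrt s%:R)^-1 *: (mixed B b *m (sampling_mx p)^T).
  by rewrite /S linearZ /= -scalemxAr !trmx_mul sign_mx_sym /mixed !mulmxA.
rewrite linearZ /= -scalemxAl -scalemxAr scalerA -invfM -expr2 sqr_sqrtr ?ler0n //.
rewrite /sample_outer -sum_outer_col; congr (_ *: _); apply: eq_bigr => i _.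
congr outer; apply/colP => l; rewrite /mixed_col !mxE (bigD1 (p i)) //= big1 ?addr0.
  by rewrite !mxE eqxx mulr1.
by move=> j jp; rewrite !mxE (negbTE jp) mulr0.
Qed.

Lemma qform_hs_le n (D : 'M[R]_n) (th : R) : 0 <= th -> hs D D <= th ^+ 2 ->
  forall x, `|qform D x| <= th * hs x x.
Proof.
move=> th0 hD x; have xx := hs_ge0 x.
rewrite -(@ler_pXn2r _ 2) ?nnegrE ?mulr_ge0 // real_normK ?num_real //.
rewrite qformE exprMn; apply: le_trans (hs_cauchy _ _) _.
rewrite [X in _ <= _ * X]expr2 mulrCA ler_wpM2l //.
by apply: le_trans (hs_mulmx_le _ _) _; rewrite ler_wpM2r.
Qed.

End SampledForm.

Section GoodEvents.
Context {R : realType}.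
Variables (n m N : nat) (B : 'M[R]_(n, N)) (B1 : 'M[R]_(n, m)).

Hypothesis B_le1 : qform_le (B *m B^T) 1%:M.
Hypothesis good : good_sketch B B1.

Lemma good_sketch_qform x :
  `|qform (B1 *m B1^T - B *m B^T) x| <= 4^-1 * hs x x.
Proof.
case/andP: good => h _; apply: qform_hs_le => //.
by apply: le_trans h _; lra.
Qed.

Lemma good_sketch_le2 : qform_le (B1 *m B1^T) 2%:M.
Proof.
move=> x; have := good_sketch_qform x; have := B_le1 x; have := hs_ge0 x.
rewrite qformD qformN !qform_scalar ler_norml => h0 h1 /andP[h2 h3]; lra.
Qed.

Lemma good_sketch_energy : hs B1 B1 <= hs B B + 2^-1.
Proof.
case/andP: good => _; rewrite linearB /= -!hs_trE => h.
have : `|hs B1 B1 - hs B B| <= 2^-1.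
  rewrite -(@ler_pXn2r _ 2) ?nnegrE // real_normK ?num_real //.
  by apply: le_trans h _; lra.
rewrite ler_norml => /andP[_]; lra.
Qed.

End GoodEvents.

(** * The convergence theorem *)

Section MainStep.
Context {R : realType} {disp : measure_display} {T : measurableType disp}.
Variable P : probability T R.
Variables (n d q k s2 : nat) (x : 'I_n -> 'cV[R]_d) (L : 'M[R]_n).
Variables (phi : T -> 'cV[R]_d -> 'cV[R]_(2 ^ k)) (S2 : T -> 'M[R]_(s2, 2 ^ k)).
Let V := feature_mx q x.

(** The sketched feature matrix in the coordinates where [A] is the identity. It is
a function of the random map [f] alone, which is what the independence of
the two stages refers to. *)
Definition sketched (f : 'cV[R]_d -> 'cV[R]_(2 ^ k)) : 'M[R]_(n, 2 ^ k) :=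
  L *m \matrix_(i, r) f (x i) r 0.

Lemma sketched_tensor (S : 'M[R]_(2 ^ k, #|{ffun 'I_q -> 'I_d}|)) :
  sketched (fun z => S *m tensor_power q z) = (L *m V) *m S^T.
Proof. by rewrite /sketched -feature_sketch mulmxA. Qed.

Definition bad_srht (f : 'cV[R]_d -> 'cV[R]_(2 ^ k)) : set 'M[R]_(s2, 2 ^ k) :=
  [set S | ~ forall z, `|qform ((sketched f *m S^T) *m (sketched f *m S^T)^T -
                              sketched f *m (sketched f)^T) z| <= 4^-1 * hs z z].

Hypothesis LV_le1 : qform_le ((L *m V) *m (L *m V)^T) 1%:M.

Lemma srht_random : is_srht P S2 -> random_element S2.
Proof.
move=> [b [p [[mb mp] _ _ _ SE]]] A.
pose Sf (c : {ffun 'I_(2 ^ k) -> bool} * {ffun 'I_s2 -> 'I_(2 ^ k)}) : 'M[R]_(s2, 2 ^ k) :=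
  (Num.sqrt s2%:R)^-1 *: (sampling_mx c.2 *m hadamard k *m sign_mx c.1).
have -> : S2 @^-1` A = (fun w => (b w, p w)) @^-1` (Sf @^-1` A).
  by apply/seteqP; split => w /=; rewrite SE.
exact: random_element_pair.
Qed.

Lemma srht_event_le (f : 'cV[R]_d -> 'cV[R]_(2 ^ k)) (e : nat) (delta : R) :
  is_srht P S2 -> (0 < s2)%N -> 2^-1 <= hs (L *m V) (L *m V) ->
  good_sketch (L *m V) (sketched f) ->
  (let r := (2 ^ e)%N in
   let M := 2 * (2 * hs (L *m V) (L *m V) + 4 * r%:R * 2) in
   let a := 4 * r%:R * M / s2%:R in
   64 ^+ r * ((a ^+ 2 + 4 * a * 2) ^+ r.-1 * (2 * a * M)) + 16 * (M / 2 ^+ r)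
      <= 3 / 8 * delta) ->
  pr P (S2 @^-1` bad_srht f) <= 3 / 8 * delta.
Proof.
move=> [b [p [[mb mp] [ub ib] [up ip] bp SE]]] s20 sl2 good hpar.
have -> : S2 @^-1` bad_srht f = [set w | bad_sample (mixed_col (sketched f) (b w)) (p w)].
  apply/seteqP; split => w; rewrite /bad_srht /bad_sample /= /sample_dev mean_mixed SE srht_sample_outer;
    by case: asboolP.
rewrite (pr_srht mb mp ub ib up ip bp (fun e r => bad_sample (mixed_col (sketched f) e) r)).
apply: le_trans hpar; apply: srht_failure => //.
- apply: le_trans (good_sketch_energy good) _; lra.
- exact: (good_sketch_le2 LV_le1 good).
- have : 0 <= (2 ^ e)%:R :> R by rewrite ler0n.
  lra.
Qed.

(** Besides the failure bound, the random map is exhibited as a function of a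
random element of a finite type, as needed to condition on it. *)
Lemma sketch_event_le (delta : R) : 0 < delta ->
  is_tensor_sketch P q phi ->
  32 * (2 + 3 ^+ q) * hs (L *m V) (L *m V) ^+ 2 / delta <= (2 ^ k)%:R ->
  exists (code : T -> {ffun 'I_q -> {ffun 'I_d -> 'I_(2 ^ k)}} * {ffun 'I_q -> {ffun 'I_d -> bool}})
    (Phi : _ -> 'cV[R]_d -> 'cV[R]_(2 ^ k)),
  [/\ random_element code, forall w, phi w = Phi (code w) &
      pr P [set w | ~~ good_sketch (L *m V) (sketched (phi w))] <= 5 / 8 * delta].
Proof.
move=> d0 [h [g [[mh mg] hh hg ind phiE]]] hs1.
pose Phi (c : {ffun 'I_q -> {ffun 'I_d -> 'I_(2 ^ k)}} * {ffun 'I_q -> {ffun 'I_d -> bool}})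
  (z : 'cV[R]_d) : 'cV[R]_(2 ^ k) := tensor_sketch_mx c.1 c.2 *m tensor_power q z.
have phiPhi w : phi w = Phi (sketch_code h g w).
  apply/funext => z; rewrite phiE /Phi; congr (tensor_sketch_mx _ _ *m _).
    by apply/funext => j; rewrite ffunE.
  by apply/funext => j; rewrite ffunE.
exists (sketch_code h g), Phi; split => //; first exact: sketch_code_random.
have -> : [set w | ~~ good_sketch (L *m V) (sketched (phi w))] =
    [set w | ~~ good_sketch (L *m V) ((L *m V) *m
      (tensor_sketch_mx (sketch_code h g w).1 (sketch_code h g w).2)^T)].
  apply/seteqP; split => w /=; rewrite phiPhi /Phi sketched_tensor //.
rewrite (pr_sketch mh mg ind (fun eta gam =>
  ~~ good_sketch (L *m V) ((L *m V) *m (tensor_sketch_mx eta gam)^T))); apply: sketch_failure => //.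
- by rewrite expn_gt0.
- by move=> j; have [uh kh] := hh j; exact: pairwise_hash_law.
- by move=> j; have [ug kg] := hg j; exact: fourwise_sign_law.
Qed.

End MainStep.

Theorem theorem6 (R : realType) :
  exists C : R, 0 < C /\
  forall (n d q : nat) (x : 'I_n -> 'cV[R]_d) (y : 'cV[R]_n)
         (lambda eps delta : R),
  (1 <= n)%N -> (1 <= d)%N -> (1 <= q)%N ->
  0 < lambda -> 0 < eps -> 0 < delta < 1 ->
  let K := kernel_matrix q x in
  let s_lambda := statistical_dim lambda K in
  let A := K + lambda%:M in
  lambda <= spectral_norm K ->
  forall (disp : measure_display) (T : measurableType disp)
         (P : probability T R) (k s2 : nat)
         (phi : T -> 'cV[R]_d -> 'cV[R]_(2 ^ k))
         (S2 : T -> 'M[R]_(s2, 2 ^ k)),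
  is_tensor_sketch P q phi ->
  32 * (2 + 3 ^+ q) * s_lambda ^+ 2 / delta <= (2 ^ k)%:R ->
  is_srht P S2 ->
  indep2 P phi S2 ->
  C * s_lambda * ln (2 + s_lambda) / delta ^+ 2 <= s2%:R ->
  let Z2 (w : T) : 'M[R]_(n, s2) :=
    \matrix_(i, j) (S2 w *m phi w (x i)) j 0 in
  forall c : 'cV[R]_n, A *m c = y ->
  with_probability_ge P (1 - delta)
    [set w | exists ctilde : 'cV[R]_n,
       pcg_iterate A (Z2 w *m (Z2 w)^T + lambda%:M) y
         (Num.ceil (Num.sqrt 3 / 2 * ln (2 / eps))) ctilde /\
       energy_norm A (ctilde - c) <= eps * energy_norm A c].
Proof.
exists (2560 * (4 * (2 * 64 * (100 * 64)))); split; first by lra.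
move=> n d q x y lambda eps delta n1 d1 q1 l0 e0 d01 K sl A lK disp T P k s2 phi S2.
move=> hphi hs1 hS2 ind hs2 Z2 c Acy.
have d0 : 0 < delta by case/andP: d01.
set V := feature_mx q x; have KE : K = V *m V^T by exact: kernel_matrixE.
have AE : A = V *m V^T + lambda%:M by rewrite /A KE.
have sA : A^T = A by rewrite AE linearD /= tr_scalar_mx trmx_mul trmxK.
have A0 z : z != 0 -> 0 < qform A z.
  move=> z0; rewrite AE qformD qform_gram_tr qform_scalar.
  by rewrite ltr_wpDl ?hs_ge0 // mulr_gt0 // hs_gt0.
have [L hL] := cholesky sA A0; rewrite AE in hL.
have slE : sl = hs (L *m V) (L *m V) by rewrite /sl KE (statistical_dimE hL).
have sl2 : 2^-1 <= hs (L *m V) (L *m V).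
  by apply: (statistical_dim_ge_half l0 hL); rewrite -KE.
have le1 := congr_gram_le1 l0 hL.
rewrite slE in hs1 hs2.
have [s20 [e hpar]] := srht_parameters erefl sl2 d01 hs2.
have [code [Phi [mcode phiE sk]]] := sketch_event_le d0 hphi hs1.
pose good w := good_sketch (L *m V) (sketched x L (phi w)).
pose E1 := [set w | ~~ good w].
pose E2 := [set w | good w /\ bad_srht x L (phi w) (S2 w)].
have mS2 : random_element S2.
  exact: srht_random hS2.
have [mE2 pE2] : measurable E2 /\ pr P E2 <= 3 / 8 * delta.
  apply: (indep2_conditional_le mcode mS2 phiE ind (G := fun f => good_sketch (L *m V) (sketched x L f))
      (D := bad_srht x L)).
    move=> cc gc; exact: (srht_event_le le1 hS2 s20 sl2 gc hpar).
  by rewrite mulr_ge0 // ltW.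
have mcodeS (Q : ('cV[R]_d -> 'cV[R]_(2 ^ k)) -> 'M[R]_(s2, 2 ^ k) -> Prop) :
    measurable [set w | Q (phi w) (S2 w)].
  rewrite (_ : [set w | _] = \bigcup_cc (code @^-1` [set cc] `&` S2 @^-1` Q (Phi cc))).
    apply: fin_bigcup_measurable => // cc _; apply: measurableI; [exact: mcode|exact: mS2].
  apply/seteqP; split => w /=; first by move=> Qw; exists (code w); rewrite //= -phiE.
  by move=> [cc _ [/= <- ]]; rewrite -phiE.
have mE1 : measurable E1 by exact: (mcodeS (fun f _ => ~~ good_sketch (L *m V) (sketched x L f))).
set G0 := [set w | exists ctilde, _].
have mG0 : measurable G0.
  exact: (mcodeS (fun f S => exists ctilde : 'cV[R]_n,
    pcg_iterate A ((\matrix_(i, j) (S *m f (x i)) j 0 : 'M[R]_(n, s2)) *m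
      (\matrix_(i, j) (S *m f (x i)) j 0 : 'M[R]_(n, s2))^T + lambda%:M) y
      (Num.ceil (Num.sqrt 3 / 2 * ln (2 / eps))) ctilde /\
    energy_norm A (ctilde - c) <= eps * energy_norm A c)).
have sub : ~` G0 `<=` E1 `|` E2.
  move=> w nG; have [gw|] := boolP (good w); last by left.
  right; split=> // H2; apply: nG.
  have LZ : L *m Z2 w = sketched x L (phi w) *m (S2 w)^T.
    rewrite /sketched -mulmxA; congr (L *m _); apply/matrixP => i j.
    by rewrite !mxE; apply: eq_bigr => r _; rewrite !mxE mulrC.
  have H1 := good_sketch_qform gw.
  (* Each stage contributes [1/4] to the error of the Gram matrix. *)
  have H z : `|qform ((L *m Z2 w) *m (L *m Z2 w)^T - (L *m V) *m (L *m V)^T) z| <= 2^-1 * hs z z.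
    have := H1 z; have := H2 z; rewrite LZ !qformD !qformN !ler_norml.
    by move=> /andP[h1 h2] /andP[h3 h4]; apply/andP; split; lra.
  have bnd := preconditioner_bounds hL H; rewrite -AE in bnd.
  have sM : (Z2 w *m (Z2 w)^T + lambda%:M)^T = Z2 w *m (Z2 w)^T + lambda%:M.
    by rewrite linearD /= tr_scalar_mx trmx_mul trmxK.
  by apply: (pcg_converges_pos n1 sA sM A0 bnd Acy e0); rewrite real_ceil_ge // num_real.
split => //.
have p1 : pr P (~` G0) <= delta.
  apply: le_trans (pr_le _ _ _ sub) _; [exact: measurableC|exact: measurableU|].
  rewrite prU //; last by rewrite -subset0 => w [/= ngw [gw _]]; exact: (negP ngw gw).
  by have : pr P E1 <= 5 / 8 * delta; [exact: sk|lra].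
have pT : pr P G0 + pr P (~` G0) = 1.
  rewrite -prU ?setUv ?setICr //; last exact: measurableC.
  by rewrite /pr probability_setT.
by rewrite prE // lee_fin; lra.
Qed.
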